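(* Let $B>0$ and let $\mathbf{G}=\mathbf{G}(a,b)$ with $(a,b)\in\mathbb{C}^2\setminus\{(0,0)\}$. For each $(X,T)\in\mathbb{R}^2$ there exists a unique solution $\mathbf{P}(\Lambda;X,T,\mathbf{G},B)$ of the Riemann-Hilbert problem stated in the context, and the solution depends real-analytically on $(X,T)\in\mathbb{R}^2$ and on the real and imaginary parts of the parameters $a,b$.
   Context: Notation: $*$ is complex conjugation (entrywise on matrices); $\sigma_3=\mathrm{diag}(1,-1)$; $\mathrm{e}^{f\sigma_3}=\mathrm{diag}(\mathrm{e}^{f},\mathrm{e}^{-f})$. For $(a,b)\in\mathbb{C}^2\setminus\{(0,0)\}$ let $$\mathbf{G}(a,b)=\frac{1}{\sqrt{|a|^2+|b|^2}}\begin{bmatrix}a & b^*\\ -b & a^*\end{bmatrix}$$ (this is the general form of a $2\times2$ matrix with $\det(\mathbf{G})=1$ and $\mathbf{G}^*=\sigma_2\mathbf{G}\sigma_2$, $\sigma_2=\begin{bmatrix}0&-\mathrm{i}\\ \mathrm{i}&0\end{bmatrix}$). Riemann-Hilbert problem: given $(X,T)\in\mathbb{R}^2$, $B>0$ and $\mathbf{G}$, find a $2\times2$ matrix function $\mathbf{P}(\Lambda;X,T,\mathbf{G},B)$ such that: (i) it is analytic in $\Lambda$ for $|\Lambda|\neq1$ and takes continuous boundary values on the unit circle from the interior and from the exterior; (ii) writing $\mathbf{P}_+$ (resp. $\mathbf{P}_-$) for the boundary value on $|\Lambda|=1$ from the exterior (resp. interior), $$\mathbf{P}_+=\mathbf{P}_-\,\mathrm{e}^{-\mathrm{i}(\Lambda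 X+\Lambda^2T+2B\Lambda^{-1})\sigma_3}\,\mathbf{G}\,\mathrm{e}^{\mathrm{i}(\Lambda X+\Lambda^2T+2B\Lambda^{-1})\sigma_3},\quad|\Lambda|=1;$$ (iii) $\mathbf{P}\to\mathbb{I}$ as $\Lambda\to\infty$. *)

(* Defs.v *)
From HB Require Import structures.
From mathcomp Require Import all_boot all_order all_algebra.
From mathcomp Require Import complex.
From mathcomp Require Import all_classical all_reals all_analysis.

Set Implicit Arguments.
Unset Strict Implicit.
Unset Printing Implicit Defensive.

Import Order.TTheory GRing.Theory Num.Theory.
Import numFieldNormedType.Exports.

Local Open Scope classical_set_scope.
Local Open Scope complex_scope.
Local Open Scope ring_scope.

Section Complex.
Variable R : realType.
Local Notation C := R[i].
Local Notation Re := (@complex.Re R).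
Local Notation Im := (@complex.Im R).

Definition cexp (z : C) : C :=
  (expR (Re z))%:C * (cos (Im z) +i* sin (Im z)).

Definition mx2 (a b c d : C) : 'M[C]_2 :=
  \matrix_(i, j) if i == 0 then (if j == 0 then a else b)
                 else (if j == 0 then c else d).

Definition exp_sigma3 (f : C) : 'M[C]_2 := mx2 (cexp f) 0 0 (cexp (- f)).

(* The norm `|z| of a complex number is itself an element of C, so the square
   root is the one of C; its argument is a nonnegative real. *)
Definition Gmx (a b : C) : 'M[C]_2 :=
  (sqrtC (`|a| ^+ 2 + `|b| ^+ 2))^-1 *: mx2 a (Num.conj b) (- b) (Num.conj a).

Definition phase (X T B : R) (z : C) : C :=
  z * X%:C + z ^+ 2 * T%:C + 2 * B%:C * z^-1.

Definition unit_circle : set C := [set z | `|z| = 1].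
Definition interior_disk : set C := [set z | `|z| < 1].
Definition exterior_disk : set C := [set z | 1 < `|z|].

(* Neighbourhoods of the point at infinity of the Riemann sphere; the library
   filter +oo would only see the positive real half-line of C. *)
Definition cinfty : set_system C :=
  [set A : set C | exists M : R, forall z : C, M%:C < `|z| -> A z].

(* C^o is C as a normed module over itself: derivability in the direction 1
   is complex differentiability. *)
Definition mx_analytic (D : set C) (P : C -> 'M[C]_2) : Prop :=
  forall i j (z : C), D z -> derivable ((fun w => P w i j) : C^o -> C^o) z 1.

(* [P] takes the continuous boundary values [Q] on the unit circle from [D]. *)
Definition boundary_values (D : set C) (P Q : C -> 'M[C]_2) : Prop :=
  forall i j,
    {within (unit_circle : set C^o),
       continuous ((fun w => Q w i j) : C^o -> C^o)} /\
    forall z : C, unit_circle z ->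
      (P w i j : C^o) @[w --> within D (nbhs (z : C^o))] --> (Q z i j : C^o).

(* The values of [P] on the unit circle itself are unconstrained. *)
Definition RHP_solution (X T : R) (G : 'M[C]_2) (B : R) (P : C -> 'M[C]_2) :
    Prop :=
  [/\ mx_analytic [set z | `|z| != 1] P,
      exists Pp Pm : C -> 'M[C]_2,
        [/\ boundary_values exterior_disk P Pp,
            boundary_values interior_disk P Pm
          & forall z : C, unit_circle z ->
              Pp z = Pm z *m exp_sigma3 (- ('i * phase X T B z))
                          *m G *m exp_sigma3 ('i * phase X T B z)]
    & forall i j, (P w i j : C^o) @[w --> cinfty] --> ((1%:M : 'M[C]_2) i j : C^o)].

Definition monomial n (alpha : {ffun 'I_n -> nat}) (h : 'rV[R]_n) : R :=
  \prod_(k < n) h 0 k ^+ alpha k.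

(* On a cube around x0, f is the sum of an absolutely convergent power series
   in the n real variables.  By absolute convergence the order of summation
   is immaterial; partial sums are taken over alpha in {0, ..., N-1}^n. *)
Definition real_analytic_at n (f : 'rV[R]_n -> C) (x0 : 'rV[R]_n) : Prop :=
  exists (c : {ffun 'I_n -> nat} -> C) (r : R), 0 < r /\
    forall h : 'rV[R]_n, (forall k, `|h 0 k| < r) ->
      summable [set: {ffun 'I_n -> nat}]
        (fun alpha => (Re `|c alpha| * monomial alpha h)%:E) /\
      ((\sum_(beta : {ffun 'I_n -> 'I_N})
          let alpha := [ffun k => nat_of_ord (beta k)] in
          c alpha * (monomial alpha h)%:C) : C^o)
        @[N --> \oo] --> (f (x0 + h) : C^o).

Definition real_analytic_on n (U : set 'rV[R]_n) (f : 'rV[R]_n -> C) : Prop :=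
  forall x, U x -> real_analytic_at f x.

(* Coordinates on parameter space: v = (X, T, Re a, Im a, Re b, Im b). *)
Definition par_X (v : 'rV[R]_6) : R := v 0 0.
Definition par_T (v : 'rV[R]_6) : R := v 0 1.
Definition par_a (v : 'rV[R]_6) : C := v 0 2 +i* v 0 3.
Definition par_b (v : 'rV[R]_6) : C := v 0 4 +i* v 0 5.

End Complex.

(* Main.v *)
(* Uniqueness: det P has no jump, so it is an entire function with value 1 at
   infinity (a function continuous on C and holomorphic off the unit circle is
   entire, by Goursat's theorem and the constancy of circle means); hence det P = 1,
   and Q P^-1 has no jump either and equals the identity.

   Existence: on the circle the jump V has absolutely summable Laurent
   coefficients, so the problem reads "find p in l1(N) such that p V has prescribed
   nonnegative coefficients".  Up to a contraction this is a finite linear system.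
   Its injectivity is Zhou's vanishing lemma, which applies because G is unitary of
   determinant 1, so that V(z* )^dagger = V(z)^-1.

   Analyticity: near a base point v0 with solution P0, consider
   F = P0 V_v V_v0^-1 P0^-1 in the Banach algebra of Laurent series in z whose
   coefficients are absolutely convergent power series in v - v0.  F is 1 at v0, so
   after shrinking the polydisc it is close to 1 and factors as E F = 1 + O with E
   analytic inside and O outside the circle.  Then E P0 inside and (1 + O) P0 outside
   solve the problem at v, and their coefficients are power series in v - v0. *)
From HB Require Import structures.
From mathcomp Require Import all_boot all_order all_algebra.
From mathcomp Require Import complex.
From mathcomp Require Import all_classical all_reals all_analysis.
From mathcomp Require Import finmap ring lra.
Require Import Defs.

Set Implicit Arguments.
Unset Strict Implicit.
Unset Printing Implicit Defensive.

Import Order.TTheory GRing.Theory Num.Theory.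
Import numFieldNormedType.Exports.

Local Open Scope classical_set_scope.
Local Open Scope complex_scope.
Local Open Scope ring_scope.

(** * Absolutely summable complex families *)

Section Norm.
Variable R : realType.
Local Notation C := R[i].
Local Notation Re := (@complex.Re R).
Local Notation Im := (@complex.Im R).
Implicit Types z w : C.

(** The Cauchy projections of the usual theory become truncations of an index set. On families with
    absolutely summable coefficients, splitting a function on the circle into its interior and
    exterior parts has norm at most 1, the pointwise product is convolution, and both parts extend
    continuously to the circle. One convolution algebra over an arbitrary commutative monoid serves
    power series, Laurent series and Laurent series with parameters; evaluation at a point is
    summation against a character. Two obstacles shape the rest. That an entire function vanishing
    at infinity is zero is obtained in logarithmic polar coordinates: all moments of the function
    over a circle vanish, while the powers of (1 + cos y)/2 concentrate at a point. And the
    normalisation of G contains the square root of |a|^2 + |b|^2, whose analyticity is obtained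
    inside the algebra as a fixed point. All infinite-dimensional equations are solved by one
    contraction principle. The estimates need real numbers, hence the real-valued [nrm]. *)

Definition nrm z : R := Re `|z|.

Lemma nrmE z : `|z| = (nrm z)%:C.
Proof. by rewrite /nrm normc_def. Qed.

Lemma nrm_ge0 z : 0 <= nrm z.
Proof. by have := normr_ge0 z; rewrite nrmE lecR. Qed.

Lemma nrm0 : nrm 0 = 0.
Proof. by rewrite /nrm normr0. Qed.

Lemma nrm1 : nrm 1 = 1.
Proof. by rewrite /nrm normr1. Qed.

Lemma nrm_eq0 z : nrm z = 0 -> z = 0.
Proof. by move=> h; apply/normr0_eq0; rewrite nrmE h. Qed.

Lemma nrm_gt0 z : (0 < nrm z) = (z != 0).
Proof. by have := normr_gt0 z; rewrite nrmE ltcR. Qed.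

Lemma nrmM z w : nrm (z * w) = nrm z * nrm w.
Proof. by apply: (@complexI R); rewrite -nrmE normrM !nrmE rmorphM. Qed.

Lemma nrmX z n : nrm (z ^+ n) = nrm z ^+ n.
Proof. by elim: n => [|n IH]; rewrite ?expr0 ?nrm1// !exprS nrmM IH. Qed.

Lemma nrmV z : nrm z^-1 = (nrm z)^-1.
Proof. by apply: (@complexI R); rewrite -nrmE normfV !nrmE fmorphV. Qed.

Lemma nrmN z : nrm (- z) = nrm z.
Proof. by rewrite /nrm normrN. Qed.

Lemma nrmC (x : R) : nrm x%:C = `|x|.
Proof. by rewrite /nrm normc_def /= expr0n/= addr0 sqrtr_sqr. Qed.

Lemma nrmD z w : nrm (z + w) <= nrm z + nrm w.
Proof. by have := ler_normD z w; rewrite !nrmE -rmorphD lecR. Qed.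

Lemma nrmB z w : nrm (z - w) <= nrm z + nrm w.
Proof. by rewrite -(nrmN w) nrmD. Qed.

Lemma nrm_conj z : nrm (conjc z) = nrm z.
Proof. by rewrite /nrm normcJ. Qed.

Lemma nrm_Re z : `|Re z| <= nrm z.
Proof. by have := normc_ge_Re z; rewrite nrmE lecR. Qed.

Lemma nrm_Im z : `|Im z| <= nrm z.
Proof.
rewrite /nrm normc_def /= -sqrtr_sqr ler_wsqrtr// lerDr; exact: sqr_ge0.
Qed.

Lemma nrm_ReIm z : nrm z <= `|Re z| + `|Im z|.
Proof.
rewrite {1}(complexE z) (le_trans (nrmD _ _))// nrmM !nrmC.
by rewrite {1}/nrm normc_def /= expr0n/= expr1n add0r sqrtr1 mul1r.
Qed.

End Norm.

(** * Unconditional sums of real families *)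

Section RealSums.
Variable R : realType.
Local Open Scope ereal_scope.

Definition asum (I : choiceType) (f : I -> R) : \bar R :=
  \esum_(i in [set: I]) (f i)%:E.

Section Basic.
Variable I : choiceType.
Implicit Types f g u v : I -> R.

Lemma asum_ge0 f : (forall i, 0 <= f i)%R -> 0 <= asum f.
Proof. by move=> f0; apply: esum_ge0 => i _; rewrite lee_fin. Qed.

Lemma eq_asum f g : f =1 g -> asum f = asum g.
Proof. by move=> fg; apply: eq_esum => i _; rewrite fg. Qed.

Lemma le_asum f g : (forall i, f i <= g i)%R -> asum f <= asum g.
Proof. by move=> fg; apply: le_esum => i _; rewrite lee_fin. Qed.

Lemma asumD f g : (forall i, 0 <= f i)%R -> (forall i, 0 <= g i)%R ->
  asum (fun i => f i + g i)%R = asum f + asum g.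
Proof. by move=> f0 g0; rewrite /asum -esumD// => i _; rewrite lee_fin. Qed.

Lemma asum_leP f (M : R) :
  (forall s : seq I, uniq s -> \sum_(i <- s) f i <= M)%R -> asum f <= M%:E.
Proof.
move=> h; rewrite /asum; apply: ge_ereal_sup => _ [X [finX _]] <-.
rewrite fsbig_finite//= sumEFin lee_fin; apply: h; exact: fset_uniq.
Qed.

Lemma asum_geP f (s : seq I) : uniq s ->
  (\sum_(i <- s) f i)%R%:E <= asum f.
Proof.
move=> us; apply: esum_ge; exists [set` s]; first by split => //; exact: finite_seq.
by rewrite -fsbig_seq//= sumEFin lexx.
Qed.

Lemma asum0 : asum (fun _ : I => 0%R) = 0.
Proof. by rewrite /asum esum1. Qed.

(** Only the inequality [<=] is proved directly; the reverse one is the same inequality for [c^-1]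
    and the family [c * f i]. *)
Lemma asumZ f (c : R) : (0 <= c)%R -> (forall i, 0 <= f i)%R ->
  asum (fun i => c * f i)%R = c%:E * asum f.
Proof.
suff H : forall (c : R) f, (0 <= c)%R -> (forall i, 0 <= f i)%R ->
  asum (fun i => c * f i)%R <= c%:E * asum f.
  move=> c0 f0; apply/eqP; rewrite eq_le H//=.
  have [->|cn0] := eqVneq c 0%R.
    by rewrite mul0e asum_ge0// => i; rewrite mul0r.
  have cp : (0 < c)%R by rewrite lt0r cn0.
  rewrite -(@lee_pdivlMl _ c)// .
  have -> : asum f = asum (fun i => c^-1 * (c * f i))%R.
    by apply: eq_asum => i; rewrite mulrA mulVf// mul1r.
  by apply: H; rewrite ?invr_ge0// => i; rewrite mulr_ge0.
move=> {}c {}f c0 f0; apply: ge_ereal_sup => _ [X [finX _]] <-.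
rewrite fsbig_finite//= sumEFin -mulr_sumr EFinM.
by apply: lee_wpmul2l; [rewrite lee_fin|exact: asum_geP].
Qed.

Lemma asum_ge1 f i : (forall i, 0 <= f i)%R -> (f i)%:E <= asum f.
Proof. by move=> f0; have := @asum_geP f [:: i] isT; rewrite big_seq1. Qed.

End Basic.

Lemma asum_pair (I J : choiceType) (f : I * J -> R) :
  (forall i, 0 <= f i)%R ->
  asum f = \esum_(i in [set: I]) asum (fun j => f (i, j)).
Proof.
move=> f0; rewrite /asum esum_esum.
  have -> : [set: I] `*`` (fun=> [set: J]) = [set: I * J].
    by apply/seteqP; split.
  by apply: eq_esum => -[i j] _.
by move=> i j _ _; rewrite lee_fin.
Qed.

Lemma asum_bij (I J : choiceType) (e : I -> J) (f : J -> R) :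
  bijective e -> asum f = asum (f \o e).
Proof.
move=> be; rewrite /asum (@reindex_esum _ _ _ [set: I] [set: J] e)//.
by rewrite setTT_bijective.
Qed.

End RealSums.

Section RSum.
Variable R : realType.
Local Open Scope ereal_scope.

(** Positive parts minus negative parts. The value is meaningful under [rl1], since [fine] sends an
    infinite sum to 0. *)
Definition rsum (I : choiceType) (f : I -> R) : R :=
  (fine (asum (fun i => Num.max (f i) 0)) -
   fine (asum (fun i => Num.max (- f i) 0)))%R.

Definition rl1 (I : choiceType) (f : I -> R) : Prop :=
  asum (fun i => `|f i|%R) < +oo.

Lemma asum_fin (I : choiceType) (f g : I -> R) : (forall i, 0 <= f i <= g i)%R ->
  asum g < +oo -> asum f \is a fin_num.
Proof.
move=> fg goo; rewrite fin_numElt (@lt_le_trans _ _ 0)//=; last first.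
  by apply: asum_ge0 => i; case/andP: (fg i).
by apply: le_lt_trans goo; apply: le_asum => i; case/andP: (fg i).
Qed.

Lemma max0_bound (x : R) : (0 <= Num.max x 0 <= `|x|)%R.
Proof. by rewrite le_max lexx orbT/= ge_max ler_norm/=. Qed.

(** Positive parts do not add, so linearity and Fubini for signed families go through other
    nonnegative splittings. Adding crosswise turns the comparison with the canonical splitting into
    an equality of nonnegative sums. *)
Lemma rsum_diff (I : choiceType) (f u v : I -> R) :
  (forall i, 0 <= u i)%R -> (forall i, 0 <= v i)%R ->
  asum u < +oo -> asum v < +oo -> (forall i, f i = u i - v i)%R ->
  rsum f = (fine (asum u) - fine (asum v))%R.
Proof.
move=> u0 v0 uoo voo fuv.
have fle i : (`|f i| <= u i + v i)%R.
  by rewrite fuv (le_trans (ler_normB _ _))// !ger0_norm.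
have uvoo : asum (fun i => u i + v i)%R < +oo.
  by rewrite asumD// lte_add_pinfty.
have fu : asum u \is a fin_num by apply: asum_fin uoo => i; rewrite u0 lexx.
have fv : asum v \is a fin_num by apply: asum_fin voo => i; rewrite v0 lexx.
have fp : asum (fun i => Num.max (f i) 0)%R \is a fin_num.
  apply: asum_fin uvoo => i; have /andP[-> /=] := max0_bound (f i).
  by move=> /le_trans; apply.
have fn : asum (fun i => Num.max (- f i) 0)%R \is a fin_num.
  apply: asum_fin uvoo => i; have /andP[-> /=] := max0_bound (- f i).
  by rewrite normrN => /le_trans; apply.

have E : asum (fun i => Num.max (f i) 0)%R + asum v =
         asum (fun i => Num.max (- f i) 0)%R + asum u.
  rewrite -!asumD//; first last.
  - by move=> i; case/andP: (max0_bound (f i)).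
  - by move=> i; case/andP: (max0_bound (- f i)).
  apply: eq_asum => i; rewrite fuv.
  have [] := leP 0%R (u i - v i)%R => h; have [h'|h'] := leP 0%R (- (u i - v i))%R; lra.
move/(congr1 fine): E; rewrite !fineD// /rsum => E; lra.
Qed.

Section Basic.
Variable I : choiceType.
Implicit Types f g u v : I -> R.

Lemma eq_rsum f g : f =1 g -> rsum f = rsum g.
Proof. by move=> /funext ->. Qed.

Lemma rl1_le f g : (forall i, `|f i| <= g i)%R -> asum g < +oo -> rl1 f.
Proof. by move=> fg; apply: le_lt_trans; exact: le_asum. Qed.

Lemma rl1_pos f : rl1 f -> asum (fun i => Num.max (f i) 0)%R < +oo.
Proof. by apply: le_lt_trans; apply: le_asum => i; case/andP: (max0_bound (f i)). Qed.

Lemma rl1_neg f : rl1 f -> asum (fun i => Num.max (- f i) 0)%R < +oo.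
Proof.
apply: le_lt_trans; apply: le_asum => i; rewrite -(normrN (f i)).
by case/andP: (max0_bound (- f i)).
Qed.

Lemma rl1N f : rl1 f -> rl1 (fun i => - f i)%R.
Proof. by rewrite /rl1 (eq_asum (fun i => normrN (f i))). Qed.

Lemma max0_ge0 (x : R) : (0 <= Num.max x 0)%R.
Proof. by case/andP: (max0_bound x). Qed.

Lemma max0_diff (x : R) : x = (Num.max x 0 - Num.max (- x) 0)%R.
Proof. by have [h|h] := leP 0%R x; have [h'|h'] := leP 0%R (- x)%R; lra. Qed.

Lemma rl1_fin f : rl1 f -> asum (fun i => Num.max (f i) 0)%R \is a fin_num.
Proof. by apply: asum_fin => i; exact: max0_bound. Qed.

Lemma rl1_finN f : rl1 f -> asum (fun i => Num.max (- f i) 0)%R \is a fin_num.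
Proof. by apply: asum_fin => i; rewrite -(normrN (f i)); exact: max0_bound. Qed.

Lemma rsumD f g : rl1 f -> rl1 g ->
  rsum (fun i => f i + g i)%R = (rsum f + rsum g)%R.
Proof.
move=> hf hg.
rewrite (@rsum_diff _ _ (fun i => Num.max (f i) 0 + Num.max (g i) 0)%R
  (fun i => Num.max (- f i) 0 + Num.max (- g i) 0)%R).
- rewrite !asumD; try by move=> ?; exact: max0_ge0.
  rewrite !fineD ?rl1_fin ?rl1_finN//; try exact: rl1N.
  rewrite /rsum; lra.
- by move=> i; rewrite addr_ge0// max0_ge0.
- by move=> i; rewrite addr_ge0// max0_ge0.
- rewrite asumD; try by move=> ?; exact: max0_ge0.
  by rewrite lte_add_pinfty ?rl1_pos.
- rewrite asumD; try by move=> ?; exact: max0_ge0.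
  by rewrite lte_add_pinfty// rl1_neg.
by move=> i; rewrite {1}(max0_diff (f i)) {1}(max0_diff (g i)); lra.
Qed.

Lemma rsumN f : rl1 f -> rsum (fun i => - f i)%R = (- rsum f)%R.
Proof.
move=> hf; rewrite /rsum opprB; congr (_ - fine _)%R.
by apply: eq_asum => i; rewrite opprK.
Qed.

Lemma rl1Z (c : R) f : rl1 f -> rl1 (fun i => c * f i)%R.
Proof.
rewrite /rl1 => hf; rewrite (eq_asum (fun i => normrM c (f i))) asumZ//.
by rewrite lte_mul_pinfty// lee_fin.
Qed.

Lemma rsumZ (c : R) f : rl1 f -> rsum (fun i => c * f i)%R = (c * rsum f)%R.
Proof.
wlog c0 : c / (0 <= c)%R.
  move=> H hf; have [/H|/ltW] := leP 0%R c; first by apply.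
  rewrite -oppr_ge0 => /H/(_ hf) E.
  rewrite -[LHS]opprK -rsumN; last exact: rl1Z.
  rewrite (_ : (fun i => - (c * f i))%R = (fun i => (- c) * f i)%R).
    by rewrite E mulNr opprK.
  by apply/funext => i; rewrite mulNr.
move=> hf.
rewrite (@rsum_diff _ _ (fun i => c * Num.max (f i) 0)%R
  (fun i => c * Num.max (- f i) 0)%R).
- rewrite !asumZ//; try by move=> ?; exact: max0_ge0.
  rewrite !fineM ?rl1_fin ?rl1_finN//; try exact: rl1N.
  by rewrite /rsum mulrBr.
- by move=> i; rewrite mulr_ge0// max0_ge0.
- by move=> i; rewrite mulr_ge0// max0_ge0.
- rewrite asumZ//; try by move=> ?; exact: max0_ge0.
  by rewrite lte_mul_pinfty ?lee_fin// rl1_pos.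
- rewrite asumZ//; try by move=> ?; exact: max0_ge0.
  by rewrite lte_mul_pinfty ?lee_fin// rl1_neg.
by move=> i; rewrite {1}(max0_diff (f i)) mulrBr.
Qed.

Lemma rsum_norm f : rl1 f -> `|rsum f|%R%:E <= asum (fun i => `|f i|%R).
Proof.
move=> hf; have hN : asum (fun i => `|f i|)%R \is a fin_num.
  by apply: asum_fin hf => i; rewrite normr_ge0 lexx.
have -> : asum (fun i => `|f i|)%R =
   asum (fun i => Num.max (f i) 0)%R + asum (fun i => Num.max (- f i) 0)%R.
  rewrite -asumD; try by move=> ?; exact: max0_ge0.
  apply: eq_asum => i.
  by have [h|h] := leP 0%R (f i); have [h'|h'] := leP 0%R (- f i)%R;
    rewrite ?(ger0_norm h) ?(ltr0_norm h); lra.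
rewrite -(fineK (rl1_fin hf)) -(fineK (rl1_finN hf)) -EFinD lee_fin /rsum.
have h1 : (0 <= fine (asum (fun i => Num.max (f i) 0)))%R.
  by apply/fine_ge0/asum_ge0 => ?; exact: max0_ge0.
have h2 : (0 <= fine (asum (fun i => Num.max (- f i) 0)))%R.
  by apply/fine_ge0/asum_ge0 => ?; exact: max0_ge0.
by rewrite (le_trans (ler_normB _ _))// !ger0_norm.
Qed.

Lemma rsum_ge0E f : (forall i, 0 <= f i)%R -> rsum f = fine (asum f).
Proof.
move=> f0; rewrite /rsum; rewrite (eq_asum (g := f)); last first.
  by move=> i; apply/max_idPl.
rewrite (_ : asum (fun i => Num.max (- f i) 0)%R = 0) ?subr0//.
rewrite -(@asum0 R I); apply: eq_asum => i.
by apply/max_idPr; rewrite oppr_le0.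
Qed.

End Basic.

Lemma rsum_bij (I J : choiceType) (e : I -> J) (f : J -> R) :
  bijective e -> rsum f = rsum (f \o e).
Proof. by move=> be; rewrite /rsum !(asum_bij _ be). Qed.

Lemma rl1_fiber (I J : choiceType) (f : I * J -> R) i : rl1 f ->
  rl1 (fun j => f (i, j)).
Proof.
rewrite /rl1 asum_pair// => h; apply: le_lt_trans h.
rewrite (esumID [set i]); last by move=> *; exact: asum_ge0.
rewrite setTI esum_set1//; last by apply: asum_ge0.
by rewrite leeDl//; apply: esum_ge0 => *; exact: asum_ge0.
Qed.

Lemma asum_pair_fin (I J : choiceType) (f : I * J -> R) :
  (forall i, 0 <= f i)%R -> asum f < +oo ->
  asum f = asum (fun i => fine (asum (fun j => f (i, j)))).
Proof.
move=> f0 h; rewrite asum_pair//; apply: eq_esum => i _; rewrite fineK//.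
apply: (@asum_fin _ _ (fun j => `|f (i, j)|)%R).
  by move=> j; rewrite f0 ler_norm.
by apply: (@rl1_fiber _ _ f); rewrite /rl1 (eq_asum (fun i => ger0_norm (f0 i))).
Qed.

Lemma rsum_pair (I J : choiceType) (f : I * J -> R) : rl1 f ->
  rsum f = rsum (fun i => rsum (fun j => f (i, j))).
Proof.
move=> hf.
have hp := rl1_pos hf; have hn := rl1_neg hf.
rewrite (@rsum_diff _ (fun i => rsum (fun j => f (i, j)))
  (fun i => fine (asum (fun j => Num.max (f (i, j)) 0)))%R
  (fun i => fine (asum (fun j => Num.max (- f (i, j)) 0)))%R)//.
- rewrite -(@asum_pair_fin _ _ (fun p => Num.max (f p) 0)%R)//;
    last by move=> ?; exact: max0_ge0.
  by rewrite -(@asum_pair_fin _ _ (fun p => Num.max (- f p) 0)%R)//;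
    move=> ?; exact: max0_ge0.
- by move=> i; apply/fine_ge0/asum_ge0 => ?; exact: max0_ge0.
- by move=> i; apply/fine_ge0/asum_ge0 => ?; exact: max0_ge0.
- by rewrite -(@asum_pair_fin _ _ (fun p => Num.max (f p) 0)%R)//
    => ?; exact: max0_ge0.
- by rewrite -(@asum_pair_fin _ _ (fun p => Num.max (- f p) 0)%R)//
    => ?; exact: max0_ge0.
Qed.

End RSum.

(** * Sums of complex families *)

Section CSum.
Variable R : realType.
Local Notation C := R[i].
Local Notation Re := (@complex.Re R).
Local Notation Im := (@complex.Im R).

Definition l1 (I : choiceType) (f : I -> C) : Prop :=
  (asum (fun i => nrm (f i)) < +oo)%E.
Definition l1n (I : choiceType) (f : I -> C) : R :=
  fine (asum (fun i => nrm (f i))).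
Definition csum (I : choiceType) (f : I -> C) : C :=
  rsum (fun i => Re (f i)) +i* rsum (fun i => Im (f i)).

Lemma cReD (z w : C) : Re (z + w) = Re z + Re w.
Proof. by case: z w => [a b] [c d]. Qed.
Lemma cImD (z w : C) : Im (z + w) = Im z + Im w.
Proof. by case: z w => [a b] [c d]. Qed.
Lemma cReM (z w : C) : Re (z * w) = Re z * Re w - Im z * Im w.
Proof. by case: z w => [a b] [c d]. Qed.
Lemma cImM (z w : C) : Im (z * w) = Re z * Im w + Im z * Re w.
Proof. by case: z w => [a b] [c d]. Qed.

Section Basic.
Variable I : choiceType.
Implicit Types f g : I -> C.

Lemma l1E f : l1 f -> asum (fun i => nrm (f i)) = (l1n f)%:E.
Proof.
move=> hf; rewrite /l1n fineK//; apply: asum_fin hf => i.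
by rewrite nrm_ge0 lexx.
Qed.

Lemma l1n_ge0 f : 0 <= l1n f.
Proof. by apply/fine_ge0/asum_ge0 => i; exact: nrm_ge0. Qed.

Lemma l1_bd f (M : R) : (asum (fun i => nrm (f i)) <= M%:E)%E ->
  l1 f /\ l1n f <= M.
Proof.
move=> h; have hf : l1 f by apply: le_lt_trans h _; rewrite ltry.
by split => //; rewrite -lee_fin -l1E.
Qed.

Lemma l1_Re f : l1 f -> rl1 (fun i => Re (f i)).
Proof. by apply: rl1_le => i; exact: nrm_Re. Qed.
Lemma l1_Im f : l1 f -> rl1 (fun i => Im (f i)).
Proof. by apply: rl1_le => i; exact: nrm_Im. Qed.

Lemma l1D f g : l1 f -> l1 g ->
  l1 (fun i => f i + g i) /\ l1n (fun i => f i + g i) <= l1n f + l1n g.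
Proof.
move=> hf hg; apply: l1_bd.
apply: (@le_trans _ _ (asum (fun i => nrm (f i) + nrm (g i)))).
  by apply: le_asum => i; exact: nrmD.
by rewrite asumD ?l1E// => i; exact: nrm_ge0.
Qed.

Lemma l1Z (c : C) f : l1 f ->
  l1 (fun i => c * f i) /\ l1n (fun i => c * f i) <= nrm c * l1n f.
Proof.
move=> hf; apply: l1_bd; rewrite (eq_asum (fun i => nrmM c (f i))).
by rewrite asumZ ?nrm_ge0// ?l1E// => i; exact: nrm_ge0.
Qed.

Lemma l1_dom f g : (forall i, nrm (f i) <= nrm (g i)) -> l1 g ->
  l1 f /\ l1n f <= l1n g.
Proof. by move=> fg hg; apply: l1_bd; rewrite -l1E//; exact: le_asum. Qed.

Lemma l1N f : l1 f -> l1 (fun i => - f i).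
Proof. by move=> /(l1_dom (f := fun i => - f i))[]// i; rewrite nrmN. Qed.

Lemma l1nN f : l1n (fun i => - f i) = l1n f.
Proof. by rewrite /l1n; under eq_asum do rewrite nrmN. Qed.

Lemma l1B f g : l1 f -> l1 g ->
  l1 (fun i => f i - g i) /\ l1n (fun i => f i - g i) <= l1n f + l1n g.
Proof. by move=> hf hg; rewrite -(l1nN g); apply: l1D => //; exact: l1N. Qed.

Lemma l1_0 : l1 (fun _ : I => 0 : C) /\ l1n (fun _ : I => 0 : C) = 0.
Proof.
rewrite /l1 /l1n; have -> : asum (fun _ : I => nrm (0 : C)) = 0%E.
  by rewrite nrm0 asum0.
by split; rewrite ?ltry.
Qed.

Lemma l1_ge1 f i : l1 f -> nrm (f i) <= l1n f.
Proof.
move=> hf; rewrite -lee_fin -l1E//.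
by apply: (@asum_ge1 _ _ (fun i => nrm (f i))) => j; exact: nrm_ge0.
Qed.

Lemma l1n_eq0 f : l1 f -> l1n f = 0 -> forall i, f i = 0.
Proof.
move=> hf f0 i; apply: nrm_eq0; apply/eqP; rewrite eq_le nrm_ge0 andbT.
by rewrite -f0 l1_ge1.
Qed.

Lemma eq_csum f g : f =1 g -> csum f = csum g.
Proof. by move=> /funext ->. Qed.

Lemma csumD f g : l1 f -> l1 g ->
  csum (fun i => f i + g i) = csum f + csum g.
Proof.
move=> hf hg; rewrite /csum.
rewrite (eq_rsum (fun i => cReD (f i) (g i))) (eq_rsum (fun i => cImD (f i) (g i))).
by rewrite (rsumD (l1_Re hf) (l1_Re hg)) (rsumD (l1_Im hf) (l1_Im hg)).
Qed.

Lemma csumZ (c : C) f : l1 f -> csum (fun i => c * f i) = c * csum f.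
Proof.
move=> hf; rewrite /csum.
rewrite (eq_rsum (fun i => cReM c (f i))) (eq_rsum (fun i => cImM c (f i))).
have hr := l1_Re hf; have hi := l1_Im hf.
rewrite (rsumD (rl1Z _ hr) (rl1N (rl1Z _ hi))) (rsumD (rl1Z _ hi) (rl1Z _ hr)).
rewrite (rsumN (rl1Z _ hi)) !(rsumZ _ hr) !(rsumZ _ hi).
by case: (c) => a b; simpc.
Qed.

Lemma csumN f : l1 f -> csum (fun i => - f i) = - csum f.
Proof.
move=> hf; rewrite -mulN1r -csumZ//; apply: eq_csum => i; by rewrite mulN1r.
Qed.

Lemma csumB f g : l1 f -> l1 g ->
  csum (fun i => f i - g i) = csum f - csum g.
Proof. by move=> hf hg; rewrite csumD ?csumN//; exact: l1N. Qed.

Lemma csum_norm f : l1 f -> nrm (csum f) <= l1n f.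
Proof.
move=> hf; have [/eqP s0|s0] := boolP (csum f == 0).
  by rewrite s0 nrm0 l1n_ge0.
have n0 : (nrm (csum f)) != 0 by rewrite gt_eqF// nrm_gt0.
(* The unimodular [c] rotates the sum onto the positive real axis, so its modulus is a single real
   sum and the bound has constant 1. *)
pose c := conjc (csum f) / (nrm (csum f))%:C.
have cs : c * csum f = (nrm (csum f))%:C.
  rewrite /c mulrAC (mulrC (conjc _)) -sqr_normc nrmE expr2.
  by rewrite mulfK// (inj_eq (@complexI R) _ 0).
have nc : nrm c = 1.
  by rewrite nrmM nrmV nrm_conj nrmC ger0_norm ?nrm_ge0// divff.
have -> : nrm (csum f) = rsum (fun i => Re (c * f i)).
  by move/(congr1 Re): cs; rewrite -csumZ//= => <-.
have [hcf le] := l1Z c hf; rewrite nc mul1r in le.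
apply: le_trans le; rewrite -lee_fin -l1E//.
apply: (le_trans _ (le_trans (rsum_norm (l1_Re hcf)) _)).
  by rewrite lee_fin ler_norm.
by apply: le_asum => i; exact: nrm_Re.
Qed.

Lemma csum0 : csum (fun _ : I => 0) = 0.
Proof.
apply: nrm_eq0; apply/eqP; rewrite eq_le nrm_ge0 andbT.
by have [h <-] := l1_0; exact: csum_norm.
Qed.

Lemma l1_mulb f (u : I -> C) (M : R) : l1 f -> (forall i, nrm (u i) <= M) ->
  0 <= M -> l1 (fun i => f i * u i) /\ l1n (fun i => f i * u i) <= M * l1n f.
Proof.
move=> hf uM M0; apply: l1_bd; rewrite EFinM -l1E// -asumZ//; last first.
  by move=> i; exact: nrm_ge0.
by apply: le_asum => i; rewrite nrmM mulrC ler_wpM2r// nrm_ge0.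
Qed.

Lemma l1_if (P : pred I) f : l1 f ->
  l1 (fun i => if P i then f i else 0) /\
  l1n (fun i => if P i then f i else 0) <= l1n f.
Proof. by apply: l1_dom => i; case: (P i) => //; rewrite nrm0 nrm_ge0. Qed.

Lemma asum_delta (i0 : I) (x : R) : 0 <= x ->
  asum (fun i => if i == i0 then x else 0) = x%:E.
Proof.
move=> x0; rewrite /asum -(@esum_set1 _ _ i0 (fun=> x%:E)) ?lee_fin//.
rewrite [RHS]esum_mkcond; apply: eq_esum => i _.
by case: eqP => [->|ne]; [rewrite mem_set|rewrite memNset].
Qed.

Lemma l1_delta (i0 : I) (x : C) :
  l1 (fun i => if i == i0 then x else 0) /\
  l1n (fun i => if i == i0 then x else 0) <= nrm x.
Proof.
apply: l1_bd; rewrite -(asum_delta i0 (nrm_ge0 x)).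
by apply: le_asum => i; case: eqP => // _; rewrite nrm0.
Qed.

Lemma rsum_delta (i0 : I) (x : R) : rsum (fun i => if i == i0 then x else 0) = x.
Proof.
have H (y : R) : 0 <= y -> rsum (fun i => if i == i0 then y else 0) = y.
  by move=> y0; rewrite rsum_ge0E; [rewrite asum_delta|move=> i; case: ifP].
have [|/ltW] := leP 0 x; first exact: H.
rewrite -oppr_ge0 => x0; rewrite -[RHS]opprK -(H _ x0).
rewrite -rsumN; last first.
  rewrite /rl1 (_ : (fun i => _) = (fun i => if i == i0 then - x else 0)).
    by rewrite asum_delta// ltry.
  by apply/funext => i; case: ifP; rewrite ?normr0// ger0_norm.
by apply: eq_rsum => i; case: ifP; rewrite ?opprK ?oppr0.
Qed.

Lemma csum_delta (i0 : I) (x : C) : csum (fun i => if i == i0 then x else 0) = x.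
Proof.
rewrite [RHS](_ : x = Re x +i* Im x); last by case: (x).
congr (_ +i* _); rewrite -[RHS](rsum_delta i0); apply: eq_rsum => i;
  by case: ifP.
Qed.

Lemma csum1 f (i0 : I) : (forall i, i != i0 -> f i = 0) -> csum f = f i0.
Proof.
move=> h; rewrite -[RHS](csum_delta i0); apply: eq_csum => i.
by case: eqP => [->//|/eqP]; exact: h.
Qed.

Lemma l1_sum (J : Type) (s : seq J) (F : J -> I -> C) :
  (forall j, l1 (F j)) -> l1 (fun i => \sum_(j <- s) F j i) /\
  l1n (fun i => \sum_(j <- s) F j i) <= \sum_(j <- s) l1n (F j).
Proof.
move=> hF; elim: s => [|j s [IH1 IH2]].
  rewrite big_nil; under eq_fun do rewrite big_nil.
  by have [h ->] := l1_0.
rewrite big_cons; under eq_fun do rewrite big_cons.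
have [h1 h2] := l1D (hF j) IH1; split=> //.
by apply: le_trans h2 _; rewrite lerD2l.
Qed.

Lemma csum_sum (J : Type) (s : seq J) (F : J -> I -> C) :
  (forall j, l1 (F j)) ->
  csum (fun i => \sum_(j <- s) F j i) = \sum_(j <- s) csum (F j).
Proof.
move=> hF; elim: s => [|j s IH].
  by rewrite big_nil; under eq_csum do rewrite big_nil; rewrite csum0.
rewrite big_cons -IH -csumD//; last by case: (l1_sum s hF).
by apply: eq_csum => i; rewrite big_cons.
Qed.

Lemma csum_fin f (s : seq I) : uniq s -> (forall i, i \notin s -> f i = 0) ->
  csum f = \sum_(i <- s) f i.
Proof.
move=> us fs.
rewrite (eq_csum (g := fun i => \sum_(j <- s) (if i == j then f j else 0))).
  rewrite csum_sum; last by move=> j; case: (l1_delta j (f j)).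
  by apply: eq_bigr => j _; rewrite csum_delta.
move=> i; have [si|si] := boolP (i \in s).
  rewrite (bigD1_seq i)//= eqxx big1 ?addr0// => j ji.
  by rewrite eq_sym (negbTE ji).
rewrite fs// big1_seq// => j /andP[_ js]; case: eqP => // ij.
by rewrite ij js in si.
Qed.

Lemma l1_fin f (s : seq I) : uniq s -> (forall i, i \notin s -> f i = 0) -> l1 f.
Proof.
move=> us fs; suff -> : f = fun i => \sum_(j <- s) (if i == j then f j else 0).
  by have [] := @l1_sum _ s (fun j i => if i == j then f j else 0)
    (fun j => (l1_delta j (f j)).1).
apply/funext => i; have [si|si] := boolP (i \in s).
  rewrite (bigD1_seq i)//= eqxx big1 ?addr0// => j ji.
  by rewrite eq_sym (negbTE ji).
rewrite fs// big1_seq// => j /andP[_ js]; case: eqP => // ij.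
by rewrite ij js in si.
Qed.

Lemma l1_split f (P : pred I) : l1 f ->
  l1n f = l1n (fun i => if P i then f i else 0) +
          l1n (fun i => if P i then 0 else f i).
Proof.
move=> hf; have [h1 _] := l1_if P hf; have [h2 _] := l1_if (predC P) hf.
apply: EFin_inj; rewrite EFinD -!l1E//; last first.
  by move: h2; congr l1; apply/funext => i /=; case: (P i).
rewrite -asumD; [|by move=> ?; exact: nrm_ge0..].
by apply: eq_asum => i; case: (P i); rewrite nrm0 ?addr0 ?add0r.
Qed.

Lemma l1_tail f (e : R) : l1 f -> 0 < e -> exists2 s : seq I, uniq s &
  l1n (fun i => if i \in s then 0 else f i) < e.
Proof.
move=> hf e0.
have : ((l1n f - e)%:E < asum (fun i => nrm (f i)))%E.
  by rewrite l1E// lte_fin ltrBlDr ltrDl.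
rewrite /asum => /ereal_sup_gt [_ [X [finX _] <-]].
rewrite fsbig_finite//= sumEFin lte_fin; set s := fset_set X => hs.
exists s; first exact: fset_uniq.
have := l1_split (mem s) hf => /= E.
suff : \sum_(i <- s) nrm (f i) <= l1n (fun i => if i \in s then f i else 0).
  by move: E hs; rewrite /in_mem/=; lra.
have [h _] := l1_if (mem s) hf; rewrite -lee_fin -l1E//.
apply: le_trans (asum_geP _ (fset_uniq s)).
rewrite lee_fin big_seq [leRHS]big_seq; apply: ler_sum => i -> //.
Qed.

Lemma csum_approx f (e : R) : l1 f -> 0 < e -> exists2 s : seq I, uniq s &
  forall t, uniq t -> {subset s <= t} -> nrm (csum f - \sum_(i <- t) f i) < e.
Proof.
move=> hf e0; have [s us hs] := l1_tail hf e0; exists s => // t ut st.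
have [h1 _] := l1_if (mem t) hf; have [h2 _] := l1_if (predC (mem t)) hf.
have -> : \sum_(i <- t) f i = csum (fun i => if i \in t then f i else 0).
  rewrite (@csum_fin _ t)//; last by move=> i /negbTE ->.
  by rewrite big_seq [RHS]big_seq; apply: eq_bigr => i ->.
rewrite -csumB//; apply: le_lt_trans hs.
apply: le_trans (csum_norm _) _; first by have [] := l1B hf h1.
have [h3 _] := l1_if (predC (mem s)) hf.
have h4 : l1 (fun i => if i \in s then 0 else f i).
  by move: h3; congr l1; apply/funext => i /=; case: (i \in s).
have [] := @l1_dom (fun i => f i - (if i \in t then f i else 0)) _ _ h4; last by [].
move=> i; have [it|it] := boolP (i \in t); first by rewrite subrr nrm0 nrm_ge0.
rewrite subr0; have [si|_] := boolP (i \in s); last exact: lexx.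
by rewrite (st _ si) in it.
Qed.

End Basic.
End CSum.

(** * Fubini, pushforward and convolution *)

Section Push.
Variable R : realType.
Local Notation C := R[i].
Local Notation Re := (@complex.Re R).
Local Notation Im := (@complex.Im R).

Lemma csum_bij (I J : choiceType) (e : I -> J) (f : J -> C) :
  bijective e -> csum f = csum (f \o e).
Proof.
move=> be; rewrite /csum.
by rewrite (rsum_bij (fun j => Re (f j)) be) (rsum_bij (fun j => Im (f j)) be).
Qed.

Lemma l1_bij (I J : choiceType) (e : I -> J) (f : J -> C) :
  bijective e -> l1 f -> l1 (f \o e).
Proof. by move=> be; rewrite /l1 (asum_bij _ be). Qed.

Lemma l1_fiber (I J : choiceType) (f : I * J -> C) i :
  l1 f -> l1 (fun j => f (i, j)).
Proof.
move=> hf; have : rl1 (fun p => nrm (f p)).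
  by rewrite /rl1; under eq_asum do rewrite (ger0_norm (nrm_ge0 _)).
move=> /rl1_fiber => /(_ i); rewrite /rl1.
by under eq_asum do rewrite (ger0_norm (nrm_ge0 _)).
Qed.

Lemma csum_pair (I J : choiceType) (f : I * J -> C) : l1 f ->
  csum f = csum (fun i => csum (fun j => f (i, j))).
Proof.
move=> hf; rewrite /csum (rsum_pair (l1_Re hf)) (rsum_pair (l1_Im hf)).
by [].
Qed.

Lemma l1_pairE (I J : choiceType) (f : I * J -> C) : l1 f ->
  asum (fun p => nrm (f p)) = asum (fun i => l1n (fun j => f (i, j))).
Proof. by move=> hf; rewrite asum_pair_fin// => p; exact: nrm_ge0. Qed.

Lemma l1_pair (I J : choiceType) (f : I * J -> C) : l1 f ->
  l1 (fun i => csum (fun j => f (i, j))) /\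
  l1n (fun i => csum (fun j => f (i, j))) <= l1n f.
Proof.
move=> hf; apply: l1_bd; rewrite -l1E// l1_pairE//.
by apply: le_asum => i; apply: csum_norm; exact: l1_fiber.
Qed.

Lemma l1_uncurry (I J : choiceType) (f : I -> J -> C) (b : I -> R) (M : R) :
  (forall i, l1 (f i)) -> (forall i, l1n (f i) <= b i) -> (asum b <= M%:E)%E ->
  l1 (fun p => f p.1 p.2) /\ l1n (fun p => f p.1 p.2) <= M.
Proof.
move=> hf hb bM; apply: l1_bd; rewrite asum_pair//=; last first.
  by move=> p; exact: nrm_ge0.
apply: le_trans bM; apply: le_esum => i _.
by rewrite l1E// lee_fin.
Qed.

Lemma swap_bij (I J : Type) : bijective (fun p : I * J => (p.2, p.1)).
Proof. by exists (fun p => (p.2, p.1)) => -[]. Qed.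

Lemma l1_swap (I J : choiceType) (f : I * J -> C) :
  l1 f -> l1 (fun p : J * I => f (p.2, p.1)).
Proof. by move=> hf; apply: (l1_bij (swap_bij J I)). Qed.

Lemma l1n_swap (I J : choiceType) (f : I * J -> C) :
  l1n (fun p : J * I => f (p.2, p.1)) = l1n f.
Proof. by rewrite /l1n (asum_bij _ (swap_bij J I)). Qed.

Lemma csum_swap (I J : choiceType) (f : I * J -> C) : l1 f ->
  csum (fun i => csum (fun j => f (i, j))) =
  csum (fun j => csum (fun i => f (i, j))).
Proof.
move=> hf; rewrite -csum_pair// (csum_bij _ (swap_bij J I)) csum_pair//.
exact: l1_swap.
Qed.

Lemma l1_tensor (I J : choiceType) (f : I -> C) (g : J -> C) :
  l1 f -> l1 g -> l1 (fun p => f p.1 * g p.2) /\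
  l1n (fun p => f p.1 * g p.2) <= l1n f * l1n g.
Proof.
move=> hf hg; apply: (@l1_uncurry _ _ (fun i j => f i * g j)
   (fun i => nrm (f i) * l1n g)).
- by move=> i; exact: (l1Z _ hg).1.
- by move=> i; exact: (l1Z _ hg).2.
under eq_asum do rewrite mulrC.
by rewrite asumZ ?l1n_ge0 ?l1E//; [rewrite -EFinM mulrC|move=> i; exact: nrm_ge0].
Qed.

(** The pushforward of a family along [phi], written as a sum over all of [I] with zeros off the
    fibre. Convolution is the pushforward of a tensor product along addition; the exponential of a
    monomial is the pushforward of the exponential series along its multiples. *)
Definition push (I J : choiceType) (phi : I -> J) (f : I -> C) (j : J) : C :=
  csum (fun i => if phi i == j then f i else 0).

Section PushL.
Variables (I J : choiceType) (phi : I -> J).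
Implicit Type f : I -> C.

Lemma push_aux f : l1 f ->
  l1 (fun p : I * J => if phi p.1 == p.2 then f p.1 else 0) /\
  l1n (fun p : I * J => if phi p.1 == p.2 then f p.1 else 0) <= l1n f.
Proof.
move=> hf; apply: (@l1_uncurry _ _ (fun i j => if phi i == j then f i else 0)
   (fun i => nrm (f i))).
- move=> i; have [h _] := l1_delta (phi i) (f i).
  by move: h; congr l1; apply/funext => j; rewrite eq_sym.
- move=> i; have [_ h] := l1_delta (phi i) (f i).
  by move: h; under eq_fun do rewrite eq_sym.
by rewrite l1E.
Qed.

Lemma l1_push f : l1 f -> l1 (push phi f) /\ l1n (push phi f) <= l1n f.
Proof.
move=> hf; have [h1 h2] := push_aux hf.
have [h3 h4] := l1_pair (l1_swap h1); split=> //.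
have E := l1n_swap (fun p : I * J => if phi p.1 == p.2 then f p.1 else 0).
by apply: le_trans h4 _; rewrite E.
Qed.

(** Both sides are iterated sums of one family on [I * J] supported on the graph of [phi]; the bound
    on [u] keeps it summable. *)
Lemma csum_push f (u : J -> C) (M : R) : l1 f -> (forall j, nrm (u j) <= M) ->
  0 <= M -> csum (fun j => push phi f j * u j) = csum (fun i => f i * u (phi i)).
Proof.
move=> hf uM M0.
have [h1 _] := push_aux hf.
have [h2 _] := @l1_mulb _ _ _ (fun p : I * J => u p.2) M h1 (fun p => uM p.2) M0.
transitivity (csum (fun j => csum (fun i =>
    (if phi i == j then f i else 0) * u j))).
  apply: eq_csum => j; rewrite mulrC -csumZ.
    by apply: eq_csum => i; rewrite mulrC.
  exact: (@l1_fiber _ _ (fun p : J * I => if phi p.2 == p.1 then f p.2 else 0) j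
     (l1_swap h1)).
rewrite -(csum_swap h2); apply: eq_csum => i /=.
rewrite (@csum1 _ _ _ (phi i)) ?eqxx// => j.
by rewrite eq_sym => /negbTE ->; rewrite mul0r.
Qed.

End PushL.

Section Conv.
Variable G : nmodType.
Implicit Types f g h : G -> C.

(** The index is any commutative monoid: [nat] gives the Cauchy product, [int] the product of
    Laurent series, and pairs of an integer and a multi-index that of Laurent series with
    parameters. *)
Definition conv f g : G -> C :=
  push (fun p : G * G => p.1 + p.2) (fun p => f p.1 * g p.2).

Lemma conv_l1 f g : l1 f -> l1 g ->
  l1 (conv f g) /\ l1n (conv f g) <= l1n f * l1n g.
Proof.
move=> hf hg; have [h1 h2] := l1_tensor hf hg.
have [h3 h4] := l1_push (fun p : G * G => p.1 + p.2) h1.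
by split=> //; apply: le_trans h4 h2.
Qed.

Lemma conv_term f g x : l1 f -> l1 g ->
  l1 (fun p : G * G => if p.1 + p.2 == x then f p.1 * g p.2 else 0).
Proof.
move=> hf hg; have [h1 _] := l1_tensor hf hg.
by have [] := l1_if (fun p : G * G => p.1 + p.2 == x) h1.
Qed.

Lemma convDl f1 f2 g x : l1 f1 -> l1 f2 -> l1 g ->
  conv (fun y => f1 y + f2 y) g x = conv f1 g x + conv f2 g x.
Proof.
move=> h1 h2 hg; rewrite /conv /push -csumD; [|exact: conv_term..].
by apply: eq_csum => p; case: ifP; rewrite ?addr0// mulrDl.
Qed.

Lemma convC f g x : conv f g x = conv g f x.
Proof.
rewrite /conv /push (csum_bij _ (swap_bij G G)); apply: eq_csum => -[a b] /=.
by rewrite addrC mulrC.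
Qed.

Lemma convZl (c : C) f g x : l1 f -> l1 g ->
  conv (fun y => c * f y) g x = c * conv f g x.
Proof.
move=> hf hg; rewrite /conv /push -csumZ; last exact: conv_term.
by apply: eq_csum => p; case: ifP; rewrite ?mulr0// mulrA.
Qed.

Lemma convBl f1 f2 g x : l1 f1 -> l1 f2 -> l1 g ->
  conv (fun y => f1 y - f2 y) g x = conv f1 g x - conv f2 g x.
Proof.
move=> h1 h2 hg; under eq_fun do rewrite -mulN1r.
by rewrite convDl// ?convZl ?mulN1r//; case: (l1Z (-1) h2).
Qed.

Lemma convBr f1 f2 g x : l1 f1 -> l1 f2 -> l1 g ->
  conv g (fun y => f1 y - f2 y) x = conv g f1 x - conv g f2 x.
Proof. by move=> *; rewrite convC convBl// convC (convC f2). Qed.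

Definition delta (a : G) (x : C) : G -> C := fun y => if y == a then x else 0.

Lemma delta_l1 a x : l1 (delta a x) /\ l1n (delta a x) <= nrm x.
Proof. exact: l1_delta. Qed.

Section Character.
Variables (chi : G -> C).
Hypothesis chiD : forall a b, chi (a + b) = chi a * chi b.
Hypothesis chi1 : forall a, nrm (chi a) <= 1.

Lemma weighted_l1 f : l1 f -> l1 (fun x => f x * chi x).
Proof. by move=> hf; case: (l1_mulb hf chi1 ler01). Qed.

(** Fubini on [G * G], since the weight at a sum of indices splits. The constant character gives the
    addition law of the exponential; powers of a point of the circle, possibly times monomials in
    the parameters, give the evaluation of Laurent series. *)
Lemma ev_conv f g : l1 f -> l1 g ->
  csum (fun x => conv f g x * chi x) =
  csum (fun x => f x * chi x) * csum (fun x => g x * chi x).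
Proof.
move=> hf hg; have [h1 _] := l1_tensor hf hg.
rewrite (csum_push _ h1 chi1 ler01).
have [h2 _] := l1_tensor (weighted_l1 hf) (weighted_l1 hg).
transitivity (csum (fun p : G * G => f p.1 * chi p.1 * (g p.2 * chi p.2))).
  by apply: eq_csum => p; rewrite chiD mulrACA.
rewrite csum_pair//=.
transitivity (csum (fun a => csum (fun x => g x * chi x) * (f a * chi a))).
  by apply: eq_csum => a; rewrite csumZ; [rewrite mulrC|exact: weighted_l1].
by rewrite csumZ; [exact: mulrC|exact: weighted_l1].
Qed.

End Character.
End Conv.

End Push.

(** * The contraction principle on balls of l1 *)

Section Contraction.
Variable R : realType.
Local Notation C := R[i].

Lemma le_geo (x y c q : R) : 0 <= q < 1 -> (forall n, x <= y + c * q ^+ n) -> x <= y.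
Proof.
move=> /andP[q0 q1] h.
have cv : (fun n => y + c * q ^+ n) @ \oo --> y + c * 0.
  apply: cvgD; first exact: cvg_cst.
  by apply: cvgM; [exact: cvg_cst|apply: cvg_expr; rewrite ger0_norm].
rewrite -[y]addr0 -(mulr0 c) -(cvg_lim _ cv)//.
by apply: limr_ge; [apply: cvgP cv|exact: nearW].
Qed.

Lemma geo_tail (q : R) n : 0 <= q < 1 ->
  (asum (fun k : nat => if (k < n)%N then 0%R else (q ^+ k)%R) <= (q ^+ n / (1 - q))%R%:E)%E.
Proof.
move=> /andP[q0 q1]; apply: asum_leP => s us.
have q1' : 0 < 1 - q by rewrite subr_gt0.
(* [N] exceeds every index in [s], so the finite sum is part of one over an initial segment. *)
pose N := (\max_(i <- s) i.+1)%N.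
apply: (@le_trans _ _ (\sum_(0 <= k < N) (if (k < n)%N then 0 else q ^+ k))).
  rewrite -[leLHS]addr0 (perm_big [seq i <- iota 0 N | i \in s]) /=.
    rewrite big_filter /index_iota subn0 [leRHS](bigID (mem s)) /= lerD2l.
    by apply: sumr_ge0 => i _; case: ifP => // _; rewrite exprn_ge0.
  apply: uniq_perm => //; first by rewrite filter_uniq// iota_uniq.
  move=> i; rewrite mem_filter mem_iota /= add0n.
  case: (boolP (i \in s)) => //= si; rewrite /N.
  by rewrite (@leq_bigmax_seq _ s xpredT (fun i => i.+1) i si isT).
rewrite ler_pdivlMr//.
suff -> : (\sum_(0 <= k < N) (if (k < n)%N then 0 else q ^+ k)) * (1 - q) =
  (if (N < n)%N then 0 else q ^+ n - q ^+ N).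
  case: ifP => _; first by rewrite exprn_ge0.
  by rewrite gerBl exprn_ge0.
elim: (N) => [|m IH].
  by rewrite big_nil mul0r; case: n => //=; rewrite subrr.
rewrite big_nat_recr//= mulrDl IH.
case: (ltngtP m n) => [mn|mn|->].
- rewrite mul0r addr0; case: ltnP => // nm.
  have -> : m.+1 = n by apply/eqP; rewrite eqn_leq mn nm.
  by rewrite subrr.
- rewrite (_ : (m.+1 < n)%N = false) ?exprS; first by ring.
  by apply/negbTE; rewrite -leqNgt ltnW// ltnW.
- rewrite (_ : (n.+1 < n)%N = false) ?exprS; first by ring.
  by apply/negbTE; rewrite -leqNgt ltnW.
Qed.

Variable I : choiceType.

(** Banach's theorem on the ball of radius [M]. Completeness enters through summation: the limit is
    the sum over [k] of the successive differences [D k], a summable family on [nat * I], and its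
    tails measure the distance to the iterates. *)
Lemma l1_fixpoint (Phi : (I -> C) -> (I -> C)) (M q : R) :
  0 <= q < 1 -> 0 <= M ->
  (forall f, l1 f -> l1n f <= M -> l1 (Phi f) /\ l1n (Phi f) <= M) ->
  (forall f g, l1 f -> l1n f <= M -> l1 g -> l1n g <= M ->
     l1n (fun i => Phi f i - Phi g i) <= q * l1n (fun i => f i - g i)) ->
  exists f, [/\ l1 f, l1n f <= M & forall i, Phi f i = f i].
Proof.
move=> hq M0 hM hL.
have /andP[q0 q1] := hq.
have q1' : 0 < 1 - q by rewrite subr_gt0.
pose F n := iter n Phi (fun=> 0).
have HF n : l1 (F n) /\ l1n (F n) <= M.
  elim: n => [|n [IH1 IH2]] /=; first by have [h ->] := l1_0 R I.
  exact: hM.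
pose D n i := F n.+1 i - F n i.
have HD n : l1 (D n) by have [] := l1B (HF n.+1).1 (HF n).1.
pose c := l1n (D 0%N).
have c0 : 0 <= c by exact: l1n_ge0.
have hDn n : l1n (D n) <= q ^+ n * c.
  elim: n => [|n IH]; first by rewrite expr0 mul1r.
  have [h1 h2] := HF n.+1; have [h3 h4] := HF n.
  have H : l1n (D n.+1) <= q * l1n (D n) by exact: (hL (F n.+1) (F n)).
  by rewrite exprS -mulrA (le_trans H)// ler_wpM2l.
have tail n : l1 (fun p : nat * I => if (p.1 < n)%N then 0 else D p.1 p.2) /\
  l1n (fun p : nat * I => if (p.1 < n)%N then 0 else D p.1 p.2) <= c / (1 - q) * q ^+ n.
  apply: (@l1_uncurry _ _ _ (fun k i => if (k < n)%N then 0 else D k i)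
    (fun k => c * (if (k < n)%N then 0 else q ^+ k))).
  - by move=> k; case: (k < n)%N => //; have [] := l1_0 R I.
  - move=> k; case: (k < n)%N; first by have [_ ->] := l1_0 R I; rewrite mulr0.
    by rewrite mulrC.
  rewrite asumZ//; last by move=> k; case: ifP => // _; rewrite exprn_ge0.
  rewrite (_ : c / (1 - q) * q ^+ n = c * (q ^+ n / (1 - q))); last by ring.
  by rewrite EFinM lee_wpmul2l ?lee_fin ?geo_tail.
pose f i := csum (fun k => D k i).
have [t1 t2] := tail 0%N.
have hf : l1 f by have [] := l1_pair (l1_swap t1).
have fF n i : f i - F n i = csum (fun k => if (k < n)%N then 0 else D k i).
  have hk (m : nat) : l1 (fun k => if (k < m)%N then 0 else D k i).
    by have [h _] := tail m; exact: (l1_fiber i (l1_swap h)).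
  have hs : l1 (fun k => if (k < n)%N then D k i else 0).
    by have [] := l1_if (fun k => k < n)%N (hk 0%N).
  have -> : F n i = csum (fun k => if (k < n)%N then D k i else 0).
    rewrite (@csum_fin _ _ _ (iota 0 n)) ?iota_uniq//; last first.
      by move=> k; rewrite mem_iota /= add0n => /negbTE ->.
    transitivity (\sum_(0 <= k < n) D k i).
      by rewrite /D telescope_sumr// subr0.
    rewrite /index_iota subn0 big_seq [RHS]big_seq; apply: eq_bigr => k.
    by rewrite mem_iota /= add0n => ->.
  rewrite -csumB//; last exact: (hk 0%N).
  by apply: eq_csum => k; case: ifP; rewrite ?subrr ?subr0.
have fFn n : l1n (fun i => f i - F n i) <= c / (1 - q) * q ^+ n.
  under eq_fun do rewrite fF.
  have [h1 h2] := tail n; apply: le_trans h2.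
  have [_ h3] := l1_pair (l1_swap h1); apply: le_trans h3 _.
  by rewrite (l1n_swap (fun p : nat * I => if (p.1 < n)%N then 0 else D p.1 p.2)).
have hfM : l1n f <= M.
  apply: (le_geo (c := c / (1 - q)) hq) => n.
  have [h1 h2] := HF n; have [h3 _] := l1B hf h1.
  have [_] := l1D h1 h3; rewrite (_ : (fun i => _) = f); last first.
    by apply/funext => i; rewrite addrC subrK.
  by move=> /le_trans; apply; rewrite lerD.
exists f; split=> // i; apply/eqP; rewrite -subr_eq0; apply/eqP.
have [hP1 hP2] := hM _ hf hfM.
have [hd _] := l1B hP1 hf.
apply: (l1n_eq0 hd); apply/eqP; rewrite eq_le l1n_ge0 andbT.
(* Both [Phi f] and [f] lie within [c / (1 - q) * q ^+ n] of the iterate [F n.+1]. *)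
apply: (le_geo (c := 2 * (c / (1 - q))) hq) => n; rewrite add0r.
have [h1 h2] := HF n; have [h1' h2'] := HF n.+1.
have [h3 _] := l1B hP1 h1'; have [h4 _] := l1B hf h1'.
have [_] := l1B h3 h4; rewrite (_ : (fun i => _) = (fun i => Phi f i - f i)); last first.
  by apply/funext => j; ring.
move=> /le_trans; apply.
have cq : 0 <= c / (1 - q) by rewrite divr_ge0// ltW.
have qn : 0 <= q ^+ n by rewrite exprn_ge0.
have A1 : l1n (fun i => Phi f i - F n.+1 i) <= q * (c / (1 - q) * q ^+ n).
  exact: le_trans (hL _ _ hf hfM h1 h2) (ler_wpM2l q0 (fFn n)).
have A2 := fFn n.+1; rewrite exprS in A2.
have A3 : q * (c / (1 - q) * q ^+ n) <= c / (1 - q) * q ^+ n.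
  by apply: ler_piMl; [exact: mulr_ge0|exact: ltW].
rewrite mulrCA in A2.
move: A1 A2 A3; set k := c / (1 - q) * q ^+ n; set a := l1n _; set b := l1n _.
by rewrite -mulrA -/k; lra.
Qed.

End Contraction.

(** * Complex differentiation and Goursat's theorem *)

Section Bridge.
Variable R : realType.
Local Notation C := R[i].

Lemma posC (e : C) : 0 < e -> exists2 d : R, 0 < d & e = d%:C.
Proof.
case: e => a b; rewrite ltcE /= => /andP[/eqP -> a0]; by exists a.
Qed.

Lemma nrm_dist (z w : C) : nrm (z - w) = nrm (w - z).
Proof. by rewrite -nrmN opprB. Qed.

Lemma nbhsC (z : C) (A : set C) : nbhs (z : C^o) A <->
  exists2 d : R, 0 < d & forall w, nrm (w - z) < d -> A w.
Proof.
split.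
  move=> /nbhs_ballP[e /= /posC[d d0 ->] h]; exists d => // w wz; apply: h.
  by rewrite -ball_normE /= nrmE ltcR nrm_dist.
move=> [d d0 h]; apply/nbhs_ballP; exists d%:C => /=; first by rewrite ltcR.
move=> w; rewrite -ball_normE /= nrmE ltcR nrm_dist; exact: h.
Qed.

Lemma cvgC (T : Type) (F : set_system T) {FF : Filter F} (f : T -> C) (l : C) :
  ((f : T -> C^o) @ F --> (l : C^o)) <->
  (forall e : R, 0 < e -> F [set t | nrm (f t - l) < e]).
Proof.
split.
  move=> /cvgrPdist_lt h e e0; have := h e%:C; rewrite ltcR => /(_ e0).
  by apply: filterS => t /=; rewrite nrmE ltcR nrm_dist.
move=> h; apply/cvgrPdist_lt => e /posC[d d0 ->]; move: (h d d0).
by apply: filterS => t /=; rewrite nrmE ltcR nrm_dist.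
Qed.

Definition ccts (f : C -> C) (z : C) := forall e : R, 0 < e ->
  exists2 d : R, 0 < d & forall w, nrm (w - z) < d -> nrm (f w - f z) < e.

(** Frechet form with real tolerances; the bound is not strict, so [w = z] is no exception.
    Goursat's estimate starts from it. *)
Definition cdiff (f : C -> C) (z D : C) := forall e : R, 0 < e ->
  exists2 d : R, 0 < d & forall w, nrm (w - z) < d ->
    nrm (f w - f z - D * (w - z)) <= e * nrm (w - z).

Notation deriv1 f z := (derivable (f : C^o -> C^o) z 1).

Lemma cctsP f z : ccts f z <-> {for z, continuous (f : C^o -> C^o)}.
Proof.
split.
  move=> h; apply/(@cvgC _ (nbhs (z : C^o)) _) => e e0; apply/nbhsC.
  by have [d d0 hd] := h e e0; exists d.
move=> /(@cvgC _ (nbhs (z : C^o)) _) h e e0; have /nbhsC[d d0 hd] := h e e0.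
by exists d.
Qed.

Lemma dnbhsC (A : set C) : (0 : C^o)^' A <->
  exists2 d : R, 0 < d & forall w, nrm w < d -> w != 0 -> A w.
Proof.
split.
  by move=> /nbhsC[d d0 h]; exists d => // w wd w0; apply: h; rewrite ?subr0.
move=> [d d0 h]; apply/nbhsC; exists d => // w wd w0.
by apply: h; rewrite subr0 in wd.
Qed.

Lemma cdiffP f z : deriv1 f z <-> exists D, cdiff f z D.
Proof.
split.
  move=> /cvg_ex[/= D /cvgC h]; exists D => e e0.
  have /dnbhsC[d d0 hd] := h e e0; exists d => // w wd.
  have [->|wz] := eqVneq w z; first by rewrite !subrr mulr0 subr0 nrm0 mulr0.
  have wz0 : w - z != 0 by rewrite subr_eq0.
  have := hd _ wd wz0; rewrite /= /shift /= [(_ - z) *: _]mulr1 subrK => /ltW hh.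
  have -> : f w - f z - D * (w - z) = ((w - z)^-1 * (f w - f z) - D) * (w - z).
    by rewrite mulrBl mulrAC mulVf// mul1r.
  by rewrite nrmM ler_wpM2r// nrm_ge0.
move=> [D h]; apply/cvg_ex; exists D; apply/cvgC => e e0; apply/dnbhsC.
have [d d0 hd] := h (e / 2) (divr_gt0 e0 (ltr0Sn _ 1)); exists d => // w wd w0.
have := hd (w + z); rewrite addrK => /(_ wd) hh.
rewrite /= /shift /= [w *: _]mulr1.
have -> : w^-1 *: (f (w + z) - f z) - D = (f (w + z) - f z - D * w) * w^-1.
  by rewrite mulrBl mulfK// [_ *: _]mulrC.
rewrite nrmM nrmV ltr_pdivrMr ?nrm_gt0//; apply: le_lt_trans hh _.
by rewrite ltr_pM2r ?nrm_gt0// ltr_pdivrMr// mulr_natr mulr2n ltrDl.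
Qed.

Lemma cdiff_quad f z D (K r : R) : 0 < r -> 0 <= K ->
  (forall w, nrm (w - z) < r -> nrm (f w - f z - D * (w - z)) <= K * nrm (w - z) ^+ 2) ->
  deriv1 f z.
Proof.
move=> r0 K0 h; apply/cdiffP; exists D => e e0.
exists (Num.min r (e / (K + 1))).
  by rewrite lt_min r0/= divr_gt0// ltr_wpDl.
move=> w; rewrite lt_min => /andP[wr we].
apply: le_trans (h w wr) _; rewrite expr2 mulrA ler_wpM2r ?nrm_ge0//.
rewrite ltr_pdivlMr ?ltr_wpDl// in we.
by apply: le_trans (ltW we); rewrite mulrC ler_wpM2l ?nrm_ge0// lerDl.
Qed.

Lemma deriv1_ccts f z : deriv1 f z -> ccts f z.
Proof.
by move=> /derivable1_diffP/differentiable_continuous h; apply/cctsP.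
Qed.

Lemma deriv1_comp f g z : deriv1 g z -> deriv1 f (g z) -> deriv1 (f \o g) z.
Proof.
move=> /derivable1_diffP h1 /derivable1_diffP h2; apply/derivable1_diffP.
exact: (@differentiable_comp C C^o C^o C^o g f z h1 h2).
Qed.

Lemma deriv1_cst (c : C) z : deriv1 (fun=> c) z.
Proof. exact: derivable_cst. Qed.

Lemma deriv1_id z : deriv1 (fun w => w) z.
Proof. exact: derivable_id. Qed.

Lemma deriv1D f g z : deriv1 f z -> deriv1 g z -> deriv1 (fun w => f w + g w) z.
Proof. exact: derivableD. Qed.

Lemma deriv1N f z : deriv1 f z -> deriv1 (fun w => - f w) z.
Proof. exact: derivableN. Qed.

Lemma deriv1B f g z : deriv1 f z -> deriv1 g z -> deriv1 (fun w => f w - g w) z.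
Proof. exact: derivableB. Qed.

Lemma deriv1M f g z : deriv1 f z -> deriv1 g z -> deriv1 (fun w => f w * g w) z.
Proof. exact: derivableM. Qed.

Lemma deriv1V f z : f z != 0 -> deriv1 f z -> deriv1 (fun w => (f w)^-1) z.
Proof. exact: derivableV. Qed.

Lemma deriv1X f n z : deriv1 f z -> deriv1 (fun w => f w ^+ n) z.
Proof.
move=> h; elim: n => [|n IH].
  under eq_fun do rewrite expr0; exact: deriv1_cst.
by under eq_fun do rewrite exprS; exact: deriv1M.
Qed.

Lemma deriv1_near f g z (d : R) : 0 < d ->
  (forall w, nrm (w - z) < d -> f w = g w) -> deriv1 f z -> deriv1 g z.
Proof.
move=> d0 h; apply: near_eq_derivable.
by apply/nbhsC; exists d.
Qed.

Lemma ccts_comp f g z : ccts g z -> ccts f (g z) -> ccts (f \o g) z.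
Proof.
move=> hg hf e e0; have [d d0 h] := hf e e0; have [d' d0' h'] := hg d d0.
by exists d' => // w /h'/h.
Qed.

Lemma cctsM f g z : ccts f z -> ccts g z -> ccts (fun w => f w * g w) z.
Proof.
by move=> /cctsP h1 /cctsP h2; apply/cctsP; exact: (continuousM h1 h2).
Qed.

End Bridge.
Notation deriv1 f z := (derivable (f : _^o -> _^o) z 1).

(** * Integration through antiderivatives *)

Section Antiderivative.
Variable R : realType.

Lemma der_id (x : R) : is_derive x 1 (fun y : R => y) 1.
Proof. exact: is_derive_id. Qed.

Lemma prim_half (f : R -> R) (a : R) : continuous f ->
  exists F : R -> R, forall x : R, a < x -> is_derive x 1 F (f x).
Proof.
move=> cf; exists (fun y => \int[lebesgue_measure]_(t in `[a, y]) f t)%R => x ax.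
have xu : x < x + 1 by rewrite ltrDl.
have [] := @continuous_FTC1_closed _ f a x (x + 1) xu _ ax (cf x).
  apply: continuous_compact_integrable; first exact: segment_compact.
  exact: continuous_subspaceT.
move=> h1 h2; apply: DeriveDef; first exact: h1.
by rewrite -derive1E; exact: h2.
Qed.

Lemma deriv_zero_const (F : R -> R) (a b : R) : a <= b ->
  (forall x : R, a <= x <= b -> is_derive x 1 F 0) -> F a = F b.
Proof.
move=> ab h.
have hc : {within `[a, b], continuous F}.
  apply: continuous_in_subspaceT => x /set_mem /=; rewrite in_itv/= => /h [h1 _].
  by apply/differentiable_continuous/derivable1_diffP.
have hd (x : R) : x \in `]a, b[%R -> is_derive x 1 F 0.
  by rewrite in_itv /= => /andP[/ltW h1 /ltW h2]; apply: h; rewrite h1 h2.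
have [c _] := MVT_segment ab hd hc.
by rewrite mul0r => /eqP; rewrite subr_eq0 => /eqP ->.
Qed.

(** The integral from a base point has derivative [f] only to the right of that point. Reflecting
    [f] gives a second primitive to the left; on the overlap []-1, 1[] the two differ by a constant,
    so they can be glued at 0. *)
Lemma prim_ex (f : R -> R) : continuous f ->
  exists F : R -> R, forall x : R, is_derive x 1 F (f x).
Proof.
move=> cf; have [F hF] := prim_half (-1) cf.
have cg : continuous (fun x => f (- x)).
  by move=> x; apply: continuous_comp; [exact: opp_continuous|exact: cf].
have [G hG] := prim_half (-1) cg.
pose H x := - G (- x).
have hH (x : R) : x < 1 -> is_derive x 1 H (f x).
  move=> x1; have h1 : -1 < - x by rewrite ltrN2.
  have d1 := hG _ h1; rewrite /= opprK in d1.
  have d2 : is_derive x 1 (fun x : R => - x) (-1).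
    by have := is_deriveN (der_id x).
  have := is_deriveN (is_derive1_comp d1 d2).
  by rewrite mulrN1 opprK.
pose c := F 0 - H 0.
have FH (x : R) : -1 < x < 1 -> F x = H x + c.
  move=> /andP[x1 x2].
  suff : F 0 - H 0 = F x - H x by rewrite /c => ->; ring.
  have hd (y : R) : -1 < y < 1 -> is_derive y 1 (fun y => F y - H y) 0.
    by move=> /andP[y1 y2]; have := is_deriveB (hF _ y1) (hH _ y2); rewrite subrr.
  have [x0|/ltW x0] := leP 0 x.
    apply: (deriv_zero_const (F := fun y => F y - H y) x0) => y /andP[y1 y2].
    by apply: hd; rewrite (lt_le_trans _ y1)//= (le_lt_trans y2).
  apply/esym/(deriv_zero_const (F := fun y => F y - H y) x0) => y /andP[y1 y2].
  by apply: hd; rewrite (lt_le_trans _ y1)//= (le_lt_trans y2).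
exists (fun x => if 0 <= x then F x else H x + c) => x.
have [x0|x0] := leP 0 x.
  apply: (@near_eq_is_derive _ _ _ F); last by apply: hF; lra.
  near=> y; case: ifPn => //; rewrite -ltNge => y0; apply: FH.
  apply/andP; split; last by lra.
  near: y; apply: lt_nbhsr; lra.
apply: (@near_eq_is_derive _ _ _ (fun x => H x + c)).
  near=> y; rewrite ifN// -ltNge; near: y; exact: lt_nbhsl.
have := is_deriveD (hH x _) (is_derive_cst c x (1 : R^o)).
rewrite addr0; apply; lra.
Unshelve. all: by end_near. Qed.

Definition prim (f : R -> R) : R -> R :=
  match pselect (exists F : R -> R, forall x : R, is_derive x 1 F (f x)) with
  | left h => sval (cid h)
  | right _ => fun=> 0
  end.

Lemma primP (f : R -> R) : continuous f -> forall x : R, is_derive x 1 (prim f) (f x).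
Proof.
move=> cf x; rewrite /prim; case: pselect => [h|]; last by have := prim_ex cf.
by case: cid.
Qed.

(** With a chosen primitive, additivity in the interval is mere cancellation. Linearity and
    monotonicity come from the mean value theorem. *)
Definition rint (f : R -> R) (a b : R) : R := prim f b - prim f a.

Lemma ge0_deriv (F f : R -> R) (a b : R) : a <= b ->
  (forall x : R, is_derive x 1 F (f x)) -> (forall x, a <= x <= b -> 0 <= f x) ->
  F a <= F b.
Proof.
move=> ab h f0.
have hc : {within `[a, b], continuous F}.
  apply: continuous_subspaceT => x; have [h1 _] := h x.
  by apply/differentiable_continuous/derivable1_diffP.
have [c] := MVT_segment ab (fun x _ => h x) hc.
rewrite in_itv /= => /f0 fc E.
by rewrite -subr_ge0 E mulr_ge0// subr_ge0.
Qed.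

Lemma rint_le (f g : R -> R) (a b : R) : a <= b -> continuous f -> continuous g ->
  (forall x, a <= x <= b -> f x <= g x) -> rint f a b <= rint g a b.
Proof.
move=> ab cf cg fg.
have := @ge0_deriv (fun x => prim g x - prim f x) (fun x => g x - f x) a b ab.
rewrite /rint => H; suff: prim g a - prim f a <= prim g b - prim f b by lra.
apply: H => x; first by apply: is_deriveB; exact: primP.
by move=> /fg; rewrite subr_ge0.
Qed.

Lemma rint_FTC (f F : R -> R) (a b : R) : a <= b -> continuous f ->
  (forall x : R, is_derive x 1 F (f x)) -> rint f a b = F b - F a.
Proof.
move=> ab cf hF; rewrite /rint.
suff : prim f a - F a = prim f b - F b by lra.
apply: (deriv_zero_const (F := fun y => prim f y - F y) ab) => x _.
by have := is_deriveB (primP cf x) (hF x); rewrite subrr.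
Qed.

Lemma rintD (f g : R -> R) (a b : R) : a <= b -> continuous f -> continuous g ->
  rint (fun x => f x + g x) a b = rint f a b + rint g a b.
Proof.
move=> ab cf cg.
have hc : continuous (fun x => f x + g x).
  by move=> x; apply: (@continuousD _ _ _ f g); [exact: cf|exact: cg].
have hd (x : R) : is_derive x 1 (fun x => prim f x + prim g x) (f x + g x).
  exact: is_deriveD (primP cf x) (primP cg x).
by rewrite (rint_FTC ab hc hd) /rint; ring.
Qed.

Lemma rintZ (f : R -> R) (c a b : R) : a <= b -> continuous f ->
  rint (fun x => c * f x) a b = c * rint f a b.
Proof.
move=> ab cf.
have hc : continuous (fun x => c * f x).
  by move=> x; apply: continuousM; [exact: cst_continuous|exact: cf].
have hd (x : R) : is_derive x 1 (fun x => c * prim f x) (c * f x).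
  exact: (@is_deriveZ _ _ _ (prim f) c x 1 _ (primP cf x)).
by rewrite (rint_FTC ab hc hd) /rint; ring.
Qed.

End Antiderivative.

Section CInt.
Variable R : realType.
Local Notation C := R[i].
Local Notation Re := (@complex.Re R).
Local Notation Im := (@complex.Im R).

Definition ccont (f : R -> C) : Prop :=
  continuous (fun x => Re (f x)) /\ continuous (fun x => Im (f x)).

Definition CI (f : R -> C) (a b : R) : C :=
  rint (fun x => Re (f x)) a b +i* rint (fun x => Im (f x)) a b.

Lemma ccontD f g : ccont f -> ccont g -> ccont (fun x => f x + g x).
Proof.
move=> [f1 f2] [g1 g2]; split=> x.
  under eq_fun do rewrite cReD.
  by apply: (@continuousD _ _ _ (fun x => Re (f x)) (fun x => Re (g x))); [exact: f1|exact: g1].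
under eq_fun do rewrite cImD.
by apply: (@continuousD _ _ _ (fun x => Im (f x)) (fun x => Im (g x))); [exact: f2|exact: g2].
Qed.

Lemma ccontM f g : ccont f -> ccont g -> ccont (fun x => f x * g x).
Proof.
move=> [f1 f2] [g1 g2]; split=> x.
  under eq_fun do rewrite cReM.
  apply: (@continuousB _ _ _ (fun x => Re (f x) * Re (g x)) (fun x => Im (f x) * Im (g x))).
    by apply: continuousM; [exact: f1|exact: g1].
  by apply: continuousM; [exact: f2|exact: g2].
under eq_fun do rewrite cImM.
apply: (@continuousD _ _ _ (fun x => Re (f x) * Im (g x)) (fun x => Im (f x) * Re (g x))).
  by apply: continuousM; [exact: f1|exact: g2].
by apply: continuousM; [exact: f2|exact: g1].
Qed.

Lemma ccont_cst (c : C) : ccont (fun=> c).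
Proof. by split=> x; exact: cst_continuous. Qed.

Lemma ccont_real : ccont (fun x => x%:C).
Proof. by split=> x /=; [exact: cvg_id|exact: cst_continuous]. Qed.

Lemma CID f g a b : a <= b -> ccont f -> ccont g ->
  CI (fun x => f x + g x) a b = CI f a b + CI g a b.
Proof.
move=> ab [f1 f2] [g1 g2]; rewrite /CI.
under [X in rint X]funext do rewrite cReD.
under [X in _ +i* rint X _ _]funext do rewrite cImD.
by rewrite !rintD.
Qed.

Lemma CIZ f (c : C) a b : a <= b -> ccont f ->
  CI (fun x => c * f x) a b = c * CI f a b.
Proof.
move=> ab [f1 f2]; rewrite /CI.
have -> : (fun x => Re (c * f x)) = (fun x => Re c * Re (f x) + (- Im c) * Im (f x)).
  by apply/funext => x; rewrite cReM mulNr.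
have -> : (fun x => Im (c * f x)) = (fun x => Re c * Im (f x) + Im c * Re (f x)).
  by apply/funext => x; rewrite cImM.
have cz (k : R) g : continuous g -> continuous (fun x : R => k * g x).
  by move=> cg x; apply: continuousM; [exact: cst_continuous|exact: cg].
rewrite !rintD//; do ?exact: cz.
by rewrite !rintZ//; case: (c) => p q; simpc; congr (_ +i* _) => /=; ring.
Qed.

Lemma rint_bound f a b (M : R) : a <= b -> continuous f ->
  (forall x, a <= x <= b -> `|f x| <= M) -> `|rint f a b| <= M * (b - a).
Proof.
move=> ab cf h.
have cst k : rint (fun=> k) a b = k * (b - a).
  have hd (x : R) : is_derive x 1 (fun x => k * x) k.
    have := @is_deriveZ _ _ _ (fun y : R => y) k x 1 _ (der_id x).
    by rewrite /= [_ *: _]mulr1.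
  by rewrite (rint_FTC ab (@cst_continuous _ _ k) hd); ring.
have cc (k : R) : continuous (fun _ : R => k) by move=> x; exact: cst_continuous.
rewrite ler_norml -mulNr -!cst; apply/andP; split; apply: rint_le => // x /h;
  by rewrite ler_norml => /andP[].
Qed.

(** The factor 2 comes from bounding the real and imaginary parts separately. *)
Lemma CI_bound f a b (M : R) : a <= b -> ccont f ->
  (forall x, a <= x <= b -> nrm (f x) <= M) -> nrm (CI f a b) <= 2 * M * (b - a).
Proof.
move=> ab [f1 f2] h; apply: le_trans (nrm_ReIm _) _.
have h1 : `|rint (fun x => Re (f x)) a b| <= M * (b - a).
  by apply: rint_bound => // x /h; apply: le_trans; exact: nrm_Re.
have h2 : `|rint (fun x => Im (f x)) a b| <= M * (b - a).
  by apply: rint_bound => // x /h; apply: le_trans; exact: nrm_Im.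
by rewrite /=; lra.
Qed.

Lemma CI_affine (al be : C) a b : a <= b ->
  CI (fun t => al + be * t%:C) a b =
  al * (b - a)%:C + be * ((b ^+ 2 - a ^+ 2) / 2)%:C.
Proof.
move=> ab.
have H (p q : R) : rint (fun t => p + q * t) a b =
    p * (b - a) + q * ((b ^+ 2 - a ^+ 2) / 2).
  have hc : continuous (fun t => p + q * t).
    move=> x; apply: (@continuousD _ _ _ (fun=> p) (fun t => q * t)).
      exact: cst_continuous.
    by apply: continuousM; [exact: cst_continuous|exact: cvg_id].
  have hd (x : R) : is_derive x 1 (fun t => p * t + q / 2 * (t * t)) (p + q * x).
    have d1 := @is_deriveZ _ _ _ (fun y : R => y) p x 1 _ (der_id x).
    have d2 := @is_deriveZ _ _ _ (fun t : R => t * t) (q / 2) x 1 _ (is_deriveM (der_id x) (der_id x)).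
    have := is_deriveD d1 d2; rewrite /GRing.scale /=.
    by rewrite (_ : p * 1 + _ = p + q * x)//; field.
  by rewrite (rint_FTC ab hc hd); field.
rewrite /CI.
have -> : (fun x => Re (al + be * x%:C)) = (fun x => Re al + Re be * x).
  by apply/funext => x; rewrite cReD cReM /= mulr0 subr0.
have -> : (fun x => Im (al + be * x%:C)) = (fun x => Im al + Im be * x).
  by apply/funext => x; rewrite cImD cImM /= mulr0 add0r.
by rewrite !H; case: (al) (be) => p q [s t]; simpc.
Qed.

Lemma CI_affine_approx f (al be : C) a b (M : R) : a <= b -> ccont f ->
  (forall t, a <= t <= b -> nrm (f t - (al + be * t%:C)) <= M) ->
  nrm (CI f a b - (al * (b - a)%:C + be * ((b ^+ 2 - a ^+ 2) / 2)%:C)) <=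
  2 * M * (b - a).
Proof.
move=> ab cf h.
have ca : ccont (fun t => al + be * t%:C).
  apply: ccontD; first exact: ccont_cst.
  by apply: ccontM; [exact: ccont_cst|exact: ccont_real].
rewrite -CI_affine// -mulN1r -CIZ// -CID//; last by apply: ccontM => //; exact: ccont_cst.
apply: CI_bound => //.
  by apply: ccontD => //; apply: ccontM => //; exact: ccont_cst.
by move=> x; rewrite mulN1r; exact: h.
Qed.

End CInt.

(** * Goursat's theorem on rectangles *)

Section Goursat.
Variable R : realType.
Local Notation C := R[i].

(** [u k] is the left end of an interval of length [w / 2 ^+ k], and passing to either half
    satisfies the step condition. The supremum of the left ends is the common point. *)
Lemma nested_intervals (u : nat -> R) (w : R) : 0 <= w ->
  (forall k, u k <= u k.+1 /\ u k.+1 <= u k + w / 2 ^+ k.+1) ->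
  exists X, forall k, u k <= X <= u k + w / 2 ^+ k.
Proof.
move=> w0 h.
have mono j k : (j <= k)%N -> u j <= u k.
  elim: k => [|k IH]; first by rewrite leqn0 => /eqP ->.
  rewrite leq_eqVlt => /orP[/eqP -> //|]; rewrite ltnS => /IH /le_trans; apply.
  by have [] := h k.
have half k : w / 2 ^+ k = w / 2 ^+ k.+1 + w / 2 ^+ k.+1.
  by rewrite exprS; field; rewrite expf_neq0.
have anti j k : (j <= k)%N -> u k + w / 2 ^+ k <= u j + w / 2 ^+ j.
  elim: k => [|k IH]; first by rewrite leqn0 => /eqP ->.
  rewrite leq_eqVlt => /orP[/eqP -> //|]; rewrite ltnS => /IH; apply: le_trans.
  by rewrite (half k); have [_ ] := h k; lra.
have wk k : 0 <= w / 2 ^+ k by rewrite divr_ge0// exprn_ge0.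
have ub k j : u k <= u j + w / 2 ^+ j.
  have [kj|jk] := leqP k j.
    by rewrite (le_trans (mono _ _ kj))// lerDl.
  by apply: le_trans (anti _ _ (ltnW jk)); rewrite lerDl.
have hs : has_sup (range u).
  split; first by exists (u 0%N), 0%N.
  by exists (u 0%N + w / 2 ^+ 0%N) => _ [k _ <-].
exists (sup (range u)) => k; apply/andP; split.
  by apply: ub_le_sup; [exact: hs.2|exists k].
by apply: ge_sup; [exact: hs.1|move=> _ [j _ <-]].
Qed.

Variable g : R -> R -> C.
Hypothesis hx : forall y, ccont (fun x => g x y).
Hypothesis hy : forall x, ccont (g x).

Definition rdiff (x y : R) := exists D : C, forall e : R, 0 < e ->
  exists2 d : R, 0 < d & forall x' y', `|x' - x| < d -> `|y' - y| < d ->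
    nrm (g x' y' - g x y - D * ((x' - x) +i* (y' - y))) <=
    e * (`|x' - x| + `|y' - y|).

(** The counterclockwise contour integral of [g] dz over the boundary, in the order bottom, right,
    top, left; dz is i dy on the vertical sides. *)
Definition rect_int (x w y h : R) : C :=
  CI (fun t => g t y) x (x + w) + 'i * CI (g (x + w)) y (y + h)
  - CI (fun t => g t (y + h)) x (x + w) - 'i * CI (g x) y (y + h).

Local Notation J := rect_int.

Let CP (f : R -> C) (x : R) : C :=
  prim (fun x => complex.Re (f x)) x +i* prim (fun x => complex.Im (f x)) x.

Let CIE f a b : CI f a b = CP f b - CP f a.
Proof. by rewrite /CI /CP /rint; simpc. Qed.

Let J_split x w y h : J x w y h =
  J x (w / 2) y (h / 2) + J (x + w / 2) (w / 2) y (h / 2) +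
  J x (w / 2) (y + h / 2) (h / 2) + J (x + w / 2) (w / 2) (y + h / 2) (h / 2).
Proof.
rewrite /J !CIE.
have -> : x + w / 2 + w / 2 = x + w by field.
have -> : y + h / 2 + h / 2 = y + h by field.
by ring.
Qed.

Let step x w y h : exists p : R * R,
  [/\ p.1 = x \/ p.1 = x + w / 2, p.2 = y \/ p.2 = y + h / 2 &
   nrm (J x w y h) <= 4 * nrm (J p.1 (w / 2) p.2 (h / 2))].
Proof.
have [|h1] := leP (nrm (J x w y h)) (4 * nrm (J x (w / 2) y (h / 2))).
  by exists (x, y); split; [left|left|].
have [|h2] := leP (nrm (J x w y h)) (4 * nrm (J (x + w / 2) (w / 2) y (h / 2))).
  by exists (x + w / 2, y); split; [right|left|].
have [|h3] := leP (nrm (J x w y h)) (4 * nrm (J x (w / 2) (y + h / 2) (h / 2))).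
  by exists (x, y + h / 2); split; [left|right|].
have [|h4] := leP (nrm (J x w y h)) (4 * nrm (J (x + w / 2) (w / 2) (y + h / 2) (h / 2))).
  by exists (x + w / 2, y + h / 2); split; [right|right|].
exfalso.
have : nrm (J x w y h) <= nrm (J x (w / 2) y (h / 2)) +
   nrm (J (x + w / 2) (w / 2) y (h / 2)) +
   nrm (J x (w / 2) (y + h / 2) (h / 2)) +
   nrm (J (x + w / 2) (w / 2) (y + h / 2) (h / 2)).
  rewrite {1}J_split; do 3!(apply: le_trans (nrmD _ _) _; rewrite lerD2r).
  exact: lexx.
by lra.
Qed.

(** On the rectangle [g] is affine in x + iy up to [e * (w + h)], and an affine function integrates
    to zero around a rectangle. A side of length l contributes at most 2 e (w + h) l, hence the
    constant 4. *)
Let small (D : C) (X0 Y0 : R) (x w y h e : R) : 0 <= w -> 0 <= h ->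
  x <= X0 <= x + w -> y <= Y0 <= y + h -> 0 <= e ->
  (forall x' y', x <= x' <= x + w -> y <= y' <= y + h ->
    nrm (g x' y' - g X0 Y0 - D * ((x' - X0) +i* (y' - Y0))) <=
    e * (`|x' - X0| + `|y' - Y0|)) ->
  nrm (J x w y h) <= 4 * e * (w + h) ^+ 2.
Proof.
move=> w0 h0 hX hY e0 H.
have M0 x' y' : x <= x' <= x + w -> y <= y' <= y + h ->
    nrm (g x' y' - g X0 Y0 - D * ((x' - X0) +i* (y' - Y0))) <= e * (w + h).
  move=> h1 h2; apply: le_trans (H _ _ h1 h2) _; rewrite ler_wpM2l//.
  apply: lerD; rewrite ler_norml; lra.
pose G := g X0 Y0.
have xw : x <= x + w by lra.
have yh : y <= y + h by lra.
have B1 y' : y <= y' <= y + h -> nrm (CI (fun t => g t y') x (x + w) -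
  ((G + D * (- X0 +i* (y' - Y0))) * (x + w - x)%:C +
    D * (((x + w) ^+ 2 - x ^+ 2) / 2)%:C)) <= 2 * (e * (w + h)) * (x + w - x).
  move=> hy'; apply: CI_affine_approx => // t ht.
  have := M0 _ _ ht hy'; congr (nrm _ <= _).
  rewrite /G (_ : (t - X0) +i* (y' - Y0) = t%:C + (- X0 +i* (y' - Y0))); first by ring.
  by simpc.
have B2 x' : x <= x' <= x + w -> nrm (CI (g x') y (y + h) -
  ((G + D * ((x' - X0) +i* (- Y0))) * (y + h - y)%:C +
    (D * 'i) * (((y + h) ^+ 2 - y ^+ 2) / 2)%:C)) <= 2 * (e * (w + h)) * (y + h - y).
  move=> hx'; apply: CI_affine_approx => // t ht.
  have := M0 _ _ hx' ht; congr (nrm _ <= _).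
  rewrite /G (_ : (x' - X0) +i* (t - Y0) = 'i * t%:C + ((x' - X0) +i* (- Y0))); first by ring.
  by simpc.
have b1 := B1 y; have b2 := B1 (y + h); have b3 := B2 x; have b4 := B2 (x + w).
rewrite !lexx !yh /= in b1 b2; rewrite !lexx !xw /= in b3 b4.
move: {b1}(b1 isT) {b2}(b2 isT) {b3}(b3 isT) {b4}(b4 isT).
set a1 := CI _ _ _; set a2 := CI _ _ _; set a3 := CI _ _ _; set a4 := CI _ _ _.
set c1 := (X in nrm (a1 - X)); set c2 := (X in nrm (a2 - X)).
set c3 := (X in nrm (a3 - X)); set c4 := (X in nrm (a4 - X)).
move=> b1 b2 b3 b4.
have E : c1 + 'i * c4 - c2 - 'i * c3 = 0.
  rewrite /c1 /c2 /c3 /c4; case: (G) => G1 G2; case: (D) => D1 D2; simpc.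
  by apply/eqP; rewrite eq_complex /=; apply/andP; split; apply/eqP; field.
have -> : J x w y h = (a1 - c1) + 'i * (a4 - c4) - (a2 - c2) - 'i * (a3 - c3).
  rewrite /J -/a1 -/a2 -/a3 -/a4 -[LHS]subr0 -E; ring.
have ni : nrm ('i : C) = 1.
  by rewrite /nrm normc_def /= expr0n/= expr1n add0r sqrtr1.
have := nrmB (a1 - c1 + 'i * (a4 - c4) - (a2 - c2)) ('i * (a3 - c3)).
have := nrmB (a1 - c1 + 'i * (a4 - c4)) (a2 - c2).
have := nrmD (a1 - c1) ('i * (a4 - c4)).
rewrite !nrmM ni !mul1r.
move: b1 b2 b3 b4; rewrite !(addrAC _ _ (- x)) !(addrAC _ _ (- y)) !subrr !add0r expr2.
set k1 := nrm _; set k2 := nrm _; set k3 := nrm _; set k4 := nrm _.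
by move=> *; nra.
Qed.

(** Bisection: some quarter always carries at least a quarter of the integral. Differentiability at
    the common point of the nested rectangles bounds the integral over the k-th one by a small
    multiple of 4^-k, which cancels the factor [4 ^+ k]. *)
Lemma goursat x w y h : 0 <= w -> 0 <= h ->
  (forall x' y', x <= x' <= x + w -> y <= y' <= y + h -> rdiff x' y') ->
  J x w y h = 0.
Proof.
move=> w0 h0 hd.
have /choice[st hst] : forall q : R * R * (R * R), exists p : R * R,
  [/\ p.1 = q.1.1 \/ p.1 = q.1.1 + q.1.2 / 2, p.2 = q.2.1 \/ p.2 = q.2.1 + q.2.2 / 2 &
   nrm (J q.1.1 q.1.2 q.2.1 q.2.2) <= 4 * nrm (J p.1 (q.1.2 / 2) p.2 (q.2.2 / 2))].
  by move=> q; exact: step.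
(* [S k] is the lower left corner of the k-th rectangle, whose sides are [w / 2 ^+ k] and
   [h / 2 ^+ k]. *)
pose S := fix S k := if k is k'.+1 then
   st ((S k').1, w / 2 ^+ k', ((S k').2, h / 2 ^+ k')) else (x, y).
have half k (v : R) : v / 2 ^+ k / 2 = v / 2 ^+ k.+1.
  by rewrite exprS; field; rewrite expf_neq0.
have hS k : [/\ (S k.+1).1 = (S k).1 \/ (S k.+1).1 = (S k).1 + w / 2 ^+ k.+1,
   (S k.+1).2 = (S k).2 \/ (S k.+1).2 = (S k).2 + h / 2 ^+ k.+1 &
   nrm (J (S k).1 (w / 2 ^+ k) (S k).2 (h / 2 ^+ k)) <=
   4 * nrm (J (S k.+1).1 (w / 2 ^+ k.+1) (S k.+1).2 (h / 2 ^+ k.+1))].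
  by have := hst ((S k).1, w / 2 ^+ k, ((S k).2, h / 2 ^+ k)); rewrite /= !half.
have wk k (v : R) : 0 <= v -> 0 <= v / 2 ^+ k by move=> v0; rewrite divr_ge0// exprn_ge0.
have [X hX] : exists X, forall k, (S k).1 <= X <= (S k).1 + w / 2 ^+ k.
  apply: nested_intervals => // k; have [+ _ _] := hS k.
  by have := wk k.+1 _ w0; move=> ? [->|->]; lra.
have [Y hY] : exists Y, forall k, (S k).2 <= Y <= (S k).2 + h / 2 ^+ k.
  apply: nested_intervals => // k; have [_ + _] := hS k.
  by have := wk k.+1 _ h0; move=> ? [->|->]; lra.
have [D hD] : rdiff X Y.
  by apply: hd; [have := hX 0%N|have := hY 0%N]; rewrite /= expr0 divr1.
have pow k : nrm (J x w y h) <= 4 ^+ k * nrm (J (S k).1 (w / 2 ^+ k) (S k).2 (h / 2 ^+ k)).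
  elim: k => [|k IH]; first by rewrite /= !expr0 !divr1 mul1r.
  apply: le_trans IH _; rewrite exprS -mulrA mulrCA ler_wpM2l ?exprn_ge0//.
  by have [] := hS k.
have key e : 0 < e -> nrm (J x w y h) <= 4 * e * (w + h) ^+ 2.
  move=> e0; have [d d0 hd'] := hD e e0.
  (* The summand 1 keeps the size positive when the rectangle is degenerate. *)
  have [k hk] : exists k, (w + h + 1) / 2 ^+ k < d.
    have q1 : `|2^-1 : R| < 1 by rewrite ger0_norm ?invr_ge0// invf_lt1// ltr1n.
    have := cvg_expr q1 => /cvgrPdist_lt.
    have dp : 0 < d / (w + h + 1) by rewrite divr_gt0//; lra.
    move=> /(_ _ dp) [k _ /(_ k (leqnn k)) /=]; rewrite sub0r normrN.
    rewrite ger0_norm ?exprn_ge0 ?invr_ge0// ltr_pdivlMr; last by lra.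
    by move=> ?; exists k; rewrite mulrC -exprVn.
  have k2 : 0 < (2 ^+ k : R) by rewrite exprn_gt0.
  have hwk : w / 2 ^+ k < d.
    by apply: le_lt_trans hk; rewrite ler_pM2r ?invr_gt0//; lra.
  have hhk : h / 2 ^+ k < d.
    by apply: le_lt_trans hk; rewrite ler_pM2r ?invr_gt0//; lra.
  apply: le_trans (pow k) _.
  have := @small D X Y (S k).1 (w / 2 ^+ k) (S k).2 (h / 2 ^+ k) e
    (wk _ _ w0) (wk _ _ h0) (hX k) (hY k) (ltW e0).
  move=> H; apply: (@le_trans _ _ (4 ^+ k * (4 * e * (w / 2 ^+ k + h / 2 ^+ k) ^+ 2))).
    rewrite ler_wpM2l ?exprn_ge0//; apply: H => x' y' hx' hy'.
    by apply: hd'; have := hX k; have := hY k; rewrite ltr_norml; lra.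
  have -> : (4 ^+ k : R) = 2 ^+ k * 2 ^+ k by rewrite -exprMn; congr (_ ^+ _); ring.
  rewrite le_eqVlt; apply/orP; left; apply/eqP; field.
  by rewrite expf_neq0.
apply: nrm_eq0; apply/eqP; rewrite eq_le nrm_ge0 andbT.
have K0 : 0 <= 4 * (w + h) ^+ 2 by rewrite mulr_ge0// sqr_ge0.
apply/ler_addgt0Pl => e e0; rewrite addr0.
have := key (e / (4 * (w + h) ^+ 2 + 1)); rewrite divr_gt0//; last by lra.
move=> /(_ isT) /le_trans; apply.
rewrite mulrAC mulrA ler_pdivrMr; last by lra.
by nra.
Qed.

End Goursat.

(** * Power series and Riemann removability across the circle *)

Section PowerSeries.
Variable R : realType.
Local Notation C := R[i].
Local Notation Re := (@complex.Re R).
Local Notation Im := (@complex.Im R).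

Lemma csum_series (f : nat -> C) (e : R) : l1 f -> 0 < e ->
  exists N0, forall N, (N0 <= N)%N -> nrm (csum f - \sum_(k < N) f k) < e.
Proof.
move=> hf e0; have [s us hs] := csum_approx hf e0.
exists (\max_(i <- s) i.+1)%N => N hN.
have := hs (iota 0 N) (iota_uniq _ _).
have -> : \sum_(i <- iota 0 N) f i = \sum_(k < N) f k.
  by rewrite -[N in iota 0 N]subn0 -/(index_iota 0 N) big_mkord.
apply => i si; rewrite mem_iota /= add0n; apply: leq_trans hN.
exact: (@leq_bigmax_seq _ s xpredT (fun i => i.+1) i si isT).
Qed.

Lemma csum_series_Re (f : nat -> C) : l1 f ->
  series (fun k => Re (f k)) @ \oo --> Re (csum f).
Proof.
move=> hf; apply/cvgrPdist_lt => e e0; have [N0 h] := csum_series hf e0.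
exists N0 => // N /= /h; apply: le_lt_trans; apply: le_trans (nrm_Re _).
rewrite cReD /series/= big_mkord.
suff -> : Re (- \sum_(k < N) f k) = - \sum_(k < N) Re (f k) by [].
by rewrite raddfN raddf_sum.
Qed.

Lemma csum_series_Im (f : nat -> C) : l1 f ->
  series (fun k => Im (f k)) @ \oo --> Im (csum f).
Proof.
move=> hf; apply/cvgrPdist_lt => e e0; have [N0 h] := csum_series hf e0.
exists N0 => // N /= /h; apply: le_lt_trans; apply: le_trans (nrm_Im _).
rewrite cImD /series/= big_mkord.
suff -> : Im (- \sum_(k < N) f k) = - \sum_(k < N) Im (f k) by [].
by rewrite raddfN raddf_sum.
Qed.

Definition ps (b : nat -> C) (z : C) : C := csum (fun n => b n * z ^+ n).

Section PS.
Variable b : nat -> C.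
Hypothesis hb : l1 b.

Lemma nrmX_le1 (z : C) n : nrm z <= 1 -> nrm (z ^+ n) <= 1.
Proof. by move=> hz; rewrite nrmX exprn_ile1 ?nrm_ge0. Qed.

Lemma ps_l1 (z : C) : nrm z <= 1 -> l1 (fun n => b n * z ^+ n) /\
  l1n (fun n => b n * z ^+ n) <= l1n b.
Proof.
move=> hz; rewrite -[X in _ <= X]mul1r.
by apply: l1_mulb => // n; exact: nrmX_le1.
Qed.

Lemma ps_bound (z : C) : nrm z <= 1 -> nrm (ps b z) <= l1n b.
Proof.
by move=> /ps_l1[h1 h2]; apply: le_trans h2; exact: csum_norm.
Qed.

(** Each of the n terms of 1 + rho + ... + rho^(n-1) is at least rho^(n-1); the induction carries
    this comparison multiplied by [1 - rho]. *)
Lemma geo_bd (rho : R) n : 0 <= rho < 1 -> n%:R * rho ^+ n.-1 <= (1 - rho)^-1.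
Proof.
move=> /andP[r0 r1]; have r1' : 0 < 1 - rho by rewrite subr_gt0.
rewrite -[leRHS]mul1r ler_pdivlMr//.
have H m : m.+1%:R * rho ^+ m * (1 - rho) <= 1 - rho ^+ m.+1.
  elim: m => [|m IH]; first by rewrite expr0 expr1 !mul1r.
  have rm : 0 <= rho ^+ m by rewrite exprn_ge0.
  have -> : m.+2%:R * rho ^+ m.+1 * (1 - rho) =
     rho * (m.+1%:R * rho ^+ m * (1 - rho)) + rho ^+ m.+1 * (1 - rho).
    by rewrite exprS -(natr1 m.+1); ring.
  have rm1 : rho ^+ m <= 1 by rewrite exprn_ile1// ltW.
  have rp : rho * rho ^+ m <= 1 by rewrite mulr_ile1// ltW.
  have := mulr_ge0 (ltW r1') (_ : 0 <= 1 - rho * rho ^+ m).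
  rewrite subr_ge0 => /(_ rp).
  have := ler_wpM2l r0 IH; rewrite !exprS; set X := _ * _ * (1 - rho).
  by move: (rho ^+ m) => p; lra.
case: n => [|n] /=; first by rewrite !mul0r.
by apply: le_trans (H n) _; rewrite gerBl exprn_ge0.
Qed.

(** The constant must be uniform in the exponent, so that the remainders can be summed against [b].
    With K = 1/(1 - rho) each step of the recursion gives [rho * K ^+ 2 + K], which is again K^2. *)
Lemma pow_taylor (rho : R) (z w : C) n : 0 <= rho < 1 -> nrm z <= rho ->
  nrm w <= rho ->
  nrm (w ^+ n - z ^+ n - n%:R * z ^+ n.-1 * (w - z)) <=
  (1 - rho)^-1 ^+ 2 * nrm (w - z) ^+ 2.
Proof.
move=> hr hz hw; have /andP[r0 r1] := hr.
have r1' : 0 < 1 - rho by rewrite subr_gt0.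
set K := (1 - rho)^-1; have K0 : 0 <= K by rewrite invr_ge0 ltW.
set d := nrm (w - z); have d0 : 0 <= d by exact: nrm_ge0.
elim: n => [|n IH].
  by rewrite !expr0 subrr !mul0r subr0 nrm0 mulr_ge0// sqr_ge0.
have -> : w ^+ n.+1 - z ^+ n.+1 - n.+1%:R * z ^+ n.+1.-1 * (w - z) =
  w * (w ^+ n - z ^+ n - n%:R * z ^+ n.-1 * (w - z)) +
  (n%:R * z ^+ n.-1) * (w - z) ^+ 2.
  case: n {IH} => [|n] /=; first by rewrite !expr0 !expr1; ring.
  by rewrite -(natr1 n.+1) !exprS; ring.
apply: le_trans (nrmD _ _) _.
rewrite (nrmM w) (nrmM (n%:R * z ^+ n.-1)) (nrmX (w - z) 2) -/d.
have h1 : nrm (n%:R * z ^+ n.-1 : C) <= K.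
  apply: le_trans (geo_bd n hr); rewrite nrmM nrmX.
  have -> : nrm (n%:R : C) = n%:R.
    by rewrite (_ : n%:R = (n%:R : R)%:C) ?nrmC ?ger0_norm// rmorph_nat.
  by rewrite ler_wpM2l// lerXn2r// ?nnegrE ?nrm_ge0.
have h2 := ler_wpM2r (sqr_ge0 d) h1.
have h3 : nrm w * nrm (w ^+ n - z ^+ n - n%:R * z ^+ n.-1 * (w - z)) <=
    rho * (K ^+ 2 * d ^+ 2).
  by apply: ler_pM => //; exact: nrm_ge0.
apply: le_trans (lerD h3 h2) _.
have -> : rho * (K ^+ 2 * d ^+ 2) + K * d ^+ 2 = (rho * K ^+ 2 + K) * d ^+ 2 by ring.
rewrite ler_wpM2r ?sqr_ge0// le_eqVlt; apply/orP; left; apply/eqP.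
by rewrite /K; field; rewrite gt_eqF.
Qed.

Lemma ps_deriv (z : C) : nrm z < 1 -> deriv1 (ps b) z.
Proof.
move=> hz; pose rho := (nrm z + 1) / 2.
have zr : nrm z < rho by rewrite /rho; lra.
have r1 : rho < 1 by rewrite /rho; lra.
have r0 : 0 <= rho by apply: le_trans (ltW zr); exact: nrm_ge0.
have hr : 0 <= rho < 1 by rewrite r0 r1.
pose D := csum (fun n => b n * (n%:R * z ^+ n.-1)).
have hbd n : nrm (n%:R * z ^+ n.-1 : C) <= (1 - rho)^-1.
  apply: le_trans (geo_bd n hr); rewrite nrmM nrmX.
  have -> : nrm (n%:R : C) = n%:R.
    by rewrite (_ : n%:R = (n%:R : R)%:C) ?nrmC ?ger0_norm// rmorph_nat.
  by rewrite ler_wpM2l// lerXn2r// ?nnegrE ?nrm_ge0// ltW.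
have K0 : 0 <= (1 - rho)^-1 by rewrite invr_ge0 subr_ge0 ltW.
have [hD _] := l1_mulb hb hbd K0.
apply: (@cdiff_quad _ _ _ D ((1 - rho)^-1 ^+ 2 * l1n b) (rho - nrm z)).
- by rewrite subr_gt0.
- by rewrite mulr_ge0 ?sqr_ge0 ?l1n_ge0.
move=> w hw.
have wr : nrm w <= rho.
  by rewrite -(subrK z w) (le_trans (nrmD _ _))// -lerBrDr ltW.
have [h1 _] := ps_l1 (le_trans wr (ltW r1)).
have [h2 _] := ps_l1 (ltW hz).
have [h3 _] := l1B h1 h2.
have [h4 _] := l1Z (w - z) hD.
have [h5 _] := l1B h3 h4.
rewrite (mulrC D) /D -csumZ// /ps -csumB// -csumB//.
have hq n : nrm (w ^+ n - z ^+ n - n%:R * z ^+ n.-1 * (w - z)) <=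
  (1 - rho)^-1 ^+ 2 * nrm (w - z) ^+ 2.
  by apply: pow_taylor => //; exact: ltW.
have Q0 : 0 <= (1 - rho)^-1 ^+ 2 * nrm (w - z) ^+ 2 by rewrite mulr_ge0// sqr_ge0.
have [h6 h7] := l1_mulb hb hq Q0.
rewrite mulrAC; apply: le_trans h7.
rewrite (eq_csum (g := fun n => b n * (w ^+ n - z ^+ n - n%:R * z ^+ n.-1 * (w - z)))).
  exact: csum_norm.
by move=> n; ring.
Qed.

Lemma pow_lip (z w : C) n : nrm z <= 1 -> nrm w <= 1 ->
  nrm (w ^+ n - z ^+ n) <= n%:R * nrm (w - z).
Proof.
move=> hz hw; elim: n => [|n IH]; first by rewrite !expr0 subrr nrm0 mul0r.
have -> : w ^+ n.+1 - z ^+ n.+1 = w * (w ^+ n - z ^+ n) + z ^+ n * (w - z).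
  by rewrite !exprS; ring.
apply: le_trans (nrmD _ _) _; rewrite !nrmM -natr1 mulrDl mul1r lerD//.
  by apply: le_trans IH; rewrite ler_piMl ?nrm_ge0.
by rewrite ler_piMl ?nrm_ge0// nrmX_le1.
Qed.

(** Absolute summability gives continuity up to the boundary. Finitely many powers are Lipschitz on
    the closed disk; the remaining coefficients have total norm below [e / 4] and move the value by
    less than [e / 2]. *)
Lemma ps_cts (z : C) : nrm z <= 1 -> forall e : R, 0 < e ->
  exists2 d : R, 0 < d & forall w, nrm w <= 1 -> nrm (w - z) < d ->
    nrm (ps b w - ps b z) < e.
Proof.
move=> hz e e0; have e4 : 0 < e / 4 by rewrite divr_gt0.
have [s us hs] := l1_tail hb e4.
pose N := (\max_(i <- s) i.+1)%N.
pose K := N%:R * l1n b + 1.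
have K0 : 0 < K by rewrite /K ltr_wpDl// mulr_ge0// l1n_ge0.
exists (e / 2 / K); first by rewrite !divr_gt0.
move=> w hw hd; have [h1 _] := ps_l1 hw; have [h2 _] := ps_l1 hz.
rewrite /ps -csumB//.
pose u n := b n * (if n \in s then w ^+ n - z ^+ n else 0).
pose v n := (if n \in s then 0 else b n) * (w ^+ n - z ^+ n).
have hN n : n \in s -> n%:R <= (N%:R : R).
  move=> sn; rewrite ler_nat ltnW//.
  exact: (@leq_bigmax_seq _ s xpredT (fun i => i.+1) n sn isT).
have [hu1 hu2] : l1 u /\ l1n u <= N%:R * nrm (w - z) * l1n b.
  apply: l1_mulb => //; last by rewrite mulr_ge0// nrm_ge0.
  move=> n; case: ifPn => sn; last by rewrite nrm0 mulr_ge0// nrm_ge0.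
  by apply: le_trans (pow_lip _ hz hw) _; rewrite ler_wpM2r ?nrm_ge0// hN.
have ht : l1 (fun n => if n \in s then 0 else b n).
  have [] := l1_if (predC (mem s)) hb; move=> h _; move: h; congr l1.
  by apply/funext => n /=; case: (n \in s).
have [hv1 hv2] : l1 v /\ l1n v <= 2 * l1n (fun n => if n \in s then 0 else b n).
  apply: l1_mulb => // n; apply: le_trans (nrmB _ _) _.
  by apply: lerD; exact: nrmX_le1.
have -> : csum (fun i => b i * w ^+ i - b i * z ^+ i) = csum u + csum v.
  rewrite -csumD//; apply: eq_csum => n; rewrite /u /v.
  by case: ifP => _; ring.
have c1 := csum_norm hu1; have c2 := csum_norm hv1.
have := nrmD (csum u) (csum v).
have b0 := l1n_ge0 b; have dz := nrm_ge0 (w - z).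
move: hd; rewrite ltr_pdivlMr// /K => hd; nra.
Qed.

(** Once the earlier coefficients vanish, dividing the series by the n-th power of [x] expresses
    [b n] as [x] times a quantity bounded by [l1n b]; then [x] tends to 0. *)
Lemma ps_zero : (forall x : R, 0 < x < 1 -> ps b x%:C = 0) -> forall n, b n = 0.
Proof.
move=> h0 n; have [k] := ubnP n; elim: k n => // k IH n; rewrite ltnS => nk.
have IH' m : (m < n)%N -> b m = 0 by move=> mn; apply: IH; exact: leq_trans nk.
apply: nrm_eq0; apply/eqP; rewrite eq_le nrm_ge0 andbT.
have M0 := l1n_ge0 b.
have key (x : R) : 0 < x < 1 -> nrm (b n) <= x * l1n b.
  move=> /andP[x0 x1]; have xC : nrm (x%:C : C) <= 1 by rewrite nrmC ger0_norm ltW.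
  have [hl _] := ps_l1 xC.
  have xn0 : x%:C ^+ n != 0 :> C by rewrite expf_neq0// (inj_eq (@complexI R) _ 0) gt_eqF.
  have E : b n * x%:C ^+ n = - csum (fun m => (if m == n then 0 else b m * x%:C ^+ m)).
    have [h1 _] := l1_if (pred1 n) hl; have [h2 _] := l1_if (predC1 n) hl.
    have h2' : l1 (fun m => if m == n then 0 else b m * x%:C ^+ m).
      by move: h2; congr l1; apply/funext => m /=; case: (m == n).
    have -> : b n * x%:C ^+ n = csum (fun m => if m == n then b m * x%:C ^+ m else 0).
      by rewrite (@csum1 _ _ _ n) ?eqxx// => m /negbTE ->.
    apply/eqP; rewrite -addr_eq0 -csumD//.
    have := h0 x; rewrite x0 x1 => /(_ isT); rewrite /ps => E.
    apply/eqP; rewrite -[RHS]E; apply: eq_csum => m.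
    by case: ifP; rewrite ?addr0 ?add0r.
  have hq : l1 (fun m => (if (m <= n)%N then 0 else b m * x%:C ^+ (m - n.+1)) ) /\
     l1n (fun m => (if (m <= n)%N then 0 else b m * x%:C ^+ (m - n.+1))) <= 1 * l1n b.
    have -> : (fun m => (if (m <= n)%N then 0 else b m * x%:C ^+ (m - n.+1))) =
      (fun m => b m * (if (m <= n)%N then 0 else x%:C ^+ (m - n.+1))).
      by apply/funext => m; case: ifP; rewrite ?mulr0.
    apply: l1_mulb => // m; case: ifP => _; first by rewrite nrm0.
    exact: nrmX_le1.
  have [hq1 hq2] := hq.
  have E2 : b n = - (x%:C * csum (fun m => (if (m <= n)%N then 0 else b m * x%:C ^+ (m - n.+1)))).
    apply: (mulIf xn0); rewrite E mulNr; congr (- _).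
    rewrite mulrAC -exprS -csumZ//; apply: eq_csum => m.
    case: (ltngtP m n) => [mn|mn|//]; rewrite ?mulr0//.
      by rewrite IH' ?mul0r.
    by rewrite mulrCA -exprD subnKC.
  rewrite E2 nrmN nrmM nrmC ger0_norm ?(ltW x0)// ler_wpM2l ?(ltW x0)//.
  by apply: le_trans (csum_norm hq1) _; rewrite mul1r in hq2.
apply/ler_addgt0Pl => e e0; rewrite addr0.
pose x := Num.min (2^-1) (e / (l1n b + 1)).
have x0 : 0 < x by rewrite lt_min invr_gt0// ltr0n/= divr_gt0//; lra.
have x1 : x < 1 by rewrite (@le_lt_trans _ _ 2^-1)// ?ge_min ?lexx// invf_lt1// ltr1n.
have := key x; rewrite x0 x1 => /(_ isT) /le_trans; apply.
have xe : x <= e / (l1n b + 1) by rewrite ge_min lexx orbT.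
rewrite ler_pdivlMr in xe; last by lra.
by nra.
Qed.

End PS.
Definition expc (z : C) (n : nat) : C := z ^+ n / n`!%:R.

Lemma nrm1_le : nrm (1 : C) <= 1.
Proof. by rewrite nrm1. Qed.

Lemma nrm_nat n : nrm (n%:R : C) = n%:R.
Proof. by rewrite (_ : n%:R = (n%:R : R)%:C) ?nrmC ?ger0_norm// rmorph_nat. Qed.

Lemma expc_l1 z : l1 (expc z) /\ l1n (expc z) <= expR (nrm z).
Proof.
apply: l1_bd; apply: asum_leP => s us.
pose N := (\max_(i <- s) i.+1)%N.
have E k : nrm (expc z k) = exp_coeff (nrm z) k.
  by rewrite /expc nrmM nrmX nrmV nrm_nat.
apply: (@le_trans _ _ (\sum_(0 <= k < N) nrm (expc z k))).
  rewrite -[leLHS]addr0 (perm_big [seq i <- iota 0 N | i \in s]) /=.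
    rewrite big_filter /index_iota subn0 [leRHS](bigID (mem s)) /= lerD2l.
    by apply: sumr_ge0 => i _; exact: nrm_ge0.
  apply: uniq_perm => //; first by rewrite filter_uniq// iota_uniq.
  move=> i; rewrite mem_filter mem_iota /= add0n.
  case: (boolP (i \in s)) => //= si; rewrite /N.
  by rewrite (@leq_bigmax_seq _ s xpredT (fun i => i.+1) i si isT).
rewrite (eq_bigr (exp_coeff (nrm z))); last by move=> k _; exact: E.
have := @nondecreasing_cvgn_le _ (series (exp_coeff (nrm z))) _ (is_cvg_series_exp_coeff _) N.
apply; apply: nondecreasing_series => n _ _; apply: exp_coeff_ge0; exact: nrm_ge0.
Qed.

Lemma conv_expc z w n : conv (expc z) (expc w) n = expc (z + w) n.
Proof.
pose s := [seq (j, (n - j)%N) | j <- iota 0 n.+1].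
have us : uniq s.
  rewrite map_inj_in_uniq ?iota_uniq// => a b _ _ [] //.
rewrite /conv /push (@csum_fin _ _ _ s)//; last first.
  move=> [a b] /=; case: eqP => //= abn /mapP[]; exists a.
    by rewrite mem_iota /= add0n ltnS -abn leq_addr.
  by rewrite -abn addKn.
rewrite big_map; transitivity (\sum_(0 <= j < n.+1)
   (if (j + (n - j))%N == n then expc z j * expc w (n - j) else 0)).
  by rewrite /index_iota subn0.
rewrite [RHS]/expc addrC exprDn mulr_suml big_mkord; apply: eq_bigr => -[i /=].
rewrite ltnS => ni _; rewrite subnKC// eqxx /expc.
have h (m : nat) : (m`!%:R : C) != 0 by rewrite pnatr_eq0 -lt0n fact_gt0.
have := bin_fact ni; move/(congr1 (fun m => m%:R : C)); rewrite !natrM => <-.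
have hb : ('C(n, i)%:R : C) != 0 by rewrite pnatr_eq0 -lt0n bin_gt0.
by rewrite -mulr_natr; field; rewrite hb !h.
Qed.

Lemma csum_expcD z w : csum (expc (z + w)) = csum (expc z) * csum (expc w).
Proof.
have H : csum (fun n => conv (expc z) (expc w) n * 1) =
    csum (fun n => expc z n * 1) * csum (fun n => expc w n * 1).
  apply: (@ev_conv R _ (fun _ : nat => 1)); [|move=> _; exact: nrm1_le|exact: (expc_l1 z).1|exact: (expc_l1 w).1].
  by move=> _ _; rewrite mulr1.
have m1 (f : nat -> C) : csum (fun n => f n * 1) = csum f.
  by apply: eq_csum => n; rewrite mulr1.
by rewrite !m1 in H; rewrite -H; apply: eq_csum => n; rewrite conv_expc.
Qed.

Lemma csum_expcR (x : R) : csum (expc x%:C) = (expR x)%:C.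
Proof.
have hl := (expc_l1 x%:C).1.
have E k : expc x%:C k = (exp_coeff x k)%:C.
  by rewrite /expc /exp_coeff /= rmorphM rmorphXn fmorphV rmorph_nat.
rewrite [LHS](_ : _ = Re (csum (expc x%:C)) +i* Im (csum (expc x%:C))); last by case: csum.
congr (_ +i* _).
  have := csum_series_Re hl; under eq_fun do rewrite E /=.
  by move=> /cvg_lim <-.
have := csum_series_Im hl; under eq_fun do rewrite E /=.
move=> /cvg_lim <- //; apply/cvg_lim => //.
rewrite (_ : series _ = fun=> 0); first exact: cvg_cst.
by apply/funext => n; rewrite /series/= big1.
Qed.

Lemma csum_expcI (y : R) : csum (expc (0 +i* y)) = cos y +i* sin y.
Proof.
have hl := (expc_l1 (0 +i* y)).1.
have iE : (0 +i* y : C) = 'i * y%:C by simpc.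
have i2 m : ('i ^+ m.*2 : C) = ((-1) ^+ m)%:C.
  by rewrite -mul2n exprM sqr_i rmorphXn rmorphN1.
have E k : expc (0 +i* y) k = cos_coeff y k +i* sin_coeff y k.
  rewrite /expc iE exprMn -(odd_double_half k).
  set m := k./2; rewrite exprD i2.
  rewrite /cos_coeff /sin_coeff /= odd_double_half -/m -exprnP.
  have -> : ((k`!)%:R : C)^-1 = ((k`!)%:R^-1 : R)%:C by rewrite fmorphV rmorph_nat.
  rewrite -rmorphXn; case: (boolP (odd k)) => ok /=; rewrite ?expr1 ?expr0.
    have -> : k.-1./2 = m by rewrite /m -[k in LHS]odd_double_half ok /= doubleK.
    by simpc; congr (_ +i* _); ring.
  by simpc; congr (_ +i* _); ring.
rewrite [LHS](_ : _ = Re (csum (expc (0 +i* y))) +i* Im (csum (expc (0 +i* y)))); last by case: csum.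
congr (_ +i* _).
  have := csum_series_Re hl; under eq_fun do rewrite E /=.
  by move=> /cvg_lim <- //; rewrite cos.unlock.
have := csum_series_Im hl; under eq_fun do rewrite E /=.
by move=> /cvg_lim <- //; rewrite sin.unlock.
Qed.

(** [cexp] is built from real functions. Its series provides the derivative and evaluates
    exponentials of elements of the convolution algebra. *)
Lemma cexp_series (z : C) : cexp z = csum (expc z).
Proof.
rewrite {2}(_ : z = (Re z)%:C + (0 +i* Im z)); last by case: z => a b; simpc.
by rewrite csum_expcD csum_expcR csum_expcI.
Qed.

Lemma cexpD (z w : C) : cexp (z + w) = cexp z * cexp w.
Proof. by rewrite !cexp_series csum_expcD. Qed.

Lemma cexp0 : cexp (0 : C) = 1.
Proof. by rewrite /cexp /= expR0 cos0 sin0 mul1r. Qed.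

Lemma nrm_cexp (z : C) : nrm (cexp z) = expR (Re z).
Proof.
rewrite /cexp nrmM nrmC ger0_norm ?expR_ge0// [X in _ * X](_ : _ = 1) ?mulr1//.
by rewrite /nrm normc_def /= cos2Dsin2 sqrtr1.
Qed.

Lemma cexp_neq0 (z : C) : cexp z != 0.
Proof. by rewrite -nrm_gt0 nrm_cexp expR_gt0. Qed.

Lemma cexpN (z : C) : cexp (- z) = (cexp z)^-1.
Proof.
apply: (mulIf (cexp_neq0 z)).
by rewrite -cexpD addNr cexp0 mulVf// cexp_neq0.
Qed.

(** Power series are differentiated inside the unit disk only, so the derivative is found at 0 and
    carried to [z] by the addition law. *)
Lemma cexp_deriv (z : C) : deriv1 (@cexp R) z.
Proof.
have h0 : deriv1 (@cexp R) 0.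
  have -> : @cexp R = ps (expc 1).
    apply/funext => w; rewrite cexp_series /ps; apply: eq_csum => n.
    by rewrite /expc expr1n mul1r mulrC.
  by apply: ps_deriv; [exact: (expc_l1 1).1|rewrite nrm0 ltr01].
have -> : @cexp R = (fun w => cexp z * cexp (w - z)).
  by apply/funext => w; rewrite -cexpD addrC subrK.
apply: deriv1M; first exact: deriv1_cst.
have h1 : deriv1 (fun w : C => w - z) z.
  by apply: deriv1B; [exact: deriv1_id|exact: deriv1_cst].
have := @deriv1_comp R (@cexp R) (fun w => w - z) z h1.
by rewrite subrr => /(_ h0).
Qed.

End PowerSeries.

(** * Circle means in logarithmic polar coordinates *)

Section Mean.
Variable R : realType.
Local Notation C := R[i].

Lemma ccont_eps (f : R -> C) :
  (forall x e, 0 < e -> exists2 d : R, 0 < d &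
     forall x', `|x' - x| < d -> nrm (f x' - f x) < e) -> ccont f.
Proof.
move=> h; split=> x; apply/cvgrPdist_lt => e e0; have [d d0 hd] := h x e e0;
  near=> y; have /hd : `|y - x| < d by near: y; apply: cvgr_distC_lt => //; exact: cvg_id.
  by apply: le_lt_trans; apply: le_trans (nrm_Re _); rewrite distrC cReD raddfN.
by apply: le_lt_trans; apply: le_trans (nrm_Im _); rewrite distrC cImD raddfN.
Unshelve. all: by end_near. Qed.

Variable H : C -> C.
Hypothesis Hc : forall z : C, z != 0 -> ccts H z.

Definition polar (x y : R) : C := H (cexp (x +i* y)).

(** Indexed by the logarithm of the radius, so that the unit circle is [x = 0]; the factor 1/(2 pi)
    is left out. *)
Definition circle_mean (x : R) : C := CI (polar x) (- pi) pi.

Lemma polar_joint (x y e : R) : 0 < e -> exists2 d : R, 0 < d &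
  forall x' y', `|x' - x| < d -> `|y' - y| < d ->
    nrm (polar x' y' - polar x y) < e.
Proof.
have hc : ccts (H \o @cexp R) (x +i* y).
  by apply: ccts_comp; [exact/deriv1_ccts/cexp_deriv|apply: Hc; exact: cexp_neq0].
move=> /hc[d d0 hd]; exists (d / 2); first by rewrite divr_gt0.
move=> x' y' hx hy; apply: hd; apply: le_lt_trans (nrm_ReIm _) _.
by rewrite /= ; lra.
Qed.

Lemma polar_ccontx y : ccont (fun x => polar x y).
Proof.
apply: ccont_eps => x e e0; have [d d0 hd] := polar_joint x y e0.
by exists d => // x' hx; apply: hd => //; rewrite subrr normr0.
Qed.

Lemma polar_cconty x : ccont (polar x).
Proof.
apply: ccont_eps => y e e0; have [d d0 hd] := polar_joint x y e0.
by exists d => // y' hy; apply: hd => //; rewrite subrr normr0.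
Qed.

Lemma polar_periodic x : polar x (- pi) = polar x pi.
Proof. by rewrite /polar /cexp /= cosN sinN sinpi oppr0. Qed.

(** Compactness of the segment makes the continuity of [polar] in the radius uniform in the angle.
    The tolerance [e1] offsets the bound 2 e1 (2 pi) for an integral over the full circle. *)
Lemma mean_cts (x e : R) : 0 < e -> exists2 d : R, 0 < d &
  forall x', `|x' - x| < d -> nrm (circle_mean x' - circle_mean x) <= e.
Proof.
move=> e0; have pi0 := pi_gt0 R.
pose e1 := e / (4 * pi); have e10 : 0 < e1 by rewrite divr_gt0// mulr_gt0.
have cov := @segment_compact R (- pi) pi.
have /(_ R (nbhs x) (fun x' y => nrm (polar x' y - polar x y) < e1) _) :=
  (compact_near_coveringP _).1 cov.
move=> [].
  move=> y _; have e12 : 0 < e1 / 2 by rewrite divr_gt0.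
  have [d d0 hd] := polar_joint x y e12.
  exists (ball y d, ball x d).
    by split; apply: nbhsx_ballx.
  move=> [y' x'] [/= hy hx]; rewrite -ball_normE /= distrC in hy.
  rewrite -ball_normE /= distrC in hx.
  have h1 := hd x' y' hx hy.
  have h2 : nrm (polar x y' - polar x y) < e1 / 2.
    by apply: hd => //; rewrite subrr normr0.
  have -> : polar x' y' - polar x y' =
    (polar x' y' - polar x y) - (polar x y' - polar x y) by ring.
  by apply: le_lt_trans (nrmB _ _) _; lra.
move=> d d0 hd; exists d => // x' hx'.
have npi : - pi <= pi :> R by lra.
have hp : circle_mean x' - circle_mean x =
    CI (fun y => polar x' y + (-1) * polar x y) (- pi) pi.
  rewrite CID//; [|exact: polar_cconty|].
    by rewrite CIZ//; [rewrite mulN1r|exact: polar_cconty].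
  by apply: ccontM; [exact: ccont_cst|exact: polar_cconty].
rewrite hp; apply: le_trans (CI_bound (M := e1) npi _ _) _.
- apply: ccontD; first exact: polar_cconty.
  by apply: ccontM; [exact: ccont_cst|exact: polar_cconty].
- move=> y hy; rewrite mulN1r ltW//.
  have hb : ball x d x' by rewrite -ball_normE /= distrC.
  by apply: (hd x' hb); rewrite /= in_itv.
rewrite /e1; move: pi0; move: (pi : R) => p p0.
by rewrite le_eqVlt; apply/orP; left; apply/eqP; field; rewrite gt_eqF.
Qed.

Hypothesis Hd : forall z : C, z != 0 -> nrm z != 1 -> deriv1 H z.

Lemma polar_rdiff (x y : R) : x != 0 -> rdiff polar x y.
Proof.
move=> x0.
have hd : deriv1 (H \o @cexp R) (x +i* y).
  apply: deriv1_comp; first exact: cexp_deriv.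
  apply: Hd; first exact: cexp_neq0.
  by rewrite nrm_cexp /= -expR0 (inj_eq (@expR_inj R)).
have /cdiffP[D hD] := hd; exists D => e e0; have [d d0 hh] := hD e e0.
exists (d / 2); first by rewrite divr_gt0.
move=> x' y' hx hy; have E : x' +i* y' - (x +i* y) = (x' - x) +i* (y' - y) by simpc.
have := hh (x' +i* y'); rewrite E.
have hn : nrm ((x' - x) +i* (y' - y)) <= `|x' - x| + `|y' - y| by exact: nrm_ReIm.
move=> /(_ _); rewrite (le_lt_trans hn) => [/(_ isT) h|]; last by lra.
by apply: le_trans h _; rewrite ler_wpM2l// ltW.
Qed.

(** Goursat's theorem on the rectangle between [x1] and [x2] of height 2 pi: the vertical sides are
    the two means, and the horizontal ones cancel because [polar] is periodic in the angle. *)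
Lemma mean_const_aux (x1 x2 : R) : x1 <= x2 -> (forall x, x1 <= x <= x2 -> x != 0) ->
  circle_mean x1 = circle_mean x2.
Proof.
move=> x12 hx; have pi0 := pi_gt0 R.
have := @goursat R polar polar_ccontx polar_cconty x1 (x2 - x1) (- pi) (2 * pi).
rewrite subr_ge0 => /(_ x12).
have p2 : 0 <= 2 * pi :> R by rewrite mulr_ge0// ltW.
move=> /(_ p2); rewrite /rect_int.
have -> : x1 + (x2 - x1) = x2 by ring.
have -> : - pi + 2 * pi = pi :> R by ring.
have -> : (fun t => polar t (- pi)) = (fun t => polar t pi).
  by apply/funext => t; exact: polar_periodic.
rewrite -/(circle_mean x2) -/(circle_mean x1).
move=> h; have {}h : 'i * (circle_mean x2 - circle_mean x1) = 0.
  rewrite -[RHS]h; first by ring.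
  by move=> x' y' hx' _; apply: polar_rdiff; exact: hx.
have i0 : ('i : C) != 0 by rewrite eq_complex /= negb_and oner_neq0 orbT.
move/eqP: h; rewrite mulf_eq0 (negbTE i0) /= subr_eq0 => /eqP ->.
by [].
Qed.

(** On either side of the unit circle, where derivability is known, the mean is constant; its
    continuity at [x = 0] joins the two values. *)
Lemma mean_const (x : R) : circle_mean x = circle_mean 0.
Proof.
have [->//|x0] := eqVneq x 0.
apply/eqP; rewrite -subr_eq0; apply/eqP/nrm_eq0/eqP.
rewrite eq_le nrm_ge0 andbT; apply/ler_addgt0Pl => e e0; rewrite addr0.
have [d d0 hd] := mean_cts 0 e0.
have [xp|xn] := ltrP 0 x.
  pose x' := Num.min x (d / 2).
  have x'0 : 0 < x' by rewrite lt_min xp divr_gt0.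
  have x'd : x' <= d / 2 by rewrite ge_min lexx orbT.
  rewrite -(@mean_const_aux x' x).
  - by apply: hd; rewrite subr0 gtr0_norm//; lra.
  - by rewrite ge_min lexx.
  - by move=> t /andP[ht _]; rewrite gt_eqF// (lt_le_trans x'0).
have {}xn : x < 0 by rewrite lt_neqAle x0.
pose x' := Num.max x (- (d / 2)).
have x'0 : x' < 0 by rewrite gt_max xn oppr_lt0 divr_gt0.
have x'd : - (d / 2) <= x' by rewrite le_max lexx orbT.
rewrite (@mean_const_aux x x').
- by apply: hd; rewrite subr0 ltr0_norm//; lra.
- by rewrite le_max lexx.
- by move=> t /andP[_ ht]; rewrite lt_eqF// (le_lt_trans ht).
Qed.

Lemma mean_small (x e : R) : (forall z, nrm z = expR x -> nrm (H z) <= e) ->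
  nrm (circle_mean x) <= 4 * pi * e.
Proof.
move=> h; have pi0 := pi_gt0 R.
have npi : - pi <= pi :> R by lra.
apply: le_trans (CI_bound (M := e) npi (polar_cconty x) _) _.
  by move=> y _; apply: h; rewrite nrm_cexp.
by lra.
Qed.

Lemma mean_zero_of_small :
  (forall e : R, 0 < e -> exists x, forall z, nrm z = expR x -> nrm (H z) <= e) ->
  forall x, circle_mean x = 0.
Proof.
move=> h x; rewrite mean_const; apply/nrm_eq0/eqP; have pi0 := pi_gt0 R.
rewrite eq_le nrm_ge0 andbT; apply/ler_addgt0Pl => e e0; rewrite addr0.
have e1 : 0 < e / (4 * pi) by rewrite divr_gt0// mulr_gt0.
have [y hy] := h _ e1; rewrite -(mean_const y).
apply: le_trans (mean_small hy) _; move: pi0; move: (pi : R) => p p0.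
by rewrite le_eqVlt; apply/orP; left; apply/eqP; field; rewrite gt_eqF.
Qed.

End Mean.

(** * A concentrating kernel on the circle *)

Section Kernel.
Variable R : realType.

(** This is the square of cos(y/2): it lies between 0 and 1 and, on [[- pi, pi]], equals 1 only at
    0. On a circle it is a combination of 1, z and z^-1. *)
Definition kern (y : R) : R := (1 + cos y) / 2.

Lemma kern_cont : continuous kern.
Proof.
move=> y; apply: (@continuousM _ _ (fun y => 1 + cos y) (fun=> 2^-1)).
  by apply: (@continuousD _ _ _ (fun=> 1 : R) (@cos R));
    [exact: cst_continuous|exact: continuous_cos].
exact: cst_continuous.
Qed.

Lemma contM (f g : R -> R) : continuous f -> continuous g ->
  continuous (fun y => f y * g y).
Proof. by move=> cf cg y; exact: (@continuousM _ _ f g y (cf y) (cg y)). Qed.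

Lemma contX (f : R -> R) n : continuous f -> continuous (fun y => f y ^+ n).
Proof.
move=> cf; elim: n => [|n IH].
  under eq_fun do rewrite expr0; move=> y; exact: cst_continuous.
by under eq_fun do rewrite exprS; exact: contM.
Qed.

Lemma contD (f g : R -> R) : continuous f -> continuous g ->
  continuous (fun y => f y + g y).
Proof. by move=> cf cg y; apply: continuousD; [exact: cf|exact: cg]. Qed.

Lemma contc (c : R) : continuous (fun _ : R => c).
Proof. by move=> y; exact: cst_continuous. Qed.

Definition wallis n : R := rint (fun y => kern y ^+ n) (- pi) pi.

(** The function [sin y * kern y ^+ n] vanishes at both ends, and its derivative is a combination of
    two consecutive powers of [kern]. *)
Lemma wallis_rec n : 2 * n.+1%:R * wallis n.+1 = (2 * n%:R + 1) * wallis n.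
Proof.
have pi0 := pi_gt0 R; have npi : - pi <= pi :> R by lra.
have ck m : continuous (fun y => kern y ^+ m) by exact/contX/kern_cont.
have dk (y : R) : is_derive y 1 kern (- sin y / 2).
  have d1 : is_derive y 1 (fun y : R => 1 + cos y) (0 + - sin y).
    exact: is_deriveD (is_derive_cst (1 : R) y (1 : R^o)) (is_derive_cos y).
  have := @is_deriveZ _ _ _ (fun y : R => 1 + cos y) (2^-1) y 1 _ d1.
  rewrite /GRing.scale /= add0r mulrC; congr (is_derive _ _ _ _).
  by apply/funext => t; rewrite /kern mulrC.
have dkn (y : R) : is_derive y 1 (fun y => kern y ^+ n) (n%:R * kern y ^+ n.-1 * (- sin y / 2)).
  have := is_deriveX n (dk y); rewrite /GRing.scale /=.
  have -> : kern ^+ n = (fun y => kern y ^+ n).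
    apply/funext => t; elim: (n) => [|m IH]; first by rewrite !expr0.
    by rewrite !exprS -IH.
  by [].
pose f (y : R) := 2 * n.+1%:R * kern y ^+ n.+1 + (- (2 * n%:R + 1)) * kern y ^+ n.
have hd (y : R) : is_derive y 1 (fun y => sin y * kern y ^+ n) (f y).
  have := is_deriveM (is_derive_sin y) (dkn y); rewrite /GRing.scale /=.
  congr (is_derive _ _ _ _).
  have hs : sin y ^+ 2 = 4 * kern y * (1 - kern y).
    have := cos2Dsin2 y; rewrite /kern => h.
    have -> : sin y ^+ 2 = 1 - cos y ^+ 2 by rewrite -h; ring.
    by field.
  have hc : cos y = 2 * kern y - 1 by rewrite /kern; field.
  rewrite /f hc; case: n {ck dkn f} => [|m] /=; first by rewrite !expr0 !expr1; ring.
  have -> : sin y * (m.+1%:R * kern y ^+ m * (- sin y / 2)) =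
     - (m.+1%:R * kern y ^+ m / 2) * sin y ^+ 2 by ring.
  by rewrite hs !exprS -(natr1 m.+1); field.
have cf : continuous f.
  by apply: contD; apply: contM; [exact: contc|exact: ck|exact: contc|exact: ck].
have := rint_FTC npi cf hd.
rewrite sinN sinpi oppr0 !mul0r subrr /f rintD//; last 2 first.
- by apply: contM; [exact: contc|exact: ck].
- by apply: contM; [exact: contc|exact: ck].
rewrite !rintZ//; rewrite -/(wallis n.+1) -/(wallis n) => /eqP.
by rewrite mulNr subr_eq0 => /eqP.
Qed.

Lemma wallis_gt0 n : 0 < wallis n.
Proof.
elim: n => [|n IH].
  have pi0 := pi_gt0 R; have npi : - pi <= pi :> R by lra.
  rewrite /wallis (@rint_FTC _ _ (fun y => y))//; first by lra.
    by under eq_fun do rewrite expr0; exact: contc.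
have := wallis_rec n; have n1 : (0 : R) < n.+1%:R by rewrite ltr0n.
have n0 : (0 : R) <= n%:R by rewrite ler0n.
have k0 : (0 : R) < 2 * n.+1%:R by lra.
have k1 : (0 : R) < 2 * n%:R + 1 by lra.
by move=> E; rewrite -(pmulr_rgt0 _ k0) E mulr_gt0.
Qed.

Lemma cos_le_cos (d y : R) : 0 < d -> d <= `|y| -> `|y| <= pi -> cos y <= cos d.
Proof.
move=> d0 dy yp.
have -> : cos y = cos `|y|.
  by case: (ger0P y) => h; rewrite ?cosN.
rewrite leNgt ltr_cos ?in_itv/= ?normr_ge0 ?yp ?(ltW d0) ?(le_trans dy)//.
by rewrite -leNgt.
Qed.

(* The probability densities kern^n / wallis n concentrate at 0; the recursion of
   the wallis integrals makes this quantitative without Fourier theory. *)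
Lemma kernel_uniqueness (f : R -> R) : continuous f ->
  (forall n, rint (fun y => f y * kern y ^+ n) (- pi) pi = 0) -> f 0 <= 0.
Proof.
move=> cf h; rewrite leNgt; apply/negP => f0.
have pi0 := pi_gt0 R; have npi : - pi <= pi :> R by lra.
have ck m : continuous (fun y => kern y ^+ m) by exact/contX/kern_cont.
pose c := f 0 / 2; have c0 : 0 < c by rewrite divr_gt0.
have [d d0 hd] : exists2 d : R, 0 < d & forall y, `|y| < d -> c <= f y.
  have /cvgrPdist_lt /(_ _ c0) [d /= d0 hd] := cf 0.
  exists d => // y yd; have := hd y; rewrite /= sub0r normrN => /(_ yd).
  by rewrite ltr_norml /c; lra.
have [m _ hm] := EVT_min npi (continuous_subspaceT cf).
pose d' := Num.min d pi.
have d'0 : 0 < d' by rewrite lt_min d0.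
have d'p : d' <= pi by rewrite ge_min lexx orbT.
have cd : cos d' < 1.
  by rewrite -cos0 ltr_cos// in_itv/= ?lexx ?pi_ge0 ?(ltW d'0).
(* [M] makes [c - M * (1 - kern y)] a lower bound of [f]: near 0 because [f] is at least [c] there,
   elsewhere because the expression is at most [- |f m|], hence at most the minimum of [f]. *)
pose M := (`|f m| + c) / ((1 - cos d') / 2).
have q0 : 0 < (1 - cos d') / 2 by rewrite divr_gt0// subr_gt0.
have M0 : 0 <= M by rewrite divr_ge0 ?(ltW q0)// addr_ge0// ltW.
have k01 y : 0 <= kern y <= 1.
  rewrite /kern; have := cos_geN1 y; have := cos_le1 y; lra.
have lb y : - pi <= y <= pi -> c - M * (1 - kern y) <= f y.
  move=> hy; have [yd|yd] := ltP `|y| d'.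
    have hc : c <= f y by apply: hd; apply: lt_le_trans yd _; rewrite ge_min lexx.
    apply: le_trans hc; rewrite gerBl mulr_ge0//; have := k01 y; lra.
  have hcos : cos y <= cos d' by apply: cos_le_cos => //; rewrite ler_norml.
  have hk : (1 - cos d') / 2 <= 1 - kern y by rewrite /kern; lra.
  have h1 : `|f m| + c <= M * (1 - kern y).
    have := ler_wpM2l M0 hk; rewrite {1}/M divfK// gt_eqF//.
  have h2 : f m <= f y by apply: hm; rewrite in_itv.
  have := ler_norm (- f m); rewrite normrN; lra.
have key n : c * wallis n <= M * (wallis n - wallis n.+1).
  have cc1 : continuous (fun y => (c - M) * kern y ^+ n).
    by apply: contM; [exact: contc|exact: ck].
  have cc2 : continuous (fun y => M * kern y ^+ n.+1).
    by apply: contM; [exact: contc|exact: ck].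
  have : rint (fun y => (c - M) * kern y ^+ n + M * kern y ^+ n.+1) (- pi) pi <=
         rint (fun y => f y * kern y ^+ n) (- pi) pi.
    apply: rint_le => //; first exact: contD.
      by apply: contM => //; exact: ck.
    move=> y hy; have kn : 0 <= kern y ^+ n.
      by rewrite exprn_ge0//; case/andP: (k01 y).
    have := ler_wpM2r kn (lb y hy); rewrite exprS; lra.
  rewrite h rintD// !rintZ// -/(wallis n) -/(wallis n.+1); lra.
(* By the recursion, [wallis N - wallis N.+1] is [wallis N] divided by 2 (N + 1), so [key] would
   force 2 (N + 1) c <= M, which this [N] violates. *)
have [N hN] : exists N : nat, M < c * N%:R.
  exists (Num.truncn (M / c)).+1; rewrite mulrC -ltr_pdivrMr//.
  by rewrite truncnS_gt.
have := key N; have wr := wallis_rec N; have w0 := wallis_gt0 N.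
have N0 : (0 : R) <= N%:R by rewrite ler0n.
rewrite -natr1 in wr.
have w1 : 2 * (N%:R + 1) * (wallis N - wallis N.+1) = wallis N by lra.
move=> k1; have N1 : (0 : R) < 2 * (N%:R + 1) by lra.
have := ler_wpM2l (ltW N1) k1.
rewrite [2 * (N%:R + 1) * (M * _)]mulrCA w1 mulrA ler_pM2r//.
move: hN; nra.
Qed.

End Kernel.

(** * Entire functions vanishing at infinity *)

Section EntireZero.
Variable R : realType.
Local Notation C := R[i].
Local Notation Re := (@complex.Re R).

Lemma ccts_id (z : C) : ccts (fun w => w) z.
Proof. by move=> e e0; exists e. Qed.

Lemma ccts_cst (c z : C) : ccts (fun=> c) z.
Proof. by move=> e e0; exists 1 => // w _; rewrite subrr nrm0. Qed.

Lemma cctsX (f : C -> C) (z : C) n : ccts f z -> ccts (fun w => f w ^+ n) z.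
Proof.
move=> h; elim: n => [|n IH]; first by under eq_fun do rewrite expr0; exact: ccts_cst.
by under eq_fun do rewrite exprS; exact: cctsM.
Qed.

Lemma cctsV (z : C) : z != 0 -> ccts (fun w => w^-1) z.
Proof.
by move=> z0; apply: deriv1_ccts; apply: deriv1V => //; exact: deriv1_id.
Qed.

Section OnCircle.
Variable F : C -> C.
Hypothesis Fc : forall z, ccts F z.
Hypothesis Fd : forall z, nrm z != 1 -> deriv1 F z.
Hypothesis Foo : forall e : R, 0 < e -> exists M : R, forall z, M < nrm z -> nrm (F z) <= e.

(* Both exponents in nat, so that the mean of F(z) z^(p-q) over circles is
   available for every sign of p - q. *)
Let H p q (z : C) := F z * (z ^+ p * z^-1 ^+ q).

Let Hc p q z : z != 0 -> ccts (H p q) z.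
Proof.
move=> z0; apply: cctsM => //; apply: cctsM; apply: cctsX.
  exact: ccts_id.
exact: cctsV.
Qed.

Let Hd p q z : z != 0 -> nrm z != 1 -> deriv1 (H p q) z.
Proof.
move=> z0 z1; apply: deriv1M; first exact: Fd.
apply: deriv1M; apply: deriv1X; first exact: deriv1_id.
by apply: deriv1V => //; exact: deriv1_id.
Qed.

(** For p <= q the power of z is bounded on large circles, where [F] is small; for p > q it tends to
    0 at the origin, where [F] is bounded. In both cases constancy of the mean gives 0. *)
Let Hmean p q x : circle_mean (H p q) x = 0.
Proof.
apply: (mean_zero_of_small (@Hc p q) (@Hd p q)) => e e0.
have [pq|qp] := leqP p q.
  have [M hM] := Foo e0; pose x0 := `|M|.
  exists x0 => z hz.
  have zx : 1 + x0 <= nrm z by rewrite hz expR_ge1Dx.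
  have x00 : 0 <= x0 by exact: normr_ge0.
  have z1 : 1 <= nrm z by lra.
  have z0 : z != 0 by rewrite -nrm_gt0; lra.
  have -> : H p q z = F z * z^-1 ^+ (q - p).
    rewrite /H; congr (_ * _); rewrite -[X in _ * z^-1 ^+ X = _](subnKC pq) exprD.
    by rewrite mulrA -exprMn divff// expr1n mul1r.
  rewrite nrmM nrmX nrmV -[leRHS]mulr1; apply: ler_pM; rewrite ?nrm_ge0//.
  - by rewrite exprn_ge0// invr_ge0 nrm_ge0.
  - by apply: hM; have := ler_norm M; rewrite -/x0; lra.
  - by rewrite exprn_ile1 ?invr_ge0 ?nrm_ge0// invf_le1//; lra.
have [d d0 hd] := Fc 0 (ltr01 : (0 : R) < 1).
pose K := nrm (F 0) + 1; have K0 : 0 < K by rewrite ltr_wpDl// nrm_ge0.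
pose m := Num.min (Num.min (d / 2) 1) (e / K).
have m0 : 0 < m by rewrite !lt_min ltr01 andbT; apply/andP; split; exact: divr_gt0.
exists (ln m) => z; rewrite lnK ?posrE// => hz.
have z0 : z != 0 by rewrite -nrm_gt0 hz.
have zd : nrm z < d.
  rewrite hz; apply: (@le_lt_trans _ _ (d / 2)); last by lra.
  by rewrite !ge_min lexx.
have z1 : nrm z <= 1 by rewrite hz !ge_min lexx orbT.
have ze : nrm z <= e / K by rewrite hz !ge_min lexx !orbT.
have FK : nrm (F z) <= K.
  have := hd z; rewrite subr0 => /(_ zd) h; rewrite -(subrK (F 0) (F z)).
  by apply: le_trans (nrmD _ _) _; rewrite /K addrC lerD2l ltW.
have -> : H p q z = F z * (z ^+ (p - q).-1 * z).
  rewrite /H -exprSr prednK ?subn_gt0//; congr (_ * _).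
  rewrite -[X in z ^+ X * _ = _](subnK (ltnW qp)) exprD.
  by rewrite -mulrA -exprMn divff// expr1n mulr1.
rewrite !nrmM nrmX.
have h1 : nrm z ^+ (p - q).-1 * nrm z <= e / K.
  rewrite -[leRHS]mul1r; apply: ler_pM; rewrite ?exprn_ge0 ?nrm_ge0//.
  by rewrite exprn_ile1 ?nrm_ge0.
have -> : e = K * (e / K) by field; rewrite gt_eqF.
by apply: ler_pM; rewrite ?mulr_ge0 ?exprn_ge0 ?nrm_ge0.
Qed.

(** If [F] had a nonzero value [c] there, the real part of [F / c] would be 1 at angle 0. Yet all
    its integrals against powers of [kern] vanish: on the circle of radius r, [kern] equals 1/2 +
    z/(4r) + r/(4z), so these integrals are combinations of moments of [F]. *)
Lemma entire_zero_pos x : F (expR x)%:C = 0.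
Proof.
apply/eqP/negP => /negP Fn0; set c := F _ in Fn0.
have pi0 := pi_gt0 R; have npi : - pi <= pi :> R by lra.
pose r := expR x; have r0 : 0 < r by exact: expR_gt0.
have rC0 : r%:C != 0 :> C by rewrite (inj_eq (@complexI R) _ 0) gt_eqF.
pose g p q N y := polar (H p q) x y * ((kern y)%:C) ^+ N.
have ckern : ccont (fun y => (kern y)%:C).
  by split=> y /=; [exact: kern_cont|exact: cst_continuous].
have ckN N : ccont (fun y => (kern y)%:C ^+ N).
  elim: N => [|N IH]; first by under eq_fun do rewrite expr0; exact: ccont_cst.
  by under eq_fun do rewrite exprS; exact: ccontM.
have cg p q N : ccont (g p q N).
  by apply: ccontM => //; apply: polar_cconty; exact: Hc.
have gz N : forall p q, CI (g p q N) (- pi) pi = 0.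
  elim: N => [|N IH] p q.
    by rewrite -[RHS](Hmean p q x); congr CI; apply/funext => y; rewrite /g expr0 mulr1.
  have -> : g p q N.+1 = (fun y => 2^-1 * g p q N y +
     ((4 * r%:C)^-1 * g p.+1 q N y + (r%:C / 4) * g p q.+1 N y)).
    apply/funext => y; rewrite /g /polar /H.
    set z := cexp _; have z0 : z != 0 by exact: cexp_neq0.
    have hk : (kern y)%:C = 2^-1 + ((4 * r%:C)^-1 * z + (r%:C / 4) * z^-1).
      have zE : z = r%:C * cexp (0 +i* y).
        rewrite /z (_ : x +i* y = x%:C + (0 +i* y)); last by simpc.
        rewrite cexpD; congr (_ * _).
        by rewrite /cexp /= cos0 sin0 mulr1.
      have zV : z^-1 = r%:C^-1 * cexp (0 +i* (- y)).
        by rewrite zE invfM -cexpN; congr (_ * cexp _); simpc.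
      rewrite zV zE.
      have e1 : (4 * r%:C)^-1 * (r%:C * cexp (0 +i* y)) = 4^-1 * cexp (0 +i* y).
        by field; rewrite rC0.
      have e2 : r%:C / 4 * (r%:C^-1 * cexp (0 +i* - y)) = 4^-1 * cexp (0 +i* (- y)).
        by field; rewrite rC0.
      rewrite e1 e2 -mulrDr.
      have -> : cexp (0 +i* y) + cexp (0 +i* - y) = (2 * cos y)%:C.
        rewrite /cexp /= expR0 cosN sinN !mul1r; simpc.
        by congr (_ +i* _); ring.
      have e4 : (2^-1 : C) = (2^-1 : R)%:C by rewrite fmorphV rmorph_nat.
      have e5 : (4^-1 : C) = (4^-1 : R)%:C by rewrite fmorphV rmorph_nat.
      by rewrite e4 e5 -rmorphM -rmorphD; congr (_%:C); rewrite /kern; field.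
    by rewrite exprS {1}hk !exprS; move: (F z) (z ^+ p) (z^-1 ^+ q) (_ ^+ N) => *; ring.
  have c1 : ccont (fun y => 2^-1 * g p q N y) by apply: ccontM => //; exact: ccont_cst.
  have c2 : ccont (fun y => (4 * r%:C)^-1 * g p.+1 q N y).
    by apply: ccontM => //; exact: ccont_cst.
  have c3 : ccont (fun y => (r%:C / 4) * g p q.+1 N y).
    by apply: ccontM => //; exact: ccont_cst.
  rewrite CID//; last exact: ccontD.
  by rewrite CID// !CIZ// !IH !mulr0 !addr0.
pose f y := Re (c^-1 * polar (H 0%N 0%N) x y).
have cp : ccont (fun y => c^-1 * polar (H 0%N 0%N) x y).
  by apply: ccontM; [exact: ccont_cst|apply: polar_cconty; exact: Hc].
have := @kernel_uniqueness R f cp.1.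
have -> : f 0 = 1.
  rewrite /f /polar /H !expr0 !mulr1.
  have -> : cexp (x +i* 0) = (expR x)%:C by rewrite /cexp /= cos0 sin0 mulr1.
  by rewrite -/c mulVf.
rewrite ler10 => /(_ _)/negP; apply => // n.
have := gz n 0%N 0%N => /(congr1 (fun t => c^-1 * t)); rewrite mulr0 -CIZ//.
move=> /(congr1 Re) /= E; rewrite -[RHS]E; congr rint; apply/funext => y.
rewrite /f /g mulrA -rmorphXn cReM /= mulr0 subr0.
by [].
Qed.

End OnCircle.

(** A rotation of the variable moves any nonzero point to the positive axis; the origin follows by
    continuity. *)
Lemma entire_zero (F : C -> C) : (forall z, ccts F z) ->
  (forall z, nrm z != 1 -> deriv1 F z) ->
  (forall e : R, 0 < e -> exists M : R, forall z, M < nrm z -> nrm (F z) <= e) ->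
  forall z, F z = 0.
Proof.
move=> Fc Fd Foo.
have nz z : z != 0 -> F z = 0.
  move=> z0; have nz0 : 0 < nrm z by rewrite nrm_gt0.
  pose u := z / (nrm z)%:C.
  have nC0 : (nrm z)%:C != 0 :> C by rewrite (inj_eq (@complexI R) _ 0) gt_eqF.
  have nu : nrm u = 1 by rewrite nrmM nrmV nrmC ger0_norm ?nrm_ge0// divff// gt_eqF.
  have du w : deriv1 (fun w => u * w) w.
    by apply: deriv1M; [exact: deriv1_cst|exact: deriv1_id].
  have := @entire_zero_pos (fun w => F (u * w)).
  move=> /(_ _ _ _ (ln (nrm z))); rewrite lnK ?posrE// /u divfK//; apply.
  - move=> w; apply: (@ccts_comp _ F (fun w => u * w)) => //.
    exact: deriv1_ccts.
  - move=> w w1; apply: (@deriv1_comp _ F (fun w => u * w)) => //.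
    by apply: Fd; rewrite nrmM nu mul1r.
  - move=> e e0; have [M hM] := Foo e e0; exists M => w hw.
    by apply: hM; rewrite nrmM nu mul1r.
move=> z; have [->|/nz//] := eqVneq z 0.
apply: nrm_eq0; apply/eqP; rewrite eq_le nrm_ge0 andbT.
apply/ler_addgt0Pl => e e0; rewrite addr0.
have [d d0 hd] := Fc 0 e e0.
have h2 : 0 < d / 2 by rewrite divr_gt0.
have := hd (d / 2)%:C; rewrite subr0 nrmC ger0_norm ?(ltW h2)//.
rewrite nz; last by rewrite (inj_eq (@complexI R) _ 0) gt_eqF.
rewrite sub0r nrmN => h; apply/ltW/h; lra.
Qed.

End EntireZero.

(** * Laurent series on the unit circle *)

Section BoundaryValues.
Variable R : realType.
Local Notation C := R[i].

Lemma circleE (z : C) : unit_circle z <-> nrm z = 1.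
Proof.
rewrite /unit_circle /= nrmE; split=> [h|->//].
by apply: (@complexI R); rewrite h.
Qed.

Lemma interiorE (z : C) : interior_disk z <-> nrm z < 1.
Proof. by rewrite /interior_disk /= nrmE ltcR. Qed.

Lemma exteriorE (z : C) : exterior_disk z <-> 1 < nrm z.
Proof. by rewrite /exterior_disk /= nrmE ltcR. Qed.

Lemma withinC (D : set C) (f : C -> C) (z l : C) :
  ((f : C -> C^o) @ within D (nbhs (z : C^o)) --> (l : C^o)) <->
  (forall e : R, 0 < e -> exists2 d : R, 0 < d &
    forall w, D w -> nrm (w - z) < d -> nrm (f w - l) < e).
Proof.
split.
  move=> /cvgC h e e0; have /nbhsC[d d0 hd] := h e e0.
  by exists d => // w Dw wd; exact: hd.
move=> h; apply/cvgC => e e0; have [d d0 hd] := h e e0.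
by apply/nbhsC; exists d => // w wd Dw; exact: hd.
Qed.

Definition bv (D : set C) (f phi : C -> C) : Prop := forall z, unit_circle z ->
  ((phi : C -> C^o) @ within (@unit_circle R) (nbhs (z : C^o)) --> (phi z : C^o)) /\
  ((f : C -> C^o) @ within D (nbhs (z : C^o)) --> (phi z : C^o)).

Lemma bvP (D : set C) (P Q : C -> 'M[C]_2) : boundary_values D P Q <->
  forall i j, bv D (fun w => P w i j) (fun w => Q w i j).
Proof.
split=> h i j; have h' := h i j.
  move=> z hz; split; last exact: h'.2.
  by have := (subspace_continuousP _ _).1 h'.1 z hz.
split; last by move=> z hz; exact: (h' z hz).2.
by apply/subspace_continuousP => z hz; exact: (h' z hz).1.
Qed.

Lemma cvgCD (F : set_system C) {FF : Filter F} (f g : C -> C) (a b : C) :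
  ((f : C -> C^o) @ F --> (a : C^o)) -> ((g : C -> C^o) @ F --> (b : C^o)) ->
  ((fun w => f w + g w) : C -> C^o) @ F --> (a + b : C^o).
Proof. by move=> h1 h2; exact: (@cvgD _ C^o C F FF f g a b h1 h2). Qed.

Lemma cvgCM (F : set_system C) {FF : Filter F} (f g : C -> C) (a b : C) :
  ((f : C -> C^o) @ F --> (a : C^o)) -> ((g : C -> C^o) @ F --> (b : C^o)) ->
  ((fun w => f w * g w) : C -> C^o) @ F --> (a * b : C^o).
Proof. by move=> h1 h2; exact: (@cvgM _ _ F FF f g a b h1 h2). Qed.

Lemma cvgCN (F : set_system C) {FF : Filter F} (f : C -> C) (a : C) :
  ((f : C -> C^o) @ F --> (a : C^o)) ->
  ((fun w => - f w) : C -> C^o) @ F --> (- a : C^o).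
Proof. by move=> h1; exact: (@cvgN _ C^o C F FF f a h1). Qed.

Lemma bvD D f g phi psi : bv D f phi -> bv D g psi ->
  bv D (fun w => f w + g w) (fun w => phi w + psi w).
Proof.
move=> h1 h2 z hz; have [a b] := h1 z hz; have [c d] := h2 z hz.
by split; [exact: (cvgCD a c)|exact: (cvgCD b d)].
Qed.

Lemma bvM D f g phi psi : bv D f phi -> bv D g psi ->
  bv D (fun w => f w * g w) (fun w => phi w * psi w).
Proof.
move=> h1 h2 z hz; have [a b] := h1 z hz; have [c d] := h2 z hz.
by split; [exact: (cvgCM a c)|exact: (cvgCM b d)].
Qed.

Lemma bv_cst D (c : C) : bv D (fun=> c) (fun=> c).
Proof.
move=> z hz.
have H (D' : set C) : ((fun _ : C => c) : C -> C^o) @ within D' (nbhs (z : C^o)) --> (c : C^o).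
  apply: (withinC D' (fun=> c) z c).2 => e e0; exists 1; first exact: ltr01.
  by move=> w _ _; rewrite subrr nrm0.
by split; exact: H.
Qed.

Lemma bvN D f phi : bv D f phi -> bv D (fun w => - f w) (fun w => - phi w).
Proof.
move=> h1 z hz; have [a b] := h1 z hz.
by split; [exact: (cvgCN a)|exact: (cvgCN b)].
Qed.

Lemma bvB D f g phi psi : bv D f phi -> bv D g psi ->
  bv D (fun w => f w - g w) (fun w => phi w - psi w).
Proof. by move=> h1 h2; exact: (bvD h1 (bvN h2)). Qed.

Lemma bv_eq D f g phi psi : (forall z, D z -> f z = g z) ->
  (forall z, unit_circle z -> phi z = psi z) -> bv D f phi -> bv D g psi.
Proof.
move=> fg pp h z hz; have [/withinC a /withinC b] := h z hz; rewrite -(pp z hz).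
split; apply/withinC => e e0.
  by have [d d0 hd] := a e e0; exists d => // w hw; rewrite -(pp w hw); exact: hd.
by have [d d0 hd] := b e e0; exists d => // w hw; rewrite -(fg w hw); exact: hd.
Qed.

(** The common boundary values make the glued function continuous on the circle, so [entire_zero]
    applies. Uniqueness of Laurent coefficients, the vanishing lemma and uniqueness for the
    Riemann-Hilbert problem all rest on this. *)
Lemma glue_zero (fi fo phi : C -> C) :
  (forall z, nrm z < 1 -> deriv1 fi z) -> bv (@interior_disk R) fi phi ->
  (forall z, 1 < nrm z -> deriv1 fo z) -> bv (@exterior_disk R) fo phi ->
  (forall e : R, 0 < e -> exists M : R, forall z, M < nrm z -> nrm (fo z) <= e) ->
  [/\ forall z, nrm z < 1 -> fi z = 0, forall z, 1 < nrm z -> fo z = 0 &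
      forall z, nrm z = 1 -> phi z = 0].
Proof.
move=> di bi do_ bo oo.
pose F z := if nrm z < 1 then fi z else if 1 < nrm z then fo z else phi z.
have Fi z : nrm z < 1 -> F z = fi z by move=> h; rewrite /F h.
have Fo z : 1 < nrm z -> F z = fo z by move=> h; rewrite /F h ltNge ltW.
have Fp z : nrm z = 1 -> F z = phi z by move=> h; rewrite /F h ltxx.
have Fd z : nrm z != 1 -> deriv1 F z.
  move=> z1; have [h|h|h] := ltgtP (nrm z) 1; last by rewrite h eqxx in z1.
    apply: (deriv1_near (f := fi) (d := 1 - nrm z)); rewrite ?subr_gt0//; last exact: di.
    move=> w hw; rewrite Fi// -(subrK z w) (le_lt_trans (nrmD _ _))//.
    by rewrite -ltrBrDr.
  apply: (deriv1_near (f := fo) (d := nrm z - 1)); rewrite ?subr_gt0//; last exact: do_.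
  move=> w hw; rewrite Fo//; have := nrmD (z - w) w.
  rewrite subrK nrm_dist; lra.
suff F0 : forall z, F z = 0.
  by split=> z h; [rewrite -Fi|rewrite -Fo|rewrite -Fp].
apply: entire_zero => //.
  move=> z; have [/eqP z1|/Fd/deriv1_ccts//] := boolP (nrm z == 1).
  have cz : unit_circle z by apply/circleE.
  move=> e e0; have [/withinC/(_ e e0)[d1 d10 h1] /withinC/(_ e e0)[d2 d20 h2]] := bi z cz.
  have [_ /withinC/(_ e e0)[d3 d30 h3]] := bo z cz.
  exists (Num.min d1 (Num.min d2 d3)); first by rewrite !lt_min d10 d20 d30.
  move=> w; rewrite !lt_min => /and3P[w1 w2 w3]; rewrite (Fp z)//.
  have [h|h|h] := ltgtP (nrm w) 1.
  - by rewrite Fi//; apply: h2 => //; apply/interiorE.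
  - by rewrite Fo//; apply: h3 => //; apply/exteriorE.
  - by rewrite Fp//; apply: h1 => //; apply/circleE.
move=> e e0; have [M hM] := oo e e0; exists (Num.max M 1) => z.
by rewrite gt_max => /andP[zM z1]; rewrite Fo//; exact: hM.
Qed.

End BoundaryValues.

(** * Symbols of Laurent families *)

Section Symbol.
Variable R : realType.
Local Notation C := R[i].
Implicit Types f g : int -> C.

Lemma l1_inj (I J : choiceType) (e : I -> J) (f : J -> C) : injective e ->
  l1 f -> l1 (f \o e) /\ l1n (f \o e) <= l1n f.
Proof.
move=> ie hf; apply: l1_bd; apply: asum_leP => s us.
rewrite -(big_map e xpredT (fun j => nrm (f j))) -lee_fin -l1E//.
by apply: (asum_geP (fun j => nrm (f j))); rewrite map_inj_uniq.
Qed.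

Lemma csum_inj (I J : choiceType) (e : I -> J) (f : J -> C) : injective e ->
  l1 f -> (forall j, (forall i, e i != j) -> f j = 0) -> csum f = csum (f \o e).
Proof.
move=> ie hf h; have [h1 _] := l1_inj ie hf.
have := @csum_push R _ _ e (f \o e) (fun=> 1) 1 h1.
move=> /(_ (fun _ => nrm1_le R) ler01) E.
transitivity (csum (fun i => (f \o e) i * 1)); last by apply: eq_csum => i; rewrite mulr1.
rewrite -E; apply: eq_csum => j; rewrite mulr1 /push.
have [[i <-]|nj] := pselect (exists i, e i = j).
  by rewrite (@csum1 _ _ _ i) ?eqxx// => k ki; rewrite (inj_eq ie) (negbTE ki).
have nj' i : e i != j by apply/eqP => eij; apply: nj; exists i.
rewrite h// -[LHS](csum0 R I); apply: eq_csum => i.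
by rewrite (negbTE (nj' i)).
Qed.

Lemma Posz_inj : injective Posz. Proof. by move=> a b []. Qed.
Lemma Negz_inj : injective Negz. Proof. by move=> a b []. Qed.

Lemma csum_int f : l1 f ->
  csum f = csum (fun n => f (Posz n)) + csum (fun n => f (Negz n)).
Proof.
move=> hf.
have [h1 _] := l1_if (fun n : int => 0 <= n) hf.
have [h2 _] := l1_if (fun n : int => n < 0) hf.
rewrite (eq_csum (g := fun n => (if 0 <= n then f n else 0) + (if n < 0 then f n else 0))).
  rewrite csumD// (csum_inj Posz_inj h1) ?(csum_inj Negz_inj h2)//.
  - by move=> [n|n] // h; have := h n; rewrite eqxx.
  - by move=> [n|n] // h; have := h n; rewrite eqxx.
by move=> [n|n]; rewrite /= ?addr0 ?add0r.
Qed.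

Definition sym f (z : C) : C := csum (fun n => f n * z ^ n).
(* The exterior part is indexed by Negz n = -(n+1), whence the extra factor. *)
Definition cin f (z : C) : C := ps (fun n => f (Posz n)) z.
Definition cout f (z : C) : C := ps (fun n => f (Negz n)) z^-1 * z^-1.

Lemma nrm1_neq0 (z : C) : nrm z = 1 -> z != 0.
Proof. by move=> h; rewrite -nrm_gt0 h. Qed.

Lemma nrm_exprz (z : C) (n : int) : nrm z = 1 -> nrm (z ^ n) = 1.
Proof.
move=> hz; case: n => n; first by rewrite -exprnP nrmX hz expr1n.
by rewrite NegzE -exprnN nrmV nrmX hz expr1n invr1.
Qed.

Lemma sym_l1 f z : l1 f -> nrm z = 1 -> l1 (fun n => f n * z ^ n).
Proof.
move=> hf hz; have [] := @l1_mulb _ _ f (fun n => z ^ n) 1 hf _ ler01 => //.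
by move=> n; rewrite nrm_exprz.
Qed.

Lemma symE f z : l1 f -> nrm z = 1 -> sym f z = cin f z + cout f z.
Proof.
move=> hf hz; rewrite /sym csum_int; last exact: sym_l1.
congr (_ + _); rewrite /cout /ps mulrC -csumZ; last first.
  have [_ _] := l1_inj Negz_inj hf; have zi : nrm z^-1 <= 1 by rewrite nrmV hz invr1.
  by have [] := ps_l1 (l1_inj Negz_inj hf).1 zi.
apply: eq_csum => n; rewrite NegzE -exprnN mulrCA -exprS.
by rewrite exprVn.
Qed.

Lemma sym_conv f g z : l1 f -> l1 g -> nrm z = 1 ->
  sym (conv f g) z = sym f z * sym g z.
Proof.
move=> hf hg hz; apply: (@ev_conv R _ (fun n : int => z ^ n)) => //.
  by move=> a b; rewrite expfzDr// nrm1_neq0.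
by move=> a; rewrite nrm_exprz.
Qed.

Lemma symD f g z : l1 f -> l1 g -> nrm z = 1 ->
  sym (fun n => f n + g n) z = sym f z + sym g z.
Proof.
move=> hf hg hz; rewrite /sym -csumD; [|exact: sym_l1..].
by apply: eq_csum => n; rewrite mulrDl.
Qed.

Lemma symN f z : l1 f -> nrm z = 1 -> sym (fun n => - f n) z = - sym f z.
Proof.
move=> hf hz; rewrite /sym -csumN; last exact: sym_l1.
by apply: eq_csum => n; rewrite mulNr.
Qed.

Lemma cin_l1 f : l1 f -> l1 (fun n => f (Posz n)).
Proof. by move=> hf; case: (l1_inj Posz_inj hf). Qed.

Lemma cout_l1 f : l1 f -> l1 (fun n => f (Negz n)).
Proof. by move=> hf; case: (l1_inj Negz_inj hf). Qed.

Lemma cin_deriv f z : l1 f -> nrm z < 1 -> deriv1 (cin f) z.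
Proof. by move=> /cin_l1 hf hz; exact: ps_deriv. Qed.

Lemma cout_deriv f z : l1 f -> 1 < nrm z -> deriv1 (cout f) z.
Proof.
move=> /cout_l1 hf hz.
have z0 : z != 0 by rewrite -nrm_gt0 (lt_trans ltr01).
have dv : deriv1 (fun w : C => w^-1) z by apply: deriv1V => //; exact: deriv1_id.
have zi : nrm z^-1 < 1 by rewrite nrmV invf_lt1// (lt_trans ltr01).
have h1 := @deriv1_comp R (ps (fun n => f (Negz n))) (fun w => w^-1) z dv
  (ps_deriv hf zi).
exact: (deriv1M h1 dv).
Qed.

Lemma cin_bv f : l1 f -> bv (@interior_disk R) (cin f) (cin f).
Proof.
move=> /cin_l1 hf z /circleE hz.
have hz1 : nrm z <= 1 by rewrite hz.
split; apply/withinC => e e0; have [d d0 hd] := ps_cts hf hz1 e0; exists d => // w.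
  by move=> /circleE hw; apply: hd; rewrite hw.
by move=> /interiorE hw; apply: hd; exact: ltW.
Qed.

Lemma cout_bv f : l1 f -> bv (@exterior_disk R) (cout f) (cout f).
Proof.
move=> /cout_l1 hf z /circleE hz.
have zi : nrm z^-1 <= 1 by rewrite nrmV hz invr1.
(* [D] is the closed exterior, which covers at once the limit along the circle and the one from
   outside. *)
pose D := [set w : C | 1 <= nrm w].
have hV : ((fun w => w^-1) : C -> C^o) @ within D (nbhs (z : C^o)) --> (z^-1 : C^o).
  apply/withinC => e e0; have [d d0 hd] := cctsV (nrm1_neq0 hz) e0.
  by exists d => // w _; exact: hd.
have hps : ((fun w => ps (fun n => f (Negz n)) w^-1) : C -> C^o) @ within D (nbhs (z : C^o))
    --> (ps (fun n => f (Negz n)) z^-1 : C^o).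
  apply/withinC => e e0; have [d d0 hd] := ps_cts hf zi e0.
  have [d' d'0 hd'] := cctsV (nrm1_neq0 hz) d0.
  exists d' => // w hw /hd'; apply: hd; rewrite nrmV invf_le1//.
  by apply: lt_le_trans hw.
have /withinC h := @cvgCM R (within D (nbhs (z : C^o))) (within_filter D (nbhs_filter (z : C^o))) _ _ _ _ hps hV.
split; apply/withinC => e e0; have [d d0 hd] := h e e0; exists d => // w hw; apply: hd.
  by rewrite /D /=; move/circleE: hw => ->.
by rewrite /D /=; move/exteriorE: hw => /ltW.
Qed.

Lemma cout_oo f (e : R) : l1 f -> 0 < e ->
  exists M : R, forall z, M < nrm z -> nrm (cout f z) <= e.
Proof.
move=> /cout_l1 hf e0; set K := l1n (fun n => f (Negz n)).
have K0 : 0 <= K by exact: l1n_ge0.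
exists (1 + K / e) => z hz.
have Ke : 0 <= K / e by rewrite divr_ge0// ltW.
have z1 : 1 < nrm z by lra.
rewrite /cout nrmM nrmV ler_pdivrMr; last by lra.
apply: le_trans (ps_bound hf _) _; first by rewrite nrmV invf_le1//; lra.
rewrite -/K; have : K / e < nrm z by lra.
by rewrite ltr_pdivrMr// mulrC => /ltW.
Qed.

Lemma ps0 (b : nat -> C) z : (forall n, b n = 0) -> ps b z = 0.
Proof.
move=> h; rewrite /ps -[RHS](csum0 R nat); apply: eq_csum => n.
by rewrite h mul0r.
Qed.

(** A vanishing symbol makes [cin f] and [- cout f] agree on the circle; they glue to zero, and both
    power series have zero coefficients. *)
Lemma sym_inj0 f : l1 f -> (forall z, nrm z = 1 -> sym f z = 0) ->
  forall n, f n = 0.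
Proof.
move=> hf h.
have h1 z : 1 < nrm z -> deriv1 (fun z => - cout f z) z.
  by move=> hz; exact: (deriv1N (cout_deriv hf hz)).
have h2 : bv (@exterior_disk R) (fun z => - cout f z) (cin f).
  apply: (bv_eq (f := fun z => - cout f z) (phi := fun z => - cout f z)) => //.
    move=> z /circleE hz; have := h z hz; rewrite symE// => /eqP.
    by rewrite addr_eq0 => /eqP ->.
  exact: (bvN (cout_bv hf)).
have h3 (e : R) : 0 < e -> exists M : R, forall z, M < nrm z -> nrm (- cout f z) <= e.
  by move=> e0; have [M hM] := cout_oo hf e0; exists M => z; rewrite nrmN; exact: hM.
have [hin hout _] := glue_zero (fun z hz => cin_deriv hf hz) (cin_bv hf) h1 h2 h3.
case=> n.
  apply: (ps_zero (cin_l1 hf)) => x /andP[x0 x1]; apply: hin.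
  by rewrite nrmC gtr0_norm.
apply: (ps_zero (cout_l1 hf)) => x /andP[x0 x1].
have xC : x%:C != 0 :> C by rewrite (inj_eq (@complexI R) _ 0) gt_eqF.
have := hout x%:C^-1; rewrite nrmV nrmC gtr0_norm// invf_gt1// => /(_ x1)/eqP.
by rewrite oppr_eq0 /cout invrK mulf_eq0 (negbTE xC) orbF => /eqP.
Qed.

Lemma sym_inj f g : l1 f -> l1 g -> (forall z, nrm z = 1 -> sym f z = sym g z) ->
  forall n, f n = g n.
Proof.
move=> hf hg h n; apply/eqP; rewrite -subr_eq0; apply/eqP.
apply: (@sym_inj0 (fun n => f n - g n)); first by have [] := l1B hf hg.
move=> z hz; rewrite symD// ?symN//; last exact: l1N.
by rewrite h// subrr.
Qed.

End Symbol.

(** * The vanishing lemma and solvability *)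

Section Rows.
Variable R : realType.
Local Notation C := R[i].
Variable G : nmodType.
Implicit Types (p q u w : 'I_2 -> G -> C) (V W : 'I_2 -> 'I_2 -> G -> C).

Definition rows_l1 p := forall j, l1 (p j).
Definition mat_l1 V := forall j k, l1 (V j k).
Definition rn p : R := \sum_j l1n (p j).
(** Dominates the operator norm on rows, and is small as soon as all four entries are. *)
Definition mn V : R := \sum_j \sum_k l1n (V j k).
Definition rmul p V : 'I_2 -> G -> C := fun k x => \sum_j conv (p j) (V j k) x.

Lemma rn_ge0 p : 0 <= rn p.
Proof. by apply: sumr_ge0 => j _; exact: l1n_ge0. Qed.

Lemma mn_ge0 V : 0 <= mn V.
Proof. by apply: sumr_ge0 => j _; apply: sumr_ge0 => k _; exact: l1n_ge0. Qed.

Lemma rmul_l1 p V : rows_l1 p -> mat_l1 V ->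
  rows_l1 (rmul p V) /\ rn (rmul p V) <= rn p * mn V.
Proof.
move=> hp hV.
have h k : l1 (rmul p V k) /\ l1n (rmul p V k) <= \sum_j l1n (p j) * l1n (V j k).
  have h1 j : l1 (conv (p j) (V j k)) by have [] := conv_l1 (hp j) (hV j k).
  have [h2 h3] := l1_sum (index_enum 'I_2) h1; split=> //.
  apply: le_trans h3 _; apply: ler_sum => j _.
  by have [] := conv_l1 (hp j) (hV j k).
split; first by move=> k; have [] := h k.
apply: (@le_trans _ _ (\sum_k \sum_j l1n (p j) * l1n (V j k))).
  by apply: ler_sum => k _; have [] := h k.
rewrite exchange_big /= /rn mulr_suml; apply: ler_sum => j _.
rewrite -mulr_sumr ler_wpM2l ?l1n_ge0// /mn [leRHS](bigD1 j)//= lerDl.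
by apply: sumr_ge0 => i _; apply: sumr_ge0 => k _; exact: l1n_ge0.
Qed.

Lemma rmulD p q V k x : rows_l1 p -> rows_l1 q -> mat_l1 V ->
  rmul (fun j y => p j y + q j y) V k x = rmul p V k x + rmul q V k x.
Proof.
move=> hp hq hV; rewrite /rmul -big_split; apply: eq_bigr => j _.
exact: convDl.
Qed.

Lemma rmulZ (c : C) p V k x : rows_l1 p -> mat_l1 V ->
  rmul (fun j y => c * p j y) V k x = c * rmul p V k x.
Proof.
move=> hp hV; rewrite /rmul mulr_sumr; apply: eq_bigr => j _.
exact: convZl.
Qed.

Lemma rmulB p q V k x : rows_l1 p -> rows_l1 q -> mat_l1 V ->
  rmul (fun j y => p j y - q j y) V k x = rmul p V k x - rmul q V k x.
Proof.
move=> hp hq hV; rewrite /rmul -sumrB; apply: eq_bigr => j _.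
exact: convBl.
Qed.

Lemma eq_rmul p q V k x : (forall j y, p j y = q j y) -> rmul p V k x = rmul q V k x.
Proof.
by move=> h; apply: eq_bigr => j _; have -> : p j = q j by apply/funext => y.
Qed.

Lemma rows_l1Z (c : C) p : rows_l1 p -> rows_l1 (fun j y => c * p j y).
Proof. by move=> hp j; have [] := l1Z c (hp j). Qed.

Lemma rows_l1D p q : rows_l1 p -> rows_l1 q -> rows_l1 (fun j y => p j y + q j y).
Proof. by move=> hp hq j; have [] := l1D (hp j) (hq j). Qed.

Lemma rows_l1_sum (K : Type) (s : seq K) (x : K -> C) (w : K -> 'I_2 -> G -> C) :
  (forall k, rows_l1 (w k)) -> rows_l1 (fun j y => \sum_(k <- s) x k * w k j y).
Proof.
move=> hw j; have [] := @l1_sum R G K s (fun k y => x k * w k j y) _ => //.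
by move=> k; have [] := l1Z (x k) (hw k j).
Qed.

Lemma rmul_sum (K : Type) (s : seq K) (x : K -> C) (w : K -> 'I_2 -> G -> C) V j y :
  (forall k, rows_l1 (w k)) -> mat_l1 V ->
  rmul (fun j y => \sum_(k <- s) x k * w k j y) V j y =
  \sum_(k <- s) x k * rmul (w k) V j y.
Proof.
move=> hw hV; elim: s => [|k s IH].
  rewrite big_nil (@eq_rmul _ (fun j y => 0 * (\sum_(k <- [::]) x k * w k j y))).
    by rewrite rmulZ ?mul0r//; exact: (rows_l1_sum [::]).
  by move=> *; rewrite big_nil mul0r.
rewrite big_cons -IH -rmulZ// -rmulD//.
- by apply: eq_rmul => *; rewrite big_cons.
- exact: rows_l1Z.
- exact: rows_l1_sum.
Qed.

Lemma asum_finType (I : finType) (f : I -> R) : (forall i, 0 <= f i) ->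
  asum f = (\sum_i f i)%:E.
Proof.
move=> f0; apply/eqP; rewrite eq_le; apply/andP; split; last first.
  exact: (asum_geP f (index_enum_uniq I)).
apply: asum_leP => s us; rewrite big_uniq//= [leRHS](bigID (mem s)) /=.
by rewrite lerDl; apply: sumr_ge0.
Qed.

Lemma rows_enc p : rows_l1 p ->
  l1 (fun a => p a.1 a.2) /\ l1n (fun a => p a.1 a.2) = rn p.
Proof.
move=> hp; have [|h1 h2] := @l1_uncurry R _ _ p (fun j => l1n (p j)) (rn p) hp
  (fun j => lexx _) _.
  by rewrite asum_finType// => j; exact: l1n_ge0.
split=> //; apply: EFin_inj; rewrite -l1E// l1_pairE//= asum_finType//.
by move=> j; exact: l1n_ge0.
Qed.

(** A row is stored as one family on ['I_2 * G], to which [l1_fixpoint] applies; compatibility with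
    differences turns the bound on [E] into a Lipschitz bound. The radius [M] solves rn u + c M =
    M. *)
Lemma rows_fixpoint (E : ('I_2 -> G -> C) -> ('I_2 -> G -> C)) (c : R) u :
  0 <= c < 1 -> rows_l1 u ->
  (forall p, rows_l1 p -> rows_l1 (E p) /\ rn (E p) <= c * rn p) ->
  (forall p q, rows_l1 p -> rows_l1 q ->
    forall j x, E (fun j x => p j x - q j x) j x = E p j x - E q j x) ->
  exists w, rows_l1 w /\ forall j x, w j x = u j x + E w j x.
Proof.
move=> hc hu hE hB; have /andP[c0 c1] := hc.
have c1' : 0 < 1 - c by rewrite subr_gt0.
pose dec (f : 'I_2 * G -> C) : 'I_2 -> G -> C := fun j x => f (j, x).
have hdec f : l1 f -> rows_l1 (dec f) /\ rn (dec f) = l1n f.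
  move=> hf; have h : rows_l1 (dec f) by move=> j; exact: l1_fiber.
  have [h1 h2] := rows_enc h; split=> //; rewrite -h2.
  by congr l1n; apply/funext => -[].
pose Phi (f : 'I_2 * G -> C) : 'I_2 * G -> C :=
  fun a => u a.1 a.2 + E (dec f) a.1 a.2.
have [hu1 hu2] := rows_enc hu.
pose M := rn u / (1 - c).
have M0 : 0 <= M by rewrite divr_ge0 ?rn_ge0// ltW.
have hPhi f : l1 f -> l1 (fun a => E (dec f) a.1 a.2) /\
    l1n (fun a => E (dec f) a.1 a.2) <= c * l1n f.
  move=> hf; have [d1 d2] := hdec _ hf; have [e1 e2] := hE _ d1.
  by have [r1 r2] := rows_enc e1; split=> //; rewrite r2 -d2.
have [||f [hf _ Ef]] := @l1_fixpoint R _ Phi M c hc M0.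
- move=> f hf fM; have [h1 h2] := hPhi f hf.
  have [h3 h4] := l1D hu1 h1; split=> //; apply: le_trans h4 _.
  rewrite hu2; apply: (@le_trans _ _ (rn u + c * M)).
    by rewrite lerD2l (le_trans h2)// ler_wpM2l.
  rewrite le_eqVlt; apply/orP; left; apply/eqP.
  by rewrite /M; field; rewrite gt_eqF.
- move=> f g hf _ hg _; have [hfg _] := l1B hf hg.
  have [_ h] := hPhi _ hfg; apply: le_trans h; rewrite le_eqVlt; apply/orP; left.
  apply/eqP; congr l1n; apply/funext => -[j x] /=.
  rewrite /Phi /= (hB (dec f) (dec g) (hdec _ hf).1 (hdec _ hg).1).
  by ring.
exists (dec f); split; first exact: (hdec _ hf).1.
by move=> j x; rewrite -[LHS](Ef (j, x)).
Qed.

End Rows.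

Section FinSolve.
Variables (F : fieldType) (K : finType) (M : K -> K -> F).

(** The Fredholm alternative in finite dimension, for the square matrix of the identity minus
    [M]. *)
Lemma fin_solve : (forall x : K -> F, (forall k, x k = \sum_l x l * M l k) ->
    forall k, x k = 0) ->
  forall b : K -> F, exists x : K -> F, forall k, x k = b k + \sum_l x l * M l k.
Proof.
move=> inj b; pose A := \matrix_(i, j < #|K|) ((i == j)%:R - M (enum_val i) (enum_val j)).
pose fn (v : 'rV[F]_#|K|) k := v 0 (enum_rank k).
have AE (v : 'rV[F]_#|K|) k : (v *m A) 0 (enum_rank k) = fn v k - \sum_l fn v l * M l k.
  rewrite mxE /fn (reindex_onto (@enum_rank K) (@enum_val K K)) /=; last first.
    by move=> i _; exact: enum_valK.
  under eq_bigl do rewrite enum_rankK eqxx.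
  under eq_bigr do rewrite mxE !enum_rankK mulrBr.
  rewrite sumrB; congr (_ - _).
  rewrite (bigD1 k)//= eqxx mulr1 big1 ?addr0// => l lk.
  by rewrite (inj_eq (@enum_rank_inj _)) (negbTE lk) mulr0.
have uA : A \in unitmx.
  rewrite -row_free_unit -kermx_eq0; apply/eqP/row_matrixP => i; rewrite row0.
  have kv : row i (kermx A) *m A = 0 by rewrite -row_mul mulmx_ker row0.
  apply/rowP => j; rewrite [RHS]mxE -(enum_valK j).
  apply: (inj (fn (row i (kermx A)))) => k; apply/eqP; rewrite -subr_eq0 -AE.
  by rewrite kv mxE.
pose v := (\row_j b (enum_val j)) *m invmx A.
exists (fn v) => k; apply/eqP; rewrite -subr_eq -AE /v -mulmxA mulVmx// mulmx1.
by rewrite mxE enum_rankK.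
Qed.

End FinSolve.

Section Vanishing.
Variable R : realType.
Local Notation C := R[i].

Lemma csum_conj (I : choiceType) (f : I -> C) : l1 f ->
  csum (fun i => conjc (f i)) = conjc (csum f).
Proof.
move=> hf; rewrite /csum /= -rsumN; last exact: l1_Im.
by congr (_ +i* _); apply: eq_rsum => i; case: (f i).
Qed.

Lemma l1_conj (I : choiceType) (f : I -> C) : l1 f -> l1 (fun i => conjc (f i)).
Proof. by move=> /(l1_dom (f := fun i => conjc (f i)))[]// i; rewrite nrm_conj. Qed.

Lemma ps_conj (b : nat -> C) z : l1 b -> nrm z <= 1 ->
  ps (fun n => conjc (b n)) z = conjc (ps b (conjc z)).
Proof.
move=> hb hz; rewrite /ps -csum_conj; last first.
  by have [] := ps_l1 hb (_ : nrm (conjc z) <= 1); rewrite ?nrm_conj.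
by apply: eq_csum => n; rewrite rmorphM rmorphXn /= conjcK.
Qed.

Implicit Types (f g : int -> C) (p : 'I_2 -> int -> C) (V : 'I_2 -> 'I_2 -> int -> C).

Lemma cin_conj f z : l1 f -> nrm z <= 1 ->
  cin (fun n => conjc (f n)) z = conjc (cin f (conjc z)).
Proof. by move=> hf hz; rewrite /cin ps_conj//; exact: cin_l1. Qed.

Lemma cout_conj f z : l1 f -> 1 <= nrm z ->
  cout (fun n => conjc (f n)) z = conjc (cout f (conjc z)).
Proof.
move=> hf hz; rewrite /cout ps_conj; last 2 first.
- exact: cout_l1.
- by rewrite nrmV invf_le1// (lt_le_trans ltr01).
have E : conjc z^-1 = (conjc z)^-1 by exact: (fmorphV (@conjc R)).
by rewrite rmorphM -E /= conjcK.
Qed.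

Lemma cout0 f z : (forall n, f (Negz n) = 0) -> cout f z = 0.
Proof. by move=> h; rewrite /cout ps0// mul0r. Qed.

Lemma cin0 f z : (forall n, f (Posz n) = 0) -> cin f z = 0.
Proof. by move=> h; rewrite /cin ps0. Qed.

(* The symbol at conj z is compared with the one at z, not with itself: this is
   the Schwarz symmetry V(z)^-1 = V(z* )^dagger, and V(z) need not be unitary. *)
Definition unitary (V : 'I_2 -> 'I_2 -> int -> C) : Prop :=
  forall z, nrm z = 1 -> forall i j,
  \sum_k sym (V i k) z * conjc (sym (V j k) (conjc z)) = (i == j)%:R.

Lemma sum2 (A : nmodType) (F : 'I_2 -> A) : \sum_i F i = F 0 + F 1.
Proof. by rewrite big_ord_recl big_ord1; congr (_ + F _); apply/val_inj. Qed.

Lemma ord2 (i : 'I_2) : i = 0 \/ i = 1.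
Proof. by case: i => -[|[|//]] hi; [left|right]; apply/val_inj. Qed.

Lemma sym_rmul p V k z : rows_l1 p -> mat_l1 V -> nrm z = 1 ->
  sym (rmul p V k) z = \sum_j sym (p j) z * sym (V j k) z.
Proof.
move=> hp hV hz.
have -> : rmul p V k = (fun n => conv (p 0) (V 0 k) n + conv (p 1) (V 1 k) n).
  by apply/funext => n; rewrite /rmul sum2.
have h0 := (conv_l1 (hp 0) (hV 0 k)).1; have h1 := (conv_l1 (hp 1) (hV 1 k)).1.
rewrite (symD h0 h1 hz) (sym_conv (hp 0) (hV 0 k) hz) (sym_conv (hp 1) (hV 1 k) hz).
by rewrite sum2.
Qed.

(* For q = p V, the functions p(z) p(z* )^dagger inside the circle and
   q(z) q(z* )^dagger outside it glue to an entire function vanishing at infinity;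
   so it is 0, and on the real axis this says |p|^2 = 0. *)
Lemma vanishing p V : rows_l1 p -> mat_l1 V -> unitary V ->
  (forall j n, p j (Negz n) = 0) -> (forall k n, rmul p V k (Posz n) = 0) ->
  forall j n, p j n = 0.
Proof.
move=> hp hV uV pneg qpos.
pose q := rmul p V; have hq : rows_l1 q by have [] := rmul_l1 hp hV.
pose ps' j n := conjc (p j n); pose qs' j n := conjc (q j n).
have hps j : l1 (ps' j) by exact: l1_conj.
have hqs j : l1 (qs' j) by exact: l1_conj.
pose fi z := cin (p 0) z * cin (ps' 0) z + cin (p 1) z * cin (ps' 1) z.
pose fo z := cout (q 0) z * cout (qs' 0) z + cout (q 1) z * cout (qs' 1) z.
have sp j z : nrm z = 1 -> sym (p j) z = cin (p j) z.
  by move=> hz; rewrite symE// cout0// addr0.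
have sq k z : nrm z = 1 -> sym (q k) z = cout (q k) z.
  by move=> hz; rewrite symE// cin0// add0r.
have bi : bv (@interior_disk R) fi fi.
  exact: (bvD (bvM (cin_bv (hp 0)) (cin_bv (hps 0))) (bvM (cin_bv (hp 1)) (cin_bv (hps 1)))).
have bo : bv (@exterior_disk R) fo fo.
  exact: (bvD (bvM (cout_bv (hq 0)) (cout_bv (hqs 0))) (bvM (cout_bv (hq 1)) (cout_bv (hqs 1)))).
have fio z : nrm z = 1 -> fo z = fi z.
  move=> hz; have hz' : nrm (conjc z) = 1 by rewrite nrm_conj.
  have hzl : nrm z <= 1 by rewrite hz.
  have hzg : 1 <= nrm z by rewrite hz.
  have Eq k t : nrm t = 1 -> sym (q k) t =
      sym (p 0) t * sym (V 0 k) t + sym (p 1) t * sym (V 1 k) t.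
    by move=> ht; rewrite (sym_rmul k hp hV ht) sum2.
  rewrite /fo /fi /ps' /qs' (cout_conj (hq 0) hzg) (cout_conj (hq 1) hzg).
  rewrite (cin_conj (hp 0) hzl) (cin_conj (hp 1) hzl).
  rewrite -(sq 0 z hz) -(sq 1 z hz) -(sq 0 _ hz') -(sq 1 _ hz').
  rewrite -(sp 0 z hz) -(sp 1 z hz) -(sp 0 _ hz') -(sp 1 _ hz').
  rewrite (Eq 0 z hz) (Eq 1 z hz) (Eq 0 _ hz') (Eq 1 _ hz').
  have cD (s t : C) : conjc (s + t) = conjc s + conjc t by exact: rmorphD.
  have cM (s t : C) : conjc (s * t) = conjc s * conjc t by exact: rmorphM.
  rewrite !cD !cM.
  have U i j := uV z hz i j.
  have := U 0 0; have := U 0 1; have := U 1 0; have := U 1 1; rewrite !sum2.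
  set a := sym (p 0) z; set b := sym (p 1) z.
  set a' := conjc (sym (p 0) _); set b' := conjc (sym (p 1) _).
  set v00 := sym (V 0 0) z; set v01 := sym (V 0 1) z.
  set v10 := sym (V 1 0) z; set v11 := sym (V 1 1) z.
  set w00 := conjc (sym (V 0 0) _); set w01 := conjc (sym (V 0 1) _).
  set w10 := conjc (sym (V 1 0) _); set w11 := conjc (sym (V 1 1) _).
  move=> E11 E10 E01 E00.
  (* Grouping by products of entries of [p] isolates the four unitarity relations. *)
  transitivity (a * a' * (v00 * w00 + v01 * w01) + a * b' * (v00 * w10 + v01 * w11) +
    b * a' * (v10 * w00 + v11 * w01) + b * b' * (v10 * w10 + v11 * w11)); first by ring.
  rewrite E00 E01 E10 E11 !eqxx (_ : (0 == 1 :> 'I_2) = false)// (_ : (1 == 0 :> 'I_2) = false)//.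
  by rewrite !mulr1 !mulr0 !addr0.
have dfi z : nrm z < 1 -> deriv1 fi z.
  by move=> hz; exact: (deriv1D (deriv1M (cin_deriv (hp 0) hz) (cin_deriv (hps 0) hz))
   (deriv1M (cin_deriv (hp 1) hz) (cin_deriv (hps 1) hz))).
have dfo z : 1 < nrm z -> deriv1 fo z.
  by move=> hz; exact: (deriv1D (deriv1M (cout_deriv (hq 0) hz) (cout_deriv (hqs 0) hz))
   (deriv1M (cout_deriv (hq 1) hz) (cout_deriv (hqs 1) hz))).
have bo' : bv (@exterior_disk R) fo fi.
  apply: (bv_eq _ _ bo) => // z /circleE; exact: fio.
have foo (e : R) : 0 < e -> exists M : R, forall z, M < nrm z -> nrm (fo z) <= e.
  move=> e0; have e2 : 0 < Num.min (e / 2) 1 by rewrite lt_min ltr01 divr_gt0.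
  have [M1 h1] := cout_oo (hq 0) e2; have [M2 h2] := cout_oo (hqs 0) ltr01.
  have [M3 h3] := cout_oo (hq 1) e2; have [M4 h4] := cout_oo (hqs 1) ltr01.
  exists (Num.max (Num.max M1 M2) (Num.max M3 M4)) => z.
  rewrite !gt_max => /andP[/andP[/h1 z1 /h2 z2] /andP[/h3 z3 /h4 z4]].
  have m1 : Num.min (e / 2) 1 <= e / 2 by rewrite ge_min lexx.
  have k1 : nrm (cout (q 0) z * cout (qs' 0) z) <= e / 2 * 1.
    by rewrite nrmM; exact: ler_pM (nrm_ge0 _) (nrm_ge0 _) (le_trans z1 m1) z2.
  have k2 : nrm (cout (q 1) z * cout (qs' 1) z) <= e / 2 * 1.
    by rewrite nrmM; exact: ler_pM (nrm_ge0 _) (nrm_ge0 _) (le_trans z3 m1) z4.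
  have k3 := le_trans (nrmD _ _) (lerD k1 k2).
  have e2E : e / 2 * 1 + e / 2 * 1 = e by field.
  by rewrite e2E in k3; exact: k3.
have [fi0 _ _] := glue_zero dfi bi dfo bo' foo.
move=> j [n|n]; last exact: pneg.
move: n; apply: (ps_zero (cin_l1 (hp j))) => x /andP[x0 x1].
have nx : nrm (x%:C : C) < 1 by rewrite nrmC gtr0_norm.
have := fi0 _ nx; rewrite /fi /ps' !cin_conj ?(ltW nx)//.
have -> : conjc (x%:C : C) = x%:C by rewrite /= oppr0.
rewrite -!sqr_normc !nrmE -!rmorphXn -rmorphD => /eqP.
rewrite (inj_eq (@complexI R) _ 0) paddr_eq0 ?sqr_ge0// !sqrf_eq0 => /andP[/eqP h0 /eqP h1].
have [->|->] := ord2 j; first exact: nrm_eq0.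
exact: nrm_eq0.
Qed.

End Vanishing.

(** * Solvability by reduction to finite rank *)

Section Existence.
Variable R : realType.
Local Notation C := R[i].
Implicit Types (f g : int -> C) (p y : 'I_2 -> int -> C).

Definition Pp f : int -> C := fun n => if n is Posz _ then f n else 0.
(** [Negz m] is -(m + 1), so the indices kept are those strictly below -N. *)
Definition Pl (N : nat) f : int -> C := fun n =>
  if n is Negz m then (if (N <= m)%N then f n else 0) else 0.

Lemma Pp_l1 f : l1 f -> l1 (Pp f) /\ l1n (Pp f) <= l1n f.
Proof. by apply: l1_dom => -[n|n] //=; rewrite nrm0 nrm_ge0. Qed.

Lemma Pl_l1 N f : l1 f -> l1 (Pl N f) /\ l1n (Pl N f) <= l1n f.
Proof.
apply: l1_dom => -[n|n] /=; first by rewrite nrm0 nrm_ge0.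
by case: ifP => //; rewrite nrm0 nrm_ge0.
Qed.

Lemma Pl_tail f (e : R) : l1 f -> 0 < e -> exists N0, forall N, (N0 <= N)%N ->
  l1n (Pl N f) < e.
Proof.
move=> hf e0; have [s us hs] := l1_tail hf e0.
exists (\max_(i <- s) (absz i).+1)%N => N hN; apply: le_lt_trans hs.
have h : l1 (fun n => if n \in s then 0 else f n).
  by have [] := l1_if (predC (mem s)) hf; move=> h _; move: h; congr l1;
     apply/funext => n /=; case: (n \in s).
have [] // := @l1_dom _ _ (Pl N f) _ _ h.
move=> [n|n] /=; first by rewrite nrm0 nrm_ge0.
case: ifPn => Nn; last by rewrite nrm0 nrm_ge0.
case: ifPn => // ns.
have := @leq_bigmax_seq _ s xpredT (fun i => (absz i).+1) _ ns isT.
move=> /leq_trans/(_ hN); rewrite /= => h1.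
by have := leq_trans h1 Nn; rewrite ltnNge leqnSn.
Qed.

(** Multiplication by a family without negative indices only raises indices, so a coefficient of the
    product below -N involves only coefficients of [g] below -N. The truncated product is therefore
    small when the tail of [g] is. *)
Lemma Pl_conv N f g n : (forall m, f (Negz m) = 0) ->
  Pl N (conv f g) n = Pl N (conv f (Pl N g)) n.
Proof.
move=> fneg; case: n => //= n; case: ifP => // Nn.
rewrite /conv /push; apply: eq_csum => -[[a|a] b] /=; last by rewrite fneg !mul0r.
case: eqP => // ab; congr (_ * _).
have -> : b = Negz (n + a).
  by apply: (addrI (Posz a)); rewrite ab !NegzE -addSn PoszD opprD addrCA subrr addr0.
by rewrite /= (leq_trans Nn)// leq_addr.
Qed.

Variables (V W : 'I_2 -> 'I_2 -> int -> C).
Hypotheses (hV : mat_l1 V) (hW : mat_l1 W).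
Hypotheses (uV : unitary V) (uW : unitary W).
Hypothesis WV : forall z, nrm z = 1 -> forall i j,
  \sum_k sym (W i k) z * sym (V k j) z = (i == j)%:R.

Lemma rmulWV y j n : rows_l1 y -> rmul (rmul y W) V j n = y j n.
Proof.
move=> hy; have hyW : rows_l1 (rmul y W) by have [] := rmul_l1 hy hW.
apply: sym_inj => //; first by have [] := rmul_l1 hyW hV.
move=> z hz; rewrite sym_rmul// sum2 !sym_rmul// !sum2.
have := WV hz 0 j; have := WV hz 1 j; rewrite !sum2 => E1 E0.
transitivity (sym (y 0) z * (sym (W 0 0) z * sym (V 0 j) z + sym (W 0 1) z * sym (V 1 j) z)
  + sym (y 1) z * (sym (W 1 0) z * sym (V 0 j) z + sym (W 1 1) z * sym (V 1 j) z)).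
  by ring.
rewrite E0 E1; case: j {E0 E1} => -[|[|//]] hj.
  rewrite (_ : Ordinal hj = 0) /=; last exact/val_inj.
  by rewrite mulr1 mulr0 addr0.
rewrite (_ : Ordinal hj = 1) /=; last exact/val_inj.
by rewrite mulr1 mulr0 add0r.
Qed.

Definition rPp p := fun j => Pp (p j).
Definition rPl N p := fun j => Pl N (p j).

Lemma rPp_l1 p : rows_l1 p -> rows_l1 (rPp p) /\ rn (rPp p) <= rn p.
Proof.
move=> hp; split=> [j|]; first by have [] := Pp_l1 (hp j).
by apply: ler_sum => j _; have [] := Pp_l1 (hp j).
Qed.

Lemma rPl_l1 N p : rows_l1 p -> rows_l1 (rPl N p).
Proof. by move=> hp j; have [] := Pl_l1 N (hp j). Qed.

(* For p = Pp (y W) the equation Pp (p V) = e reads y = e + Pp ((y W - p) V), because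
   W V = 1. Emap keeps only the tail of y W - p below -N and is a contraction; the
   rest of the operator has finite rank. *)
Let Emap N y := rPp (rmul (rPl N (rmul (rPp y) W)) V).

Let Emap_l1 N y : rows_l1 y -> rows_l1 (Emap N y).
Proof.
move=> hy; have h1 := (rmul_l1 (rPp_l1 hy).1 hW).1.
have h2 := (rmul_l1 (rPl_l1 N h1) hV).1.
by have [] := rPp_l1 h2.
Qed.

(** By [Pl_conv] only the tail of [W] enters, and that is small for large [N]. *)
Let Emap_bd N y : rows_l1 y ->
  rn (Emap N y) <= rn y * mn (fun j k => Pl N (W j k)) * mn V.
Proof.
move=> hy; have hy1 := (rPp_l1 hy).1; have h1 := (rmul_l1 hy1 hW).1.
have h2 := rmul_l1 (rPl_l1 N h1) hV.
apply: le_trans (rPp_l1 h2.1).2 _; apply: le_trans h2.2 _.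
rewrite ler_wpM2r ?mn_ge0//.
have hPW : mat_l1 (fun j k => Pl N (W j k)) by move=> j k; have [] := Pl_l1 N (hW j k).
have h3 := rmul_l1 hy1 hPW.
apply: (@le_trans _ _ (rn (rmul (rPp y) (fun j k => Pl N (W j k))))).
  apply: ler_sum => k _.
  have -> : rPl N (rmul (rPp y) W) k = Pl N (rmul (rPp y) (fun j k => Pl N (W j k)) k).
    apply/funext => n; have := fun j => @Pl_conv N (rPp y j) (W j k) n (fun m => erefl).
    move=> E; have := E 0; have := E 1; rewrite /rPl /rmul.
    case: n {E} => //= n; case: ifP => // _ E1 E0.
    by rewrite !sum2 E0 E1.
  by have [] := Pl_l1 N (h3.1 k).
apply: le_trans h3.2 _; rewrite ler_wpM2r ?mn_ge0//.
by have [] := rPp_l1 hy.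
Qed.

Let Emap_eq N y y' j n : (forall i m, y i m = y' i m) -> Emap N y j n = Emap N y' j n.
Proof. by move=> h; have -> : y = y' by apply/funext => i; apply/funext => m. Qed.

Let EmapB N y y' j n : rows_l1 y -> rows_l1 y' ->
  Emap N (fun j n => y j n - y' j n) j n = Emap N y j n - Emap N y' j n.
Proof.
move=> hy hy'; have a1 := (rPp_l1 hy).1; have a2 := (rPp_l1 hy').1.
have b1 := (rmul_l1 a1 hW).1; have b2 := (rmul_l1 a2 hW).1.
rewrite /Emap /rPp; case: n => n /=; last by rewrite subrr.
rewrite -rmulB; [|exact: rPl_l1..|exact: hV].
apply: eq_rmul => i [m|m] /=; first by rewrite /rPl /= subrr.
rewrite /rPl /=; case: ifP => _; last by rewrite subrr.
rewrite -(rmulB i (Negz m) a1 a2 hW); apply: eq_rmul => k [l|l] //=.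
by rewrite subrr.
Qed.

Let EmapD N y y' j n : rows_l1 y -> rows_l1 y' ->
  Emap N (fun j n => y j n + y' j n) j n = Emap N y j n + Emap N y' j n.
Proof.
move=> hy hy'; have := @EmapB N (fun j n => y j n + y' j n) y' j n (rows_l1D hy hy') hy'.
have -> : (fun j n => y j n + y' j n - y' j n) = y.
  by apply/funext => i; apply/funext => m; rewrite addrK.
by move=> ->; rewrite subrK.
Qed.

Let EmapZ N (c : C) y j n : rows_l1 y ->
  Emap N (fun j n => c * y j n) j n = c * Emap N y j n.
Proof.
move=> hy; have a1 := (rPp_l1 hy).1; have b1 := (rmul_l1 a1 hW).1.
rewrite /Emap /rPp; case: n => n /=; last by rewrite mulr0.
rewrite -rmulZ//; last exact: rPl_l1.
apply: eq_rmul => i [m|m] /=; first by rewrite /rPl /= mulr0.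
rewrite /rPl /=; case: ifP => _; last by rewrite mulr0.
rewrite -rmulZ//; apply: eq_rmul => k [l|l] //=.
by rewrite mulr0.
Qed.

Let Emap_sum N (K : Type) (s : seq K) (x : K -> C) (w : K -> 'I_2 -> int -> C) j n :
  (forall k, rows_l1 (w k)) ->
  Emap N (fun j n => \sum_(k <- s) x k * w k j n) j n =
  \sum_(k <- s) x k * Emap N (w k) j n.
Proof.
move=> hw; elim: s => [|k s IH].
  have h0 : rows_l1 (fun j n => \sum_(k <- [::]) x k * w k j n).
    exact: (rows_l1_sum [::]).
  have := EmapB N j n h0 h0; rewrite subrr big_nil => E; rewrite -[RHS]E.
  apply: Emap_eq.
  by move=> i m; rewrite big_nil subrr.
rewrite big_cons -IH -(EmapZ _ _ _ _ (hw k)).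
rewrite -(EmapD _ _ _ (rows_l1Z (x k) (hw k)) (rows_l1_sum s x hw)).
apply: Emap_eq.
by move=> i m; rewrite big_cons.
Qed.

Let exN : exists N, mn (fun j k => Pl N (W j k)) * mn V <= 2^-1.
Proof.
(* Each of the four tails will be below [e], so their total times [mn V] is at most 4 e mn V, which
   is at most 1/2. *)
pose e := (8 * (mn V + 1))^-1.
have V0 := mn_ge0 V.
have e0 : 0 < e by rewrite invr_gt0; lra.
have /choice[N0 hN0] : forall a : 'I_2 * 'I_2, exists N0, forall N, (N0 <= N)%N ->
    l1n (Pl N (W a.1 a.2)) < e by move=> a; exact: Pl_tail.
exists (\max_a N0 a)%N; set N := (\max_a N0 a)%N.
have h j k : l1n (Pl N (W j k)) < e by apply: (hN0 (j, k)); exact: leq_bigmax.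
have h4 : mn (fun j k => Pl N (W j k)) <= 4 * e.
  rewrite /mn !sum2; have := h 0 0; have := h 0 1; have := h 1 0; have := h 1 1; lra.
apply: le_trans (ler_wpM2r V0 h4) _.
have eV : 8 * (e * (mn V + 1)) = 1.
  by rewrite /e; field; rewrite gt_eqF//; lra.
nra.
Qed.

(** What the contraction leaves out are the 2 N coefficients of y W at the indices -1, ..., -N. For
    each of them the contraction solves with right-hand side [U k]; superposing these solutions
    leaves a linear system for the coefficients alone. *)
Lemma symbol_solve (e0 : 'I_2 -> int -> C) : rows_l1 e0 ->
  (forall j n, e0 j (Negz n) = 0) ->
  exists p, [/\ rows_l1 p, forall j n, p j (Negz n) = 0 &
    forall k n, rmul p V k (Posz n) = e0 k (Posz n)].
Proof.
move=> he0 e0neg; have [N hN] := exN.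
have fixp u : rows_l1 u -> exists w, rows_l1 w /\ forall j n, w j n = u j n + Emap N w j n.
  move=> hu; apply: (@rows_fixpoint R _ (Emap N) 2^-1) => //.
  - by rewrite invr_ge0 ler0n/= invf_lt1// ltr1n.
  - move=> y hy; split; first exact: Emap_l1.
    apply: le_trans (Emap_bd N hy) _; rewrite -mulrA mulrC.
    by apply: ler_wpM2r => //; exact: rn_ge0.
  - by move=> y y' hy hy' j n; exact: EmapB.
pose K : finType := ('I_2 * 'I_N)%type.
pose b (k : K) : 'I_2 -> int -> C := fun j n =>
  if (j == k.1) && (n == Negz k.2) then 1 else 0.
have hb k : rows_l1 (b k).
  move=> j; apply: (@l1_fin _ _ _ [:: Negz k.2]) => // n; rewrite inE /b.
  by move=> /negbTE ->; rewrite andbF.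
pose U k := rPp (rmul (b k) V).
have hU k : rows_l1 (U k) by have [] := rPp_l1 (rmul_l1 (hb k) hV).1.
have /choice[w hw] : forall k, exists w, rows_l1 w /\
    forall j n, w j n = U k j n + Emap N w j n by move=> k; exact: fixp.
have hw1 k := (hw k).1.
pose L y (k : K) := rmul y W k.1 (Negz k.2).
(* Both solvability (e1 = e0) and injectivity (e1 = 0) of the finite linear
   system rest on this: a solution x makes y solve the full equation. *)
have core e1 w1 x : rows_l1 e1 -> (forall j n, e1 j (Negz n) = 0) ->
  rows_l1 w1 -> (forall j n, w1 j n = e1 j n + Emap N w1 j n) ->
  let y := fun j n => w1 j n + \sum_k x k * w k j n in
  (forall k, x k = L y k) ->
  [/\ rows_l1 y, forall j n, y j (Negz n) = 0 &
    forall j n, rmul (rPp (rmul y W)) V j (Posz n) = e1 j (Posz n)].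
  move=> he1 e1neg hw1' Ew1 y xL.
  have hs : rows_l1 (fun j n => \sum_k x k * w k j n) by exact: rows_l1_sum.
  have hy : rows_l1 y by exact: rows_l1D.
  have yE j n : y j n = e1 j n + \sum_k x k * U k j n + Emap N y j n.
    rewrite /y EmapD// Emap_sum// Ew1 -!addrA; congr (_ + _).
    rewrite addrCA; congr (_ + _); rewrite -big_split /=.
    by apply: eq_bigr => k _; rewrite -mulrDr; have [_ ->] := hw k.
  have yneg j n : y j (Negz n) = 0.
    rewrite yE e1neg add0r /Emap /= addr0.
    by rewrite big1// => k _; rewrite mulr0.
  split=> // j n.
  have hyW := (rmul_l1 hy hW).1.
  have yP : rPp y = y by apply/funext => i; apply/funext => -[m|m] //=; rewrite yneg.
  pose mid := fun i m => \sum_k x k * b k i m.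
  have hmid : rows_l1 mid by exact: rows_l1_sum.
  (* Under the system for [x], [mid] is exactly the part of y W at the indices -1, ..., -N,
     complementary to [rPp] and [rPl N]. *)
  have midE i m : mid i m = if m is Negz l then
      (if (N <= l)%N then 0 else rmul y W i m) else 0.
    rewrite /mid; case: m => l.
      by rewrite big1// => k _; rewrite /b andbF mulr0.
    case: ltnP => lN; last first.
      rewrite big1// => k _; rewrite /b.
      have -> : (Negz l == Negz k.2) = false.
        by apply/eqP => -[lk]; move: (ltn_ord k.2); rewrite -lk ltnNge lN.
      by rewrite andbF mulr0.
    rewrite (bigD1 (i, Ordinal lN))//= {1}/b !eqxx mulr1 xL /L /= big1 ?addr0// => k.
    rewrite /b; case: k => k1 k2 /=; rewrite xpair_eqE negb_and.
    case: eqP => [->|/eqP ik] /=; last by rewrite eq_sym (negbTE ik) mulr0.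
    move=> kl; have -> : (Negz l == Negz k2) = false.
      by apply/eqP => -[h]; move/eqP: kl; apply; apply/val_inj; rewrite /= h.
    by rewrite andbF mulr0.
  have E1 : \sum_k x k * U k j (Posz n) = rmul mid V j (Posz n).
    by rewrite rmul_sum.
  have E2 : Emap N y j (Posz n) = rmul (rPl N (rmul y W)) V j (Posz n).
    by rewrite /Emap yP.
  have hl := rPl_l1 N hyW; have hpp := (rPp_l1 hyW).1.
  have E3 : y j (Posz n) = rmul (rPp (rmul y W)) V j (Posz n) +
      (rmul mid V j (Posz n) + rmul (rPl N (rmul y W)) V j (Posz n)).
    rewrite -{1}(rmulWV j (Posz n) hy) -(rmulD j (Posz n) hmid hl hV).
    rewrite -(rmulD j (Posz n) hpp (rows_l1D hmid hl) hV).
    apply: eq_rmul => i m; rewrite midE /rPl /rPp; case: m => m /=.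
      by rewrite !addr0.
    by rewrite add0r; case: ifP; rewrite ?addr0 ?add0r.
  have := yE j (Posz n); rewrite E1 E2 E3 -addrA => /addIr.
  by [].
(* The homogeneous solution [y] vanishes by two uses of [vanishing]. With [V] the lemma kills the
   nonnegative part of y W; then y W has only negative indices, and the lemma with [W] kills [y]
   itself. *)
have inj x : (forall k, x k = \sum_l x l * L (w l) k) -> forall k, x k = 0.
  move=> hx.
  have z0 : rows_l1 (fun (_ : 'I_2) (_ : int) => 0 : C) by move=> j; exact: (l1_0 R int).1.
  have E00 j n : Emap N (fun _ _ => 0) j n = 0.
    by have := EmapB N j n z0 z0; rewrite !subrr.
  have [|k|hy yneg yV] := core (fun _ _ => 0) (fun _ _ => 0) x z0 (fun _ _ => erefl) z0 _ _.
  - by move=> j n; rewrite E00 addr0.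
  - rewrite /L (@eq_rmul _ _ _ (fun j n => \sum_k x k * w k j n)); last first.
      by move=> *; rewrite add0r.
    by rewrite rmul_sum// -hx.
  set y := fun j n => _ in hy yneg yV.
  have hyW := (rmul_l1 hy hW).1.
  have q0 := vanishing (rPp_l1 hyW).1 hV uV (fun _ _ => erefl) yV.
  have y0 := vanishing hy hW uW yneg (fun k n => q0 k (Posz n)).
  move=> k; rewrite hx.
  have -> : \sum_l x l * L (w l) k = L y k.
    rewrite /L -(rmul_sum _ _ _ _ hw1 hW); apply: eq_rmul => j n.
    by rewrite /y add0r.
  rewrite /L (@eq_rmul _ _ _ (fun _ _ => 0 * (0 : C))); last by move=> *; rewrite y0 mul0r.
  by rewrite (rmulZ 0 _ _ z0 hW) mul0r.
have [w0 [hw0 Ew0]] := fixp e0 he0.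
have [x hx] := fin_solve inj (fun k => L w0 k).
have [|hy yneg yV] := core e0 w0 x he0 e0neg hw0 Ew0 _.
  move=> k; rewrite /L rmulD//; last exact: rows_l1_sum.
  by rewrite rmul_sum// hx.
have hyW := (rmul_l1 hy hW).1.
exists (rPp (rmul (fun j n => w0 j n + \sum_k x k * w k j n) W)); split=> //.
by have [] := rPp_l1 hyW.
Qed.

End Existence.

(** * Convergent series in the parameters *)

Section Evaluation.
Variable R : realType.
Local Notation C := R[i].
Variable n : nat.
Local Notation M := {ffun 'I_n -> nat}.
Local Notation A := (int * M)%type.
Implicit Types (x h : 'rV[R]_n) (al be : M) (f g : A -> C).

Definition unit_cube x : Prop := forall k, `|x 0 k| <= 1.
Definition mdeg al : nat := (\sum_k al k)%N.

Lemma monomialD al be x : monomial (al + be) x = monomial al x * monomial be x.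
Proof.
rewrite /monomial -big_split; apply: eq_bigr => k _.
by rewrite ffunE exprD.
Qed.

Lemma monomial_le1 al x : unit_cube x -> `|monomial al x| <= 1.
Proof.
move=> hx; rewrite /monomial normr_prod; apply: prodr_ile1 => k _.
by rewrite normr_ge0 normrX exprn_ile1.
Qed.

Lemma monomialZ al (t : R) x : monomial al (t *: x) = t ^+ mdeg al * monomial al x.
Proof.
rewrite /monomial /mdeg -prodrXr -big_split; apply: eq_bigr => k _.
by rewrite mxE exprMn.
Qed.

Lemma monomial0 al : monomial al (0 : 'rV[R]_n) = (al == 0)%:R.
Proof.
case: eqP => [->|/eqP al0].
  by rewrite /monomial big1// => k _; rewrite ffunE expr0.
have [k hk] : exists k, al k != 0%N.
  apply/existsP; apply: contraR al0 => /existsPn h; apply/eqP/ffunP => k.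
  by have := h k; rewrite negbK ffunE => /eqP.
by rewrite /monomial (bigD1 k)//= mxE expr0n (negbTE hk) mul0r.
Qed.

(* An element of l1 (int * multi-indices) is a Laurent series in z whose
   coefficients are power series in the parameters x, and chi z x evaluates it. *)
Definition chi (z : C) x (a : A) : C := z ^ a.1 * (monomial a.2 x)%:C.

Lemma chiD z x a b : nrm z = 1 -> chi z x (a + b) = chi z x a * chi z x b.
Proof.
move=> hz; rewrite /chi /= expfzDr ?nrm1_neq0// monomialD rmorphM /=.
by rewrite mulrACA.
Qed.

Lemma chi_le1 z x a : nrm z = 1 -> unit_cube x -> nrm (chi z x a) <= 1.
Proof. by move=> hz hx; rewrite nrmM nrm_exprz// mul1r nrmC monomial_le1. Qed.

Definition ev f (z : C) x : C := csum (fun a => f a * chi z x a).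

Lemma ev_mul f g z x : l1 f -> l1 g -> nrm z = 1 -> unit_cube x ->
  ev (conv f g) z x = ev f z x * ev g z x.
Proof.
move=> hf hg hz hx; apply: (@ev_conv R _ (chi z x)) => //.
  by move=> a b; exact: chiD.
by move=> a; exact: chi_le1.
Qed.

Lemma ev_l1 f z x : l1 f -> nrm z = 1 -> unit_cube x -> l1 (fun a => f a * chi z x a).
Proof.
move=> hf hz hx; have [] := @l1_mulb _ _ f (chi z x) 1 hf _ ler01 => //.
by move=> a; exact: chi_le1.
Qed.

Lemma ev_add f g z x : l1 f -> l1 g -> nrm z = 1 -> unit_cube x ->
  ev (fun a => f a + g a) z x = ev f z x + ev g z x.
Proof.
move=> hf hg hz hx; rewrite /ev -csumD; [|exact: ev_l1..].
by apply: eq_csum => a; rewrite mulrDl.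
Qed.

(** Specialisation of the parameters: the passage from the algebra with parameters to Laurent
    families. *)
Definition spec x f : int -> C :=
  fun m => csum (fun al => f (m, al) * (monomial al x)%:C).

Lemma spec_aux f x : l1 f -> unit_cube x ->
  l1 (fun a : A => f a * (monomial a.2 x)%:C).
Proof.
move=> hf hx; have [] := @l1_mulb _ _ f (fun a : A => (monomial a.2 x)%:C) 1 hf _ ler01 => //.
by move=> a; rewrite nrmC monomial_le1.
Qed.

Lemma spec_l1 f x : l1 f -> unit_cube x -> l1 (spec x f).
Proof. by move=> hf hx; have [] := l1_pair (spec_aux hf hx). Qed.

Lemma sym_spec f z x : l1 f -> nrm z = 1 -> unit_cube x ->
  sym (spec x f) z = ev f z x.
Proof.
move=> hf hz hx; rewrite /ev csum_pair; last exact: ev_l1.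
apply: eq_csum => m /=; rewrite mulrC -csumZ.
  by apply: eq_csum => al; rewrite /chi /= mulrCA.
exact: (l1_fiber m (spec_aux hf hx)).
Qed.

Lemma sym_spec0 f z : l1 f -> nrm z = 1 -> ev f z 0 = sym (fun m => f (m, 0)) z.
Proof.
have h0 : unit_cube 0 by move=> k; rewrite mxE normr0.
move=> hf hz; rewrite -sym_spec//; apply: eq_csum => m; congr (_ * _).
rewrite /spec (@csum1 _ _ _ 0); first by rewrite monomial0 eqxx mulr1.
by move=> al al0; rewrite monomial0 (negbTE al0) mulr0.
Qed.

Lemma slice0_l1 f : l1 f -> l1 (fun m => f (m, 0)).
Proof.
have ie : injective (fun m : int => (m, 0 : M)) by move=> a b [].
by move=> hf; have [] := l1_inj ie hf.
Qed.

Definition emb (g : int -> C) : A -> C := fun a => if a.2 == 0 then g a.1 else 0.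

Lemma emb_l1 (g : int -> C) : l1 g -> l1 (emb g).
Proof.
move=> hg; have [] := @l1_uncurry R _ _ (fun m (al : M) => if al == 0 then g m else 0)
  (fun m => nrm (g m)) (l1n g) _ _ _ => //.
- by move=> m; have [] := l1_delta (0 : M) (g m).
- by move=> m; have [] := l1_delta (0 : M) (g m).
- by rewrite l1E.
Qed.

Lemma ev_emb (g : int -> C) z x : l1 g -> nrm z = 1 -> unit_cube x ->
  ev (emb g) z x = sym g z.
Proof.
move=> hg hz hx; rewrite /ev csum_pair; last by apply: ev_l1 => //; exact: emb_l1.
apply: eq_csum => m; rewrite (@csum1 _ _ _ 0).
  by rewrite /emb /chi /= eqxx (_ : monomial 0 x = 1) ?mulr1//
    /monomial big1// => k _; rewrite ffunE expr0.
by move=> al al0; rewrite /emb /= (negbTE al0) mul0r.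
Qed.

(* The substitution x := t x of the parameters, which shrinks the norm of
   elements without constant part. *)
Definition rescale (t : R) f : A -> C := fun a => f a * (t ^+ mdeg a.2)%:C.

(** Without constant part only multi-indices of degree at least 1 occur, and each contributes a
    factor at most [t]. *)
Lemma rescale_l1 t f : 0 <= t <= 1 -> l1 f -> (forall m, f (m, 0) = 0) ->
  l1 (rescale t f) /\ l1n (rescale t f) <= t * l1n f.
Proof.
move=> /andP[t0 t1] hf f0.
have -> : rescale t f = fun a => f a * (if a.2 == 0 then 0 else t ^+ mdeg a.2)%:C.
  by apply/funext => -[m al]; rewrite /rescale /=; case: eqP => // ->; rewrite f0 !mul0r.
apply: l1_mulb => // -[m al] /=; rewrite nrmC.
case: eqP => [_|/eqP al0]; first by rewrite normr0.
rewrite ger0_norm ?exprn_ge0//.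
have [d ->] : exists d, mdeg al = d.+1.
  suff : (0 < mdeg al)%N by case: (mdeg al) => // d; exists d.
  rewrite lt0n; apply: contra al0; rewrite /mdeg sum_nat_eq0 => /forallP h.
  by apply/eqP/ffunP => k; rewrite ffunE; apply/eqP; exact: h.
by rewrite exprS ler_piMr// exprn_ile1.
Qed.

Lemma ev_rescale t f z x : ev (rescale t f) z x = ev f z (t *: x).
Proof.
apply: eq_csum => -[m al]; rewrite /rescale /chi /= monomialZ rmorphM /=.
by rewrite -!mulrA; congr (_ * _); rewrite mulrCA.
Qed.

Definition PpA f : A -> C := fun a => if a.1 is Posz _ then f a else 0.

Lemma PpA_l1 f : l1 f -> l1 (PpA f) /\ l1n (PpA f) <= l1n f.
Proof. by apply: l1_dom => -[[m|m] al] //=; rewrite nrm0 nrm_ge0. Qed.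

(** [E] is the fixed point of E = u - PpA (E D). Since [u] has no negative indices, neither has [E],
    while the rest of E (1 + D) has only negative ones. With unit rows for [u] this factors 1 + D
    row by row. *)
Lemma small_norm (D : 'I_2 -> 'I_2 -> A -> C) (u : 'I_2 -> A -> C) :
  mat_l1 D -> mn D <= 2^-1 -> rows_l1 u -> (forall k m al, u k (Negz m, al) = 0) ->
  exists E, [/\ rows_l1 E, forall k m al, E k (Negz m, al) = 0 &
   forall k m al, E k (Posz m, al) + rmul E D k (Posz m, al) = u k (Posz m, al)].
Proof.
move=> hD D2 hu uneg.
pose Phi p := fun k => PpA (fun a => - rmul p D k a).
have hPhi p : rows_l1 p -> rows_l1 (Phi p) /\ rn (Phi p) <= 2^-1 * rn p.
  move=> hp; have [h1 h2] := rmul_l1 hp hD.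
  have h3 k := PpA_l1 (l1N (h1 k)); split; first by move=> k; have [] := h3 k.
  apply: (@le_trans _ _ (rn (rmul p D))).
    by apply: ler_sum => k _; have [_] := h3 k; rewrite l1nN.
  by apply: le_trans h2 _; rewrite mulrC ler_wpM2r// rn_ge0.
have [||E [hE EE]] := @rows_fixpoint R _ Phi 2^-1 u _ hu hPhi _.
- by rewrite invr_ge0 ler0n/= invf_lt1// ltr1n.
- move=> p q hp hq j -[[m|m] al]; rewrite /Phi /PpA /=; last by rewrite subrr.
  by rewrite (rmulB j _ hp hq hD) opprB opprK addrC.
exists E; split=> // k m al.
  by rewrite EE uneg /Phi /PpA /= addr0.
by rewrite {1}EE /Phi /PpA /= subrK.
Qed.

Lemma ev_rmul (p : 'I_2 -> A -> C) (D : 'I_2 -> 'I_2 -> A -> C) k z x :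
  rows_l1 p -> mat_l1 D -> nrm z = 1 -> unit_cube x ->
  ev (rmul p D k) z x = \sum_j ev (p j) z x * ev (D j k) z x.
Proof.
move=> hp hD hz hx.
have -> : rmul p D k = (fun a => conv (p 0) (D 0 k) a + conv (p 1) (D 1 k) a).
  by apply/funext => a; rewrite /rmul sum2.
have h0 := (conv_l1 (hp 0) (hD 0 k)).1; have h1 := (conv_l1 (hp 1) (hD 1 k)).1.
rewrite (ev_add h0 h1 hz hx) (ev_mul (hp 0) (hD 0 k) hz hx).
by rewrite (ev_mul (hp 1) (hD 1 k) hz hx) sum2.
Qed.

(** Summing over the powers of [z] first leaves a power series in the parameters whose coefficients
    do not depend on [x]; absolute summability on pairs permits the exchange. *)
Lemma ps_series (b : nat -> M -> C) (z : C) :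
  l1 (fun a => b a.1 a.2) -> nrm z <= 1 ->
  exists2 c : M -> C, l1 c & forall x, unit_cube x ->
    ps (fun m => csum (fun al => b m al * (monomial al x)%:C)) z =
    csum (fun al => c al * (monomial al x)%:C).
Proof.
move=> hb hz.
have [h1 _] := @l1_mulb _ _ _ (fun a : nat * M => z ^+ a.1) 1 hb
   (fun a => nrmX_le1 a.1 hz) ler01.
exists (fun al => csum (fun m => b m al * z ^+ m)).
  by have [] := l1_pair (l1_swap h1).
move=> x hx.
have hm (a : nat * M) : nrm (monomial a.2 x)%:C <= 1 by rewrite nrmC monomial_le1.
have [h2 _] := l1_mulb h1 hm ler01.
have [h3 _] := l1_mulb hb hm ler01.
transitivity (csum (fun m => csum (fun al => b m al * z ^+ m * (monomial al x)%:C))).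
  apply: eq_csum => m; rewrite mulrC -csumZ; last exact: (l1_fiber m h3).
  by apply: eq_csum => al; rewrite mulrA (mulrC (z ^+ m)).
rewrite (csum_swap h2) /=; apply: eq_csum => al.
rewrite mulrC -csumZ; last exact: (l1_fiber al (l1_swap h1)).
by apply: eq_csum => m; rewrite mulrC.
Qed.

Lemma cin_series f (z : C) : l1 f -> nrm z <= 1 ->
  exists2 c : M -> C, l1 c & forall x, unit_cube x ->
    cin (spec x f) z = csum (fun al => c al * (monomial al x)%:C).
Proof.
move=> hf hz; apply: (ps_series (b := fun m al => f (Posz m, al))) => //.
have ie : injective (fun a : nat * M => (Posz a.1, a.2)).
  by move=> [a b] [c d] /= [-> ->].
by have [] := l1_inj ie hf.
Qed.

Lemma cout_series f (z : C) : l1 f -> 1 <= nrm z ->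
  exists2 c : M -> C, l1 c & forall x, unit_cube x ->
    cout (spec x f) z = csum (fun al => c al * (monomial al x)%:C).
Proof.
move=> hf hz.
have hzi : nrm z^-1 <= 1 by rewrite nrmV invf_le1// (lt_le_trans ltr01).
have ie : injective (fun a : nat * M => (Negz a.1, a.2)).
  by move=> [a b] [c d] /= [-> ->].
have [] := @ps_series (fun m al => f (Negz m, al)) z^-1 _ hzi.
  by have [] := l1_inj ie hf.
move=> c hc cE; exists (fun al => z^-1 * c al); first by have [] := l1Z z^-1 hc.
move=> x hx; rewrite /cout [ps _ _](cE x hx) mulrC -csumZ.
  by apply: eq_csum => al; rewrite mulrA.
have [] := @l1_mulb _ _ c (fun al => (monomial al x)%:C) 1 hc _ ler01 => //.
by move=> al; rewrite nrmC monomial_le1.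
Qed.

(** The cubes of multi-indices with entries below N eventually contain every finite set, so they
    exhaust an unconditional sum. *)
Lemma box_sums (c : M -> C) : l1 c ->
  ((\sum_(beta : {ffun 'I_n -> 'I_N})
      c [ffun k => nat_of_ord (beta k)]) : C^o) @[N --> \oo] --> (csum c : C^o).
Proof.
move=> hc; apply/cvgC => e e0; have [s us hs] := csum_approx hc e0.
exists (\max_(al <- s) \max_k (al k).+1)%N => // N /= hN.
pose u (beta : {ffun 'I_n -> 'I_N}) : M := [ffun k => nat_of_ord (beta k)].
pose t : seq M := map u (enum (predT : pred {ffun 'I_n -> 'I_N})).
have -> : \sum_(beta : {ffun 'I_n -> 'I_N}) c [ffun k => nat_of_ord (beta k)] =
   \sum_(al <- t) c al by rewrite big_map big_enum.
rewrite nrm_dist; apply: hs.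
  rewrite map_inj_uniq ?enum_uniq// => b1 b2 /ffunP h; apply/ffunP => k.
  by apply/val_inj; have := h k; rewrite !ffunE.
move=> al sal; have hal k : (al k < N)%N.
  apply: leq_trans hN; apply: leq_trans (@leq_bigmax_seq _ s xpredT (fun al : M => \max_k (al k).+1)%N al sal isT).
  exact: (@leq_bigmax _ (fun k => (al k).+1)).
apply/mapP; exists [ffun k => Ordinal (hal k)]; first by rewrite mem_enum.
rewrite /u.
by apply/ffunP => k; rewrite !ffunE.
Qed.

(** A series on the unit cube becomes one on the cube of radius [rho] when each coefficient is
    divided by [rho] to the degree of its monomial. *)
Lemma analytic_of_series (F : 'rV[R]_n -> C) (x0 : 'rV[R]_n) (rho : R) (c : M -> C) :
  0 < rho -> l1 c ->
  (forall x, unit_cube x -> F (x0 + rho *: x) = csum (fun al => c al * (monomial al x)%:C)) ->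
  real_analytic_at F x0.
Proof.
move=> r0 hc hF.
pose c' al := c al * (rho^-1 ^+ mdeg al)%:C.
exists c', rho; split=> // h hh.
pose x := rho^-1 *: h.
have hx : unit_cube x.
  move=> k; rewrite mxE normrM normfV (gtr0_norm r0) mulrC ler_pdivrMr// mul1r.
  exact: ltW.
have E al : c' al * (monomial al h)%:C = c al * (monomial al x)%:C.
  by rewrite /c' /x monomialZ rmorphM /= -mulrA.
have hl : l1 (fun al => c' al * (monomial al h)%:C).
  under eq_fun do rewrite E.
  have [] := @l1_mulb _ _ c (fun al => (monomial al x)%:C) 1 hc _ ler01 => //.
  by move=> al; rewrite nrmC monomial_le1.
split.
  move: hl; rewrite /l1 /asum /summable; congr (_ < _)%E.
  apply: eq_esum => al _; rewrite /= -/(nrm (c' al)) nrmM nrmC normrM.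
  by rewrite (ger0_norm (nrm_ge0 _)).
have := box_sums hl.
have -> : csum (fun al => c' al * (monomial al h)%:C) = F (x0 + h).
  rewrite (_ : h = rho *: x); last by rewrite scalerA divff ?scale1r// gt_eqF.
  rewrite hF//; apply: eq_csum => al; rewrite -E.
  by rewrite /x scalerA divff ?scale1r// gt_eqF.
by [].
Qed.

End Evaluation.

(** * Uniqueness *)

Section RHP.
Variable R : realType.
Local Notation C := R[i].

Lemma cinfty_filter : Filter (@cinfty R).
Proof.
split.
- by exists 0.
- move=> P Q [M hM] [N hN]; exists (Num.max M N) => z hz; split.
    by apply: hM; apply: le_lt_trans hz; rewrite lecR le_max lexx.
  by apply: hN; apply: le_lt_trans hz; rewrite lecR le_max lexx orbT.
by move=> P Q PQ [M hM]; exists M => z /hM /PQ.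
Qed.

Lemma cinfM (f g : C -> C) (a b : C) :
  ((f : C -> C^o) @ @cinfty R --> (a : C^o)) -> ((g : C -> C^o) @ @cinfty R --> (b : C^o)) ->
  ((fun w => f w * g w) : C -> C^o) @ @cinfty R --> (a * b : C^o).
Proof. by move=> h1 h2; exact: (@cvgCM R _ cinfty_filter _ _ _ _ h1 h2). Qed.

Lemma cinfD (f g : C -> C) (a b : C) :
  ((f : C -> C^o) @ @cinfty R --> (a : C^o)) -> ((g : C -> C^o) @ @cinfty R --> (b : C^o)) ->
  ((fun w => f w + g w) : C -> C^o) @ @cinfty R --> (a + b : C^o).
Proof. by move=> h1 h2; exact: (@cvgCD R _ cinfty_filter _ _ _ _ h1 h2). Qed.

Lemma cinfB (f g : C -> C) (a b : C) :
  ((f : C -> C^o) @ @cinfty R --> (a : C^o)) -> ((g : C -> C^o) @ @cinfty R --> (b : C^o)) ->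
  ((fun w => f w - g w) : C -> C^o) @ @cinfty R --> (a - b : C^o).
Proof.
by move=> h1 h2; exact: (cinfD h1 (@cvgCN R _ cinfty_filter _ _ h2)).
Qed.

Lemma cinftyP (f : C -> C) (l : C) :
  ((f : C -> C^o) @ @cinfty R --> (l : C^o)) <->
  (forall e : R, 0 < e -> exists M : R, forall z, M < nrm z -> nrm (f z - l) <= e).
Proof.
split.
  move=> /(@cvgC R _ _ cinfty_filter) h e e0; have [M hM] := h e e0.
  by exists M => z hz; apply/ltW/hM; rewrite nrmE ltcR.
move=> h; apply: (@cvgC R _ _ cinfty_filter f l).2 => e e0.
have e2 : 0 < e / 2 by rewrite divr_gt0.
have [M hM] := h _ e2; exists M => z; rewrite nrmE ltcR => /hM /le_lt_trans; apply.
by lra.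
Qed.

Definition jump (X T : R) (G : 'M[C]_2) (B : R) (z : C) : 'M[C]_2 :=
  exp_sigma3 (- ('i * phase X T B z)) *m G *m exp_sigma3 ('i * phase X T B z).

Lemma mul2 (A B : 'M[C]_2) i j : (A *m B) i j = A i 0 * B 0 j + A i 1 * B 1 j.
Proof. by rewrite mxE sum2. Qed.

(** The explicit formula stays within products and differences of entries, under which derivability,
    boundary values and limits at infinity are stable. *)
Definition det2 (A : 'M[C]_2) : C := A 0 0 * A 1 1 - A 0 1 * A 1 0.

Lemma det2M A B : det2 (A *m B) = det2 A * det2 B.
Proof. by rewrite /det2 !mul2; ring. Qed.

Lemma mx2E (a b c d : C) : [/\ mx2 a b c d 0 0 = a, mx2 a b c d 0 1 = b,
  mx2 a b c d 1 0 = c & mx2 a b c d 1 1 = d].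
Proof. by rewrite !mxE. Qed.

Lemma det2_exp (f : C) : det2 (exp_sigma3 f) = 1.
Proof.
have [e1 e2 e3 e4] := mx2E (cexp f) 0 0 (cexp (- f)).
by rewrite /det2 /exp_sigma3 e1 e2 e3 e4 mulr0 subr0 cexpN divff// cexp_neq0.
Qed.

Lemma det2_jump X T G B z : det2 (jump X T G B z) = det2 G.
Proof. by rewrite /jump !det2M !det2_exp mul1r mulr1. Qed.

Lemma jumpE X T G B z : let w := 'i * phase X T B z in
  [/\ jump X T G B z 0 0 = G 0 0, jump X T G B z 0 1 = G 0 1 * cexp (- (2 * w)),
      jump X T G B z 1 0 = G 1 0 * cexp (2 * w) & jump X T G B z 1 1 = G 1 1].
Proof.
move=> w; rewrite /jump -/w.
have [a1 a2 a3 a4] := mx2E (cexp (- w)) 0 0 (cexp (- - w)).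
have [b1 b2 b3 b4] := mx2E (cexp w) 0 0 (cexp (- w)).
rewrite !mul2 /exp_sigma3 a1 a2 a3 a4 b1 b2 b3 b4 opprK.
have E : cexp (- w) * cexp w = 1 by rewrite -cexpD addNr cexp0.
have E2 : cexp (2 * w) = cexp w * cexp w by rewrite -cexpD; congr cexp; ring.
have E3 : cexp (- (2 * w)) = cexp (- w) * cexp (- w).
  by rewrite -cexpD; congr cexp; ring.
rewrite E2 E3; split.
- transitivity (G 0 0 * (cexp (- w) * cexp w)); first by ring.
  by rewrite E mulr1.
- by ring.
- by ring.
- transitivity (G 1 1 * (cexp (- w) * cexp w)); first by ring.
  by rewrite E mulr1.
Qed.

Lemma glue_one (f phi psi : C -> C) :
  (forall z, nrm z != 1 -> deriv1 f z) ->
  bv (@exterior_disk R) f phi -> bv (@interior_disk R) f psi ->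
  (forall z, nrm z = 1 -> phi z = psi z) -> forall l : C,
  ((f : C -> C^o) @ @cinfty R --> (l : C^o)) ->
  (forall z, nrm z != 1 -> f z = l) /\ (forall z, nrm z = 1 -> psi z = l).
Proof.
move=> df bo bi pp l /cinftyP foo.
have d z : nrm z != 1 -> deriv1 (fun w => f w - l) z.
  by move=> hz; exact: (@deriv1B R f (fun=> l) z (df z hz) (@deriv1_cst R l z)).
have h1 z : nrm z < 1 -> deriv1 (fun w => f w - l) z.
  by move=> hz; apply: d; rewrite lt_eqF.
have h2 z : 1 < nrm z -> deriv1 (fun w => f w - l) z.
  by move=> hz; apply: d; rewrite gt_eqF.
have bi' := bvB bi (bv_cst (@interior_disk R) l).
have bo' : bv (@exterior_disk R) (fun w => f w - l) (fun w => psi w - l).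
  apply: (bv_eq _ _ (bvB bo (bv_cst (@exterior_disk R) l))) => // z /circleE hz.
  by rewrite pp.
have [g1 g2 g3] := glue_zero h1 bi' h2 bo' foo.
split=> z hz; apply/eqP; rewrite -subr_eq0; apply/eqP; last exact: g3.
have [h|h|h] := ltgtP (nrm z) 1; [exact: g1|exact: g2|].
by rewrite h eqxx in hz.
Qed.

Lemma circ_neq (z : C) : (`|z| != 1) = (nrm z != 1).
Proof.
rewrite nrmE; congr (~~ _); apply/eqP/eqP => [h|->//].
by apply: (@complexI R); rewrite h.
Qed.

Section Unique.
Variables (X T B : R) (G : 'M[C]_2).
Hypothesis detG : det2 G = 1.

Lemma rhp_det (P : C -> 'M[C]_2) (Pp Pm : C -> 'M[C]_2) :
  mx_analytic [set z | `|z| != 1] P ->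
  boundary_values (@exterior_disk R) P Pp -> boundary_values (@interior_disk R) P Pm ->
  (forall z, nrm z = 1 -> Pp z = Pm z *m jump X T G B z) ->
  (forall i j, (P w i j : C^o) @[w --> @cinfty R] --> ((1%:M : 'M[C]_2) i j : C^o)) ->
  (forall z, nrm z != 1 -> det2 (P z) = 1) /\ (forall z, nrm z = 1 -> det2 (Pm z) = 1).
Proof.
move=> hA /bvP bp /bvP bm hJ hoo.
have dP i j z : nrm z != 1 -> deriv1 (fun w => P w i j) z.
  by rewrite -circ_neq => hz; exact: hA.
apply: (@glue_one (fun w => det2 (P w)) (fun w => det2 (Pp w)) (fun w => det2 (Pm w))).
- move=> z hz; exact: (deriv1B (deriv1M (dP 0 0 z hz) (dP 1 1 z hz))
    (deriv1M (dP 0 1 z hz) (dP 1 0 z hz))).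
- exact: (bvB (bvM (bp 0 0) (bp 1 1)) (bvM (bp 0 1) (bp 1 0))).
- exact: (bvB (bvM (bm 0 0) (bm 1 1)) (bvM (bm 0 1) (bm 1 0))).
- by move=> z hz; rewrite hJ// det2M det2_jump detG mulr1.
- have := cinfB (cinfM (hoo 0 0) (hoo 1 1)) (cinfM (hoo 0 1) (hoo 1 0)).
  by rewrite !mxE /= mulr0 subr0 mulr1.
Qed.

Lemma rhp_unique (P Q : C -> 'M[C]_2) :
  RHP_solution X T G B P -> RHP_solution X T G B Q ->
  forall z, nrm z != 1 -> Q z = P z.
Proof.
move=> [hA [Pp [Pm [bp bm hJ]]] hoo] [hA' [Qp [Qm [bp' bm' hJ']]] hoo'].
have {}hJ z : nrm z = 1 -> Pp z = Pm z *m jump X T G B z.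
  by move=> /circleE hz; rewrite hJ// /jump !mulmxA.
have {}hJ' z : nrm z = 1 -> Qp z = Qm z *m jump X T G B z.
  by move=> /circleE hz; rewrite hJ'// /jump !mulmxA.
have [d1 d2] := rhp_det hA bp bm hJ hoo.
move/bvP: bp => bp; move/bvP: bm => bm; move/bvP: bp' => bp'; move/bvP: bm' => bm'.
have dP i j z : nrm z != 1 -> deriv1 (fun w => P w i j) z.
  by rewrite -circ_neq => hz; exact: hA.
have dQ i j z : nrm z != 1 -> deriv1 (fun w => Q w i j) z.
  by rewrite -circ_neq => hz; exact: hA'.
have detJ z : nrm z = 1 -> det2 (jump X T G B z) = 1 by rewrite det2_jump.
(* Since det P = 1, these are the entries of Q P^-1. *)
have e0 i z : nrm z != 1 -> Q z i 0 * P z 1 1 - Q z i 1 * P z 1 0 = (1%:M : 'M[C]_2) i 0.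
  apply: (@glue_one (fun z => Q z i 0 * P z 1 1 - Q z i 1 * P z 1 0)
    (fun z => Qp z i 0 * Pp z 1 1 - Qp z i 1 * Pp z 1 0)
    (fun z => Qm z i 0 * Pm z 1 1 - Qm z i 1 * Pm z 1 0) _ _ _ _ ((1%:M : 'M[C]_2) i 0) _).1.
  - move=> w hw; exact: (deriv1B (deriv1M (dQ i 0 w hw) (dP 1 1 w hw))
      (deriv1M (dQ i 1 w hw) (dP 1 0 w hw))).
  - exact: (bvB (bvM (bp' i 0) (bp 1 1)) (bvM (bp' i 1) (bp 1 0))).
  - exact: (bvB (bvM (bm' i 0) (bm 1 1)) (bvM (bm' i 1) (bm 1 0))).
  (* [P] and [Q] are multiplied on the right by the same [J], so the combination of entries acquires
     the factor det J, which is 1. *)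
  - move=> w hw; rewrite hJ// hJ'//; move: (detJ w hw).
    move: (jump X T G B w) => J; rewrite /det2 => E; rewrite !mul2.
    by rewrite -[RHS]mulr1 -E; ring.
  - have := cinfB (cinfM (hoo' i 0) (hoo 1 1)) (cinfM (hoo' i 1) (hoo 1 0)).
    rewrite [(1%:M : 'M[C]_2) 1 1]mxE [(1%:M : 'M[C]_2) 1 0]mxE /=.
    by rewrite mulr0 subr0 mulr1.
have e1 i z : nrm z != 1 -> Q z i 1 * P z 0 0 - Q z i 0 * P z 0 1 = (1%:M : 'M[C]_2) i 1.
  apply: (@glue_one (fun z => Q z i 1 * P z 0 0 - Q z i 0 * P z 0 1)
    (fun z => Qp z i 1 * Pp z 0 0 - Qp z i 0 * Pp z 0 1)
    (fun z => Qm z i 1 * Pm z 0 0 - Qm z i 0 * Pm z 0 1) _ _ _ _ ((1%:M : 'M[C]_2) i 1) _).1.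
  - move=> w hw; exact: (deriv1B (deriv1M (dQ i 1 w hw) (dP 0 0 w hw))
      (deriv1M (dQ i 0 w hw) (dP 0 1 w hw))).
  - exact: (bvB (bvM (bp' i 1) (bp 0 0)) (bvM (bp' i 0) (bp 0 1))).
  - exact: (bvB (bvM (bm' i 1) (bm 0 0)) (bvM (bm' i 0) (bm 0 1))).
  - move=> w hw; rewrite hJ// hJ'//; move: (detJ w hw).
    move: (jump X T G B w) => J; rewrite /det2 => E; rewrite !mul2.
    by rewrite -[RHS]mulr1 -E; ring.
  - have := cinfB (cinfM (hoo' i 1) (hoo 0 0)) (cinfM (hoo' i 0) (hoo 0 1)).
    rewrite [(1%:M : 'M[C]_2) 0 0]mxE [(1%:M : 'M[C]_2) 0 1]mxE /=.
    by rewrite mulr0 subr0 mulr1.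
move=> z hz; have D := d1 z hz; rewrite /det2 in D.
apply/matrixP => i j.
have E : Q z i j = (1%:M : 'M[C]_2) i 0 * P z 0 j + (1%:M : 'M[C]_2) i 1 * P z 1 j.
  rewrite -(e0 i z hz) -(e1 i z hz) -[LHS]mulr1 -D.
  by case: (ord2 j) => ->; ring.
by rewrite E !mxE; case: (ord2 i) => ->; rewrite /= ?mul1r ?mul0r ?addr0 ?add0r.
Qed.

End Unique.

Lemma mk_solution (X T B : R) (G : 'M[C]_2) (Pin Pout : 'I_2 -> 'I_2 -> C -> C) :
  (forall i j z, nrm z < 1 -> deriv1 (Pin i j) z) ->
  (forall i j, bv (@interior_disk R) (Pin i j) (Pin i j)) ->
  (forall i j z, 1 < nrm z -> deriv1 (Pout i j) z) ->
  (forall i j, bv (@exterior_disk R) (Pout i j) (Pout i j)) ->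
  (forall i j, ((Pout i j) : C -> C^o) @ @cinfty R --> ((i == j)%:R : C^o)) ->
  (forall i k z, nrm z = 1 -> Pout i k z = \sum_j Pin i j z * jump X T G B z j k) ->
  let P z : 'M[C]_2 := \matrix_(i, j) if nrm z < 1 then Pin i j z else Pout i j z in
  let Pp z : 'M[C]_2 := \matrix_(i, j) Pout i j z in
  let Pm z : 'M[C]_2 := \matrix_(i, j) Pin i j z in
  [/\ mx_analytic [set z | `|z| != 1] P, boundary_values (@exterior_disk R) P Pp,
      boundary_values (@interior_disk R) P Pm,
      forall z, nrm z = 1 -> Pp z = Pm z *m jump X T G B z &
      forall i j, (P w i j : C^o) @[w --> @cinfty R] --> ((1%:M : 'M[C]_2) i j : C^o)].
Proof.
move=> d1 b1 d2 b2 oo hJ P Pp Pm.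
have Ei i j z : nrm z < 1 -> P z i j = Pin i j z.
  by move=> h; rewrite mxE h.
have Eo i j z : 1 < nrm z -> P z i j = Pout i j z.
  by move=> h; rewrite mxE ltNge (ltW h).
split.
- move=> i j z /=; rewrite circ_neq => z1.
  have [h|h|h] := ltgtP (nrm z) 1; last by rewrite h eqxx in z1.
    apply: (deriv1_near (f := Pin i j) (d := 1 - nrm z)); rewrite ?subr_gt0//; last exact: d1.
    move=> w hw; rewrite Ei// -(subrK z w) (le_lt_trans (nrmD _ _))//.
    by rewrite -ltrBrDr.
  apply: (deriv1_near (f := Pout i j) (d := nrm z - 1)); rewrite ?subr_gt0//; last exact: d2.
  move=> w hw; rewrite Eo//; have := nrmD (z - w) w.
  rewrite subrK nrm_dist; lra.
- apply/bvP => i j; apply: (bv_eq _ _ (b2 i j)) => z hz; last by rewrite mxE.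
  by rewrite Eo//; apply/exteriorE.
- apply/bvP => i j; apply: (bv_eq _ _ (b1 i j)) => z hz; last by rewrite mxE.
  by rewrite Ei//; apply/interiorE.
- move=> z hz; apply/matrixP => i k; rewrite [LHS]mxE hJ// [RHS]mxE.
  by apply: eq_bigr => j _; rewrite [in RHS]mxE.
- move=> i j; apply/cinftyP => e e0; have /cinftyP/(_ e e0)[M hM] := oo i j.
  exists (Num.max M 1) => z; rewrite gt_max => /andP[zM z1].
  by rewrite Eo// [(1%:M : 'M[C]_2) i j]mxE; exact: hM.
Qed.

End RHP.

(** * The jump matrix as a convergent series *)

Section Elements.
Variable R : realType.
Local Notation C := R[i].
Variable n : nat.
Local Notation M := {ffun 'I_n -> nat}.
Local Notation A := (int * M)%type.
Implicit Types (x : 'rV[R]_n) (f g : A -> C).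

Lemma chi0 (z : C) x : chi z x 0 = 1.
Proof.
rewrite /chi /= expr0z mul1r (_ : monomial 0 x = 1)//.
by rewrite /monomial big1// => k _; rewrite ffunE expr0.
Qed.

Lemma ev_delta (a : A) (c z : C) x : ev (delta a c) z x = c * chi z x a.
Proof.
by rewrite /ev (@csum1 _ _ _ a) /delta ?eqxx// => b /negbTE ->; rewrite mul0r.
Qed.

Definition evar (k : 'I_n) : M := [ffun j => nat_of_bool (j == k)].

Lemma monomial_evar k x : monomial (evar k) x = x 0 k.
Proof.
rewrite /monomial (bigD1 k)//= ffunE eqxx expr1 big1 ?mulr1// => j jk.
by rewrite ffunE (negbTE jk) expr0.
Qed.

(** Affine in two parameters, which suits [par_a], [par_b] and their conjugates: each depends on one
    real and one imaginary coordinate. *)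
Definition lin (c0 : C) (k1 : 'I_n) (c1 : C) (k2 : 'I_n) (c2 : C) : A -> C :=
  fun a => delta 0 c0 a + (delta (0, evar k1) c1 a + delta (0, evar k2) c2 a).

Lemma lin_l1 c0 k1 c1 k2 c2 : l1 (lin c0 k1 c1 k2 c2).
Proof.
have h (a : A) (c : C) : l1 (delta a c) by have [] := delta_l1 a c.
by apply: (l1D _ (l1D _ _).1).1.
Qed.

Lemma ev_lin c0 k1 c1 k2 c2 z x : nrm z = 1 -> unit_cube x ->
  ev (lin c0 k1 c1 k2 c2) z x = c0 + (c1 * (x 0 k1)%:C + c2 * (x 0 k2)%:C).
Proof.
move=> hz hx; have h (a : A) (c : C) : l1 (delta a c) by have [] := delta_l1 a c.
rewrite (ev_add (h 0 c0) (l1D (h (0, evar k1) c1) (h (0, evar k2) c2)).1 hz hx).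
rewrite (ev_add (h _ c1) (h _ c2) hz hx) !ev_delta chi0 mulr1.
by rewrite /chi /= !expr0z !mul1r !monomial_evar.
Qed.

Lemma evZ (c : C) f z x : l1 f -> nrm z = 1 -> unit_cube x ->
  ev (fun a => c * f a) z x = c * ev f z x.
Proof.
move=> hf hz hx; rewrite /ev -csumZ; last exact: ev_l1.
by apply: eq_csum => a; rewrite mulrA.
Qed.

(** The exponential of [c] times the monomial [a]: the k-th term sits at [a *+ k]. Several k may
    share an index, as for [a = 0]; [push] adds their terms. *)
Definition expo (c : C) (a : A) : A -> C := push (fun k : nat => a *+ k) (expc c).

Lemma expo_l1 c a : l1 (expo c a).
Proof. by have [] := l1_push (fun k : nat => a *+ k) (expc_l1 c).1. Qed.

Lemma ev_expo c a z x : nrm z = 1 -> unit_cube x ->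
  ev (expo c a) z x = cexp (c * chi z x a).
Proof.
move=> hz hx; rewrite /ev /expo (csum_push _ (expc_l1 c).1 _ ler01); last first.
  by move=> b; exact: chi_le1.
rewrite cexp_series; apply: eq_csum => k.
rewrite /expc exprMn mulrAC; congr (_ * _ / _).
elim: k => [|k IH]; first by rewrite mulr0n chi0 expr0.
by rewrite mulrS chiD// IH exprS.
Qed.

Lemma ev_add_mul f g f' g' z x : l1 f -> l1 g -> l1 f' -> l1 g' ->
  nrm z = 1 -> unit_cube x ->
  ev (fun a => conv f g a + conv f' g' a) z x =
  ev f z x * ev g z x + ev f' z x * ev g' z x.
Proof.
move=> hf hg hf' hg' hz hx.
rewrite (ev_add (conv_l1 hf hg).1 (conv_l1 hf' hg').1 hz hx).
by rewrite (ev_mul hf hg hz hx) (ev_mul hf' hg' hz hx).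
Qed.

Lemma ev_expo_conv (f : A -> C) (c d : C) (a : A) z x :
  l1 f -> nrm z = 1 -> unit_cube x -> ev f z x = cexp d ->
  ev (conv (expo c a) f) z x = cexp (c * chi z x a + d).
Proof.
move=> hf hz hx fd.
by rewrite (ev_mul (expo_l1 c a) hf hz hx) (ev_expo c a hz hx) fd -(cexpD _ d).
Qed.

(** The equation (1 + u)^2 = 1 + f reads u = (f - u^2)/2. This map preserves the ball of radius 1/2,
    and u^2 - v^2 = (u - v) u + v (u - v) gives it the Lipschitz constant 1/2 there. *)
Lemma sqrt_element f : l1 f -> l1n f <= 2^-1 -> exists u, [/\ l1 u, l1n u <= 2^-1 &
  forall z x, nrm z = 1 -> unit_cube x -> (1 + ev u z x) ^+ 2 = 1 + ev f z x].
Proof.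
move=> hf f2.
pose Phi u : A -> C := fun a => 2^-1 * (f a - conv u u a).
have n2 : nrm (2^-1 : C) = 2^-1.
  by rewrite nrmV (_ : (2 : C) = 2%:R)// nrm_nat.
have h2 : 0 <= (2^-1 : R) < 1 by rewrite invr_ge0 ler0n/= invf_lt1// ltr1n.
have h20 : 0 <= (2^-1 : R) by case/andP: h2.
have [||u [hu u2 uE]] := @l1_fixpoint R _ Phi 2^-1 2^-1 h2 h20.
- move=> u hu u2; have [c1 c2] := conv_l1 hu hu.
  have [b1 b2] := l1B hf c1; have [z1 z2] := l1Z 2^-1 b1; split=> //.
  apply: le_trans z2 _; rewrite n2.
  have cc := ler_pM (l1n_ge0 u) (l1n_ge0 u) u2 u2.
  have : l1n (fun i => f i - conv u u i) <= 1 by move: b2 c2 cc f2; lra.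
  by move=> h; rewrite -[leRHS]mulr1 ler_wpM2l.
- move=> u v hu u2 hv v2; have [d1 _] := l1B hu hv.
  have [e1 e2] := conv_l1 d1 hu; have [g1 g2] := conv_l1 hv d1.
  have [k1 k2] := l1D e1 g1; have [m1 m2] := l1Z (- 2^-1) k1.
  have -> : (fun i => Phi u i - Phi v i) = (fun i => - 2^-1 *
     (conv (fun i => u i - v i) u i + conv v (fun i => u i - v i) i)).
    apply/funext => i; rewrite /Phi (convBl i hu hv hu) (convBr i hu hv hv).
    rewrite (convC v u); move: (conv u u i) (conv u v i) (conv v v i) => c1 c2 c3.
  by rewrite mulrBr mulrBr; ring.
  apply: le_trans m2 _; rewrite nrmN n2 ler_wpM2l//.
  set d := l1n (fun i => u i - v i) in e2 g2 *.
  have d0 : 0 <= d by exact: l1n_ge0.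
  have q1 := ler_wpM2l d0 u2; have q2 := ler_wpM2r d0 v2.
  apply: (le_trans k2); apply: (le_trans (lerD e2 g2)); apply: (le_trans (lerD q1 q2)).
  by rewrite (mulrC 2^-1) -splitr.
exists u; split=> // z x hz hx.
have [c1 _] := conv_l1 hu hu; have cN := l1N c1.
have E : ev u z x = 2^-1 * (ev f z x - ev u z x * ev u z x).
  rewrite -(ev_mul hu hu hz hx).
  have -> : ev u z x = ev (Phi u) z x by congr (ev _ z x); apply/funext => a; rewrite uE.
  rewrite /Phi (evZ _ (l1B hf c1).1 hz hx); congr (_ * _).
  rewrite (ev_add hf cN hz hx); congr (_ + _).
  rewrite (_ : (fun a => - conv u u a) = (fun a => (-1) * conv u u a)); last first.
    by apply/funext => a; rewrite mulN1r.
  by rewrite (evZ _ c1 hz hx) mulN1r.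
have {}E : 2 * ev u z x = ev f z x - ev u z x * ev u z x.
  by rewrite {1}E mulrA divff ?mul1r// pnatr_eq0.
by rewrite -[ev f z x](subrK (ev u z x * ev u z x)) -E; ring.
Qed.

(** The fixed point of w = 1 - u w. The radius 2 is preserved because 1 + (1/2) 2 = 2. *)
Lemma inverse_element u : l1 u -> l1n u <= 2^-1 -> exists w, l1 w /\
  forall z x, nrm z = 1 -> unit_cube x -> (1 + ev u z x) * ev w z x = 1.
Proof.
move=> hu u2.
pose Phi w : A -> C := fun a => delta 0 1 a - conv u w a.
have h2 : 0 <= (2^-1 : R) < 1 by rewrite invr_ge0 ler0n/= invf_lt1// ltr1n.
have h20 : 0 <= (2^-1 : R) by case/andP: h2.
have [de1 de2] := delta_l1 (0 : A) (1 : C); rewrite nrm1 in de2.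
have [||w [hw _ wE]] := @l1_fixpoint R _ Phi 2 2^-1 h2 (ler0n _ 2).
- move=> w hw w2; have [c1 c2] := conv_l1 hu hw.
  have [b1 b2] := l1B de1 c1; split=> //; apply: le_trans b2 _.
  have := ler_pM (l1n_ge0 u) (l1n_ge0 w) u2 w2; rewrite mulVf ?pnatr_eq0//.
  by move: de2 c2; lra.
- move=> v w hv _ hw _; have [d1 _] := l1B hv hw.
  have [c1 c2] := conv_l1 hu d1; have n1 := l1nN (conv u (fun i => v i - w i)).
  have -> : (fun i => Phi v i - Phi w i) = (fun i => - conv u (fun i => v i - w i) i).
    by apply/funext => i; rewrite /Phi (convBr i hv hw hu); ring.
  by rewrite n1; apply: le_trans c2 _; rewrite ler_wpM2r// l1n_ge0.
exists w; split=> // z x hz hx.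
have [c1 _] := conv_l1 hu hw.
have E : ev w z x = 1 - ev u z x * ev w z x.
  rewrite -(ev_mul hu hw hz hx).
  have -> : ev w z x = ev (Phi w) z x by congr (ev _ z x); apply/funext => a; rewrite wE.
  rewrite /Phi (ev_add de1 (l1N c1) hz hx) ev_delta chi0 mulr1; congr (_ + _).
  rewrite (_ : (fun a => - conv u w a) = (fun a => (-1) * conv u w a)); last first.
    by apply/funext => a; rewrite mulN1r.
  by rewrite (evZ _ c1 hz hx) mulN1r.
by rewrite mulrDl mul1r {1}E subrK.
Qed.

End Elements.

(** * The jump matrix near a base point *)

Section JumpElement.
Variable R : realType.
Local Notation C := R[i].
Local Notation Re := (@complex.Re R).
Local Notation A := (int * {ffun 'I_6 -> nat})%type.
Variable B : R.

(** The squared norm written as a polynomial in a, b and their conjugates, all of which are affine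
    in the real parameters. *)
Definition den (a b : C) : C := a * conjc a + b * conjc b.

Lemma denE (a b : C) : `|a| ^+ 2 + `|b| ^+ 2 = den a b.
Proof. by rewrite !sqr_normc. Qed.

Lemma den_gt0 (a b : C) : (a, b) != (0, 0) -> 0 < den a b.
Proof.
rewrite xpair_eqE negb_and -denE => /orP[h|h].
  by apply: ltr_pwDl; [rewrite exprn_gt0// normr_gt0|rewrite exprn_ge0].
by apply: ltr_wpDl; [rewrite exprn_ge0|rewrite exprn_gt0// normr_gt0].
Qed.

Lemma den_neq0 (a b : C) : den a b != 0 -> (a, b) != (0, 0).
Proof.
apply: contra => /eqP[-> ->]; by rewrite /den !mul0r addr0.
Qed.

Lemma GmxE (a b : C) : let s := (sqrtC (den a b))^-1 in
  [/\ Gmx a b 0 0 = s * a, Gmx a b 0 1 = s * conjc b,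
      Gmx a b 1 0 = s * (- b) & Gmx a b 1 1 = s * conjc a].
Proof.
move=> s; have [e1 e2 e3 e4] := mx2E a (Num.conj b) (- b) (Num.conj a).
have h i j : Gmx a b i j = s * mx2 a (Num.conj b) (- b) (Num.conj a) i j.
  by rewrite /Gmx mxE denE.
by rewrite !h e1 e2 e3 e4.
Qed.

Lemma det2_Gmx (a b : C) : (a, b) != (0, 0) -> det2 (Gmx a b) = 1.
Proof.
move=> /den_gt0 h; have [e1 e2 e3 e4] := GmxE a b.
rewrite /det2 e1 e2 e3 e4; set s := sqrtC _.
have s2 : s ^+ 2 = den a b by exact: sqrtCK.
have s0 : s != 0 by rewrite -sqrf_eq0 s2 gt_eqF.
transitivity (s^-1 ^+ 2 * den a b); first by rewrite /den; ring.
by rewrite -s2 -exprMn mulVf// expr1n.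
Qed.

(* Identifies the algebraically constructed square root with sqrtC: y is near 1,
   so it lies in the right half-plane. *)
Lemma sqrt_scale (t t0 y : C) : 0 < t0 -> 0 <= t -> y ^+ 2 = t0^-1 * t ->
  nrm (y - 1) <= 2^-1 -> sqrtC t = sqrtC t0 * y.
Proof.
move=> t00 tp hy y1.
have s0 : 0 < sqrtC t0 by rewrite sqrtC_gt0.
have E : (sqrtC t0 * y) ^+ 2 = sqrtC t ^+ 2.
  by rewrite exprMn !sqrtCK hy mulrA divff ?mul1r// gt_eqF.
move/eqP: E; rewrite eqf_sqr => /orP[/eqP//|/eqP E].
exfalso; have : sqrtC t0 * y <= 0 by rewrite E oppr_le0 sqrtC_ge0.
rewrite pmulr_rle0// => y0.
have : Re y <= 0 by move: y0; rewrite lecE => /andP[].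
have := nrm_Re (y - 1); rewrite cReD raddfN /= ler_norml; lra.
Qed.

Variable v0 : 'rV[R]_6.
Hypothesis ab0 : (par_a v0, par_b v0) != (0, 0).

Let aA (r : R) : A -> C := lin (par_a v0) 2 r%:C 3 (r%:C * 'i).
Let aA' (r : R) : A -> C := lin (conjc (par_a v0)) 2 r%:C 3 (- (r%:C * 'i)).
Let bA (r : R) : A -> C := lin (par_b v0) 4 r%:C 5 (r%:C * 'i).
Let bA' (r : R) : A -> C := lin (conjc (par_b v0)) 4 r%:C 5 (- (r%:C * 'i)).

Let ev_aA r z x : nrm z = 1 -> unit_cube x -> ev (aA r) z x = par_a (v0 + r *: x).
Proof.
by move=> hz hx; rewrite ev_lin// /par_a !mxE; simpc; rewrite addrC.
Qed.

Let ev_aA' r z x : nrm z = 1 -> unit_cube x ->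
  ev (aA' r) z x = conjc (par_a (v0 + r *: x)).
Proof.
by move=> hz hx; rewrite ev_lin// /par_a !mxE; simpc; rewrite /= opprD.
Qed.

Let ev_bA r z x : nrm z = 1 -> unit_cube x -> ev (bA r) z x = par_b (v0 + r *: x).
Proof.
by move=> hz hx; rewrite ev_lin// /par_b !mxE; simpc; rewrite addrC.
Qed.

Let ev_bA' r z x : nrm z = 1 -> unit_cube x ->
  ev (bA' r) z x = conjc (par_b (v0 + r *: x)).
Proof.
by move=> hz hx; rewrite ev_lin// /par_b !mxE; simpc; rewrite /= opprD.
Qed.

Let t0 : C := den (par_a v0) (par_b v0).

(** Divided by its value [t0] at the base point, the squared norm is 1 + f with [f] free of constant
    part. Shrinking the parameters by [rho] brings [f] into the range of [sqrt_element];
    invertibility of the root also shows that (a, b) stays nonzero. *)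
Let sqrt_part : exists2 rho : R, 0 < rho & exists sA : A -> C, l1 sA /\
  forall z x, nrm z = 1 -> unit_cube x ->
    (par_a (v0 + rho *: x), par_b (v0 + rho *: x)) != (0, 0) /\
    ev sA z x = (sqrtC (den (par_a (v0 + rho *: x)) (par_b (v0 + rho *: x))))^-1.
Proof.
have t00 : 0 < t0 by exact: den_gt0.
pose tA : A -> C := fun a => conv (aA 1) (aA' 1) a + conv (bA 1) (bA' 1) a.
have hl c0 k1 c1 k2 c2 : l1 (lin c0 k1 c1 k2 c2 : A -> C) by exact: lin_l1.
have la : l1 (aA 1) by exact: hl.
have la' : l1 (aA' 1) by exact: hl.
have lb : l1 (bA 1) by exact: hl.
have lb' : l1 (bA' 1) by exact: hl.
have h1 := (conv_l1 la la').1; have h2 := (conv_l1 lb lb').1.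
have htA : l1 tA := (l1D h1 h2).1.
have hd := (delta_l1 (0 : A) (-1 : C)).1.
have hz' := (l1Z t0^-1 htA).1.
pose f : A -> C := fun a => t0^-1 * tA a + delta 0 (-1) a.
have hf : l1 f := (l1D hz' hd).1.
have ev_f z x : nrm z = 1 -> unit_cube x ->
    1 + ev f z x = t0^-1 * den (par_a (v0 + x)) (par_b (v0 + x)).
  move=> hz hx; rewrite (ev_add hz' hd hz hx) (evZ _ htA hz hx).
  rewrite (ev_add_mul la la' lb lb' hz hx) ev_delta chi0.
  rewrite (ev_aA 1 hz hx) (ev_aA' 1 hz hx) (ev_bA 1 hz hx) (ev_bA' 1 hz hx).
  rewrite scale1r -/(den _ _).
  by rewrite mulr1 addrCA subrr addr0.
have c0 : unit_cube (0 : 'rV[R]_6) by move=> k; rewrite mxE normr0.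
have f0 m : f (m, 0) = 0.
  apply: (sym_inj0 (slice0_l1 hf)) => z hz.
  rewrite -(sym_spec0 hf hz); have := ev_f z 0 hz c0.
  by rewrite addr0 mulVf ?gt_eqF// => /eqP; rewrite -subr_eq0 addrAC subrr add0r => /eqP.
have F0 : 0 <= l1n f by exact: l1n_ge0.
(* This makes [rho * l1n f] at most 1/2 and [rho] at most 1. *)
pose rho := (2 * (l1n f + 1))^-1.
have r0 : 0 < rho by rewrite invr_gt0; lra.
have rE : rho * (2 * (l1n f + 1)) = 1 by rewrite mulVf// gt_eqF//; lra.
have r1 : rho <= 1 by rewrite invf_le1//; lra.
have r01 : 0 <= rho <= 1 by rewrite (ltW r0).
have [hx1 hx2] := rescale_l1 r01 hf f0.
have hx3 : l1n (rescale rho f) <= 2^-1 by apply: le_trans hx2 _; lra.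
have [u [hu u2 uE]] := sqrt_element hx1 hx3.
have [w [hw wE]] := inverse_element hu u2.
exists rho => //; exists (fun a => (sqrtC t0)^-1 * w a); split.
  exact: (l1Z _ hw).1.
move=> z x hz hx.
have hx' : unit_cube (rho *: x).
  by move=> k; rewrite mxE normrM (gtr0_norm r0) mulr_ile1// ltW.
have y2 := uE z x hz hx; rewrite ev_rescale ev_f// in y2.
have yw := wE z x hz hx; set y := 1 + ev u z x in y2 yw.
have y0 : y != 0.
  by apply/negP => /eqP h; move/eqP: yw; rewrite h mul0r eq_sym oner_eq0.
have ab : (par_a (v0 + rho *: x), par_b (v0 + rho *: x)) != (0, 0).
  apply: den_neq0; apply/negP => /eqP h; move: y2; rewrite h mulr0 => /eqP.
  by rewrite sqrf_eq0 (negbTE y0).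
split=> //; rewrite (evZ _ hw hz hx).
rewrite (sqrt_scale t00 (ltW (den_gt0 ab)) y2); last first.
  rewrite /y addrC addKr; apply: le_trans u2; apply: le_trans (csum_norm _) _.
    exact: ev_l1.
  rewrite -[leRHS]mul1r; apply: (l1_mulb hu _ ler01).2 => a; exact: chi_le1.
by rewrite invfM; congr (_ * _); apply: (mulfI y0); rewrite yw divff.
Qed.

(** The exponential of 2 i s times the phase, as a product of exponentials of single monomials: the
    base values of X and T, their increments along the parameters 0 and 1, and the term in B/z. The
    sign [s] is 1 for the entry (1, 0) of the jump and -1 for the entry (0, 1). *)
Let ph (r s : R) : A -> C :=
  conv (expo (s%:C * (2 * 'i * (par_X v0)%:C)) (1, 0))
  (conv (expo (s%:C * (2 * 'i * r%:C)) (1, evar 0))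
  (conv (expo (s%:C * (2 * 'i * (par_T v0)%:C)) (2, 0))
  (conv (expo (s%:C * (2 * 'i * r%:C)) (2, evar 1))
        (expo (s%:C * (4 * 'i * B%:C)) (-1, 0))))).

Let ph_l1 r s : l1 (ph r s).
Proof.
by do 4!(apply: (conv_l1 _ _).1; first exact: expo_l1); exact: expo_l1.
Qed.

Let ev_ph r s z x : nrm z = 1 -> unit_cube x ->
  ev (ph r s) z x = cexp (s%:C * (2 * ('i * phase (par_X (v0 + r *: x))
    (par_T (v0 + r *: x)) B z))).
Proof.
move=> hz hx; have e := @expo_l1 R 6.
have e4 := (conv_l1 (e (s%:C * (2 * 'i * r%:C)) (2, evar 1)) (e (s%:C * (4 * 'i * B%:C)) (-1, 0))).1.
have e3 := (conv_l1 (e (s%:C * (2 * 'i * (par_T v0)%:C)) (2, 0)) e4).1.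
have e2 := (conv_l1 (e (s%:C * (2 * 'i * r%:C)) (1, evar 0)) e3).1.
have E := ev_expo_conv _ _ e2 hz hx (ev_expo_conv _ _ e3 hz hx
  (ev_expo_conv _ _ e4 hz hx (ev_expo_conv _ _ (e _ _) hz hx (ev_expo _ _ hz hx)))).
rewrite (E _ _) {E}; congr cexp.
rewrite /chi /= (_ : monomial 0 x = 1); last first.
  by rewrite /monomial big1// => k _; rewrite ffunE expr0.
rewrite !monomial_evar /par_X /par_T !mxE /phase !rmorphD !rmorphM /=.
rewrite expr1z !mulr1.
have -> : z ^ (-1) = z^-1 by [].
have -> : z ^ 2 = z ^+ 2 by [].
by ring.
Qed.

Lemma jump_element : exists2 rho : R, 0 < rho &
  exists VA : 'I_2 -> 'I_2 -> A -> C, mat_l1 VA /\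
  forall z x, nrm z = 1 -> unit_cube x -> let v := v0 + rho *: x in
    (par_a v, par_b v) != (0, 0) /\
    forall j k, ev (VA j k) z x =
      jump (par_X v) (par_T v) (Gmx (par_a v) (par_b v)) B z j k.
Proof.
have [rho r0 [sA [hs sE]]] := sqrt_part; exists rho => //.
have hl c0 k1 c1 k2 c2 : l1 (lin c0 k1 c1 k2 c2 : A -> C) by exact: lin_l1.
have haA : l1 (aA rho) by exact: hl.
have haA' : l1 (aA' rho) by exact: hl.
have hbA : l1 (bA rho) by exact: hl.
have hbA' : l1 (bA' rho) by exact: hl.
have p1 := ph_l1 rho 1; have pm := ph_l1 rho (-1).
have v00 := (conv_l1 hs haA).1; have v11 := (conv_l1 hs haA').1.
have w01 := (conv_l1 hs hbA').1; have v01 := (conv_l1 w01 pm).1.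
have w10 := (conv_l1 hs (l1Z (-1) hbA).1).1; have v10 := (conv_l1 w10 p1).1.
pose VA (j k : 'I_2) : A -> C := if j == 0 then
   (if k == 0 then conv sA (aA rho) else conv (conv sA (bA' rho)) (ph rho (-1)))
   else (if k == 0 then conv (conv sA (fun a => -1 * bA rho a)) (ph rho 1)
   else conv sA (aA' rho)).
exists VA; split.
  by move=> j k; rewrite /VA; case: ifP => _; case: ifP.
move=> z x hz hx v; have [ab se] := sE z x hz hx; split=> // j k.
have [j1 j2 j3 j4] := jumpE (par_X v) (par_T v) (Gmx (par_a v) (par_b v)) B z.
have [g1 g2 g3 g4] := GmxE (par_a v) (par_b v).
case: (ord2 j) => ->; case: (ord2 k) => ->; rewrite /VA /=.
- by rewrite j1 g1 (ev_mul hs haA hz hx) se ev_aA.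
- rewrite j2 g2 (ev_mul w01 pm hz hx) (ev_mul hs hbA' hz hx) se ev_bA'// ev_ph//.
  by congr (_ * cexp _); rewrite rmorphN1 mulN1r.
- rewrite j3 g3 (ev_mul w10 p1 hz hx) (ev_mul hs (l1Z (-1) hbA).1 hz hx) se.
  by rewrite (evZ _ hbA hz hx) ev_bA// ev_ph// mulN1r mul1r.
- by rewrite j4 g4 (ev_mul hs haA' hz hx) se ev_aA'.
Qed.

End JumpElement.

(** * Existence and analyticity *)

Section Assembly.
Variable R : realType.
Local Notation C := R[i].
Implicit Types (p q V W : 'I_2 -> 'I_2 -> int -> C).

(** The adjugate, which is the inverse at determinant 1. Its entries are signed entries of the
    matrix, so it extends to families of coefficients as [adjf]. *)
Definition adj2 (M : 'M[C]_2) : 'M[C]_2 := mx2 (M 1 1) (- M 0 1) (- M 1 0) (M 0 0).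

Lemma adj2E (M : 'M[C]_2) : [/\ adj2 M 0 0 = M 1 1, adj2 M 0 1 = - M 0 1,
  adj2 M 1 0 = - M 1 0 & adj2 M 1 1 = M 0 0].
Proof. exact: mx2E. Qed.

Lemma mul_adj2 (M : 'M[C]_2) : det2 M = 1 -> M *m adj2 M = 1%:M.
Proof.
rewrite /det2 => h; have [a1 a2 a3 a4] := adj2E M.
apply/matrixP => i j; rewrite (mul2 M).
case: (ord2 i) => ->; case: (ord2 j) => ->; rewrite ?a1 ?a2 ?a3 ?a4 [RHS]mxE /=.
- by rewrite -h; ring.
- by ring.
- by ring.
- by rewrite -h; ring.
Qed.

Lemma adj2_mul (M : 'M[C]_2) : det2 M = 1 -> adj2 M *m M = 1%:M.
Proof. by move=> /mul_adj2 /mulmx1C. Qed.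

Lemma conjc_cexp (w : C) : conjc (cexp w) = cexp (conjc w).
Proof.
case: w => x y; rewrite /cexp /= cosN sinN; congr (_ +i* _).
  by rewrite !mul0r.
by rewrite !mul0r !addr0 mulrN.
Qed.

Lemma conjc_phase (X T B : R) (z : C) :
  conjc (phase X T B z) = phase X T B (conjc z).
Proof.
have hM (x y : C) : conjc (x * y) = conjc x * conjc y by exact: rmorphM.
have hr (r : R) : conjc (r%:C) = r%:C by rewrite /= oppr0.
have h2 : conjc (2 : C) = 2 by exact: rmorph_nat.
have hV (x : C) : conjc x^-1 = (conjc x)^-1 by exact: fmorphV.
have hD (x y : C) : conjc (x + y) = conjc x + conjc y by exact: rmorphD.
by rewrite /phase expr2 !hD !hM !hr h2 hV.
Qed.

(* Schwarz symmetry of the jump: the inverse of J(z) is the adjoint of J(z* ). *)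
Lemma jump_conj X T B (a b z : C) i j : (a, b) != (0, 0) ->
  conjc (jump X T (Gmx a b) B (conjc z) j i) = adj2 (jump X T (Gmx a b) B z) i j.
Proof.
move=> ab0.
have hM (x y : C) : conjc (x * y) = conjc x * conjc y by exact: rmorphM.
have hN (x : C) : conjc (- x) = - conjc x by exact: rmorphN.
have h2 : conjc (2 : C) = 2 by exact: rmorph_nat.
have hi : conjc ('i : C) = - 'i by exact: conjCi.
have [a1 a2 a3 a4] := adj2E (jump X T (Gmx a b) B z).
have [j1 j2 j3 j4] := jumpE X T (Gmx a b) B z.
have [k1 k2 k3 k4] := jumpE X T (Gmx a b) B (conjc z).
have [g1 g2 g3 g4] := GmxE a b.
have sr : conjc (sqrtC (den a b))^-1 = (sqrtC (den a b))^-1.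
  apply/CrealP; rewrite realE invr_ge0 sqrtC_ge0 ltW//; exact: den_gt0.
set w := 'i * phase X T B z in j2 j3.
set w' := 'i * phase X T B (conjc z) in k2 k3.
have ww : conjc w' = - w.
  by rewrite /w' hM -conjc_phase conjcK hi mulNr.
have E1 : conjc (cexp (2 * w')) = cexp (- (2 * w)).
  by rewrite conjc_cexp hM ww h2 mulrN.
have E2 : conjc (cexp (- (2 * w'))) = cexp (2 * w).
  by rewrite conjc_cexp hN hM ww h2 mulrN opprK.
case: (ord2 i) => ->; case: (ord2 j) => ->.
- by rewrite a1 j4 k1 g1 g4 hM sr.
- by rewrite a2 j2 k3 g2 g3 hM E1 hM sr hN mulrN mulNr.
- by rewrite a3 j3 k2 g2 g3 hM E2 hM sr conjcK mulrN mulNr opprK.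
- by rewrite a4 j1 k4 g1 g4 hM sr conjcK.
Qed.

Definition symM V (z : C) : 'M[C]_2 := \matrix_(i, j) sym (V i j) z.

Definition adjf (I : Type) (F : 'I_2 -> 'I_2 -> I -> C) i j (x : I) : C :=
  adj2 (\matrix_(k, l) F k l x) i j.

Lemma adjfE (I : Type) (F : 'I_2 -> 'I_2 -> I -> C) :
  [/\ adjf F 0 0 = F 1 1, adjf F 0 1 = (fun x => - F 0 1 x),
      adjf F 1 0 = (fun x => - F 1 0 x) & adjf F 1 1 = F 0 0].
Proof.
by split; apply/funext => x; have [a1 a2 a3 a4] := adj2E (\matrix_(k, l) F k l x);
  rewrite /adjf ?a1 ?a2 ?a3 ?a4 mxE.
Qed.

Lemma adjf_l1 (I : nmodType) (F : 'I_2 -> 'I_2 -> I -> C) : mat_l1 F -> mat_l1 (adjf F).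
Proof.
move=> hF; have [a1 a2 a3 a4] := adjfE F => i j.
case: (ord2 i) => ->; case: (ord2 j) => ->.
- by rewrite a1.
- by rewrite a2; exact: (l1N (hF 0 1)).
- by rewrite a3; exact: (l1N (hF 1 0)).
- by rewrite a4.
Qed.

Lemma symM_adjf V z : mat_l1 V -> nrm z = 1 -> symM (adjf V) z = adj2 (symM V z).
Proof.
move=> hV hz; have [a1 a2 a3 a4] := adjfE V; have [b1 b2 b3 b4] := adj2E (symM V z).
apply/matrixP => i j; rewrite mxE.
case: (ord2 i) => ->; case: (ord2 j) => ->; rewrite ?a1 ?a2 ?a3 ?a4 ?b1 ?b2 ?b3 ?b4 mxE//.
  exact: (symN (hV 0 1) hz).
exact: (symN (hV 1 0) hz).
Qed.

Lemma sym_delta (c z : C) : sym (delta (0 : int) c) z = c.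
Proof.
rewrite /sym (@csum1 _ _ _ (0 : int)) /delta ?eqxx ?expr0z ?mulr1//.
by move=> b /negbTE ->; rewrite mul0r.
Qed.

(* p and q are the Laurent coefficients of P inside the disk and of P - 1 outside
   it, one family for each matrix entry. *)
Definition coef_solution (J : C -> 'M[C]_2) p q :=
  [/\ mat_l1 p, mat_l1 q, forall i j n, p i j (Negz n) = 0,
      forall i j n, q i j (Posz n) = 0 &
      forall z, nrm z = 1 -> 1%:M + symM q z = symM p z *m J z].

(** The rows of the unknown decouple: row [i] is [symbol_solve] with the i-th unit row as prescribed
    nonnegative part. The second symbol is the adjugate family, and both unitarity hypotheses come
    from [jump_conj]. *)
Lemma coef_solution_exists (X T B : R) (a b : C) V : (a, b) != (0, 0) -> mat_l1 V ->
  (forall z, nrm z = 1 -> symM V z = jump X T (Gmx a b) B z) ->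
  exists p q, coef_solution (jump X T (Gmx a b) B) p q.
Proof.
move=> ab0 hV VJ; have hW := adjf_l1 hV.
have WJ z : nrm z = 1 -> symM (adjf V) z = adj2 (jump X T (Gmx a b) B z).
  by move=> hz; rewrite (symM_adjf hV hz) VJ.
have nc (z : C) : nrm z = 1 -> nrm (conjc z) = 1 by move=> hz; rewrite nrm_conj.
have Ve i j z : nrm z = 1 -> sym (V i j) z = jump X T (Gmx a b) B z i j.
  by move=> hz; rewrite -(VJ z hz) mxE.
have We i j z : nrm z = 1 -> sym (adjf V i j) z = adj2 (jump X T (Gmx a b) B z) i j.
  by move=> hz; rewrite -(WJ z hz) mxE.
have dJ z : det2 (jump X T (Gmx a b) B z) = 1 by rewrite det2_jump det2_Gmx.
have mulJ z i j : (jump X T (Gmx a b) B z *m adj2 (jump X T (Gmx a b) B z)) i j = (i == j)%:R.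
  by rewrite (mul_adj2 (dJ z)) [LHS]mxE.
have Jmul z i j : (adj2 (jump X T (Gmx a b) B z) *m jump X T (Gmx a b) B z) i j = (i == j)%:R.
  by rewrite (adj2_mul (dJ z)) [LHS]mxE.
have uV : unitary V.
  move=> z hz i j; have := mulJ z i j; rewrite mxE => <-; apply: eq_bigr => k _.
  by rewrite (Ve _ _ z hz) (Ve _ _ _ (nc z hz)) (jump_conj X T B z k j ab0).
have uW : unitary (adjf V).
  move=> z hz i j; have := Jmul z i j; rewrite mxE => <-; apply: eq_bigr => k _.
  rewrite (We _ _ z hz) (We _ _ _ (nc z hz)) -(jump_conj X T B (conjc z) j k ab0).
  by rewrite !conjcK.
have WV z : nrm z = 1 -> forall i j,
    \sum_k sym (adjf V i k) z * sym (V k j) z = (i == j)%:R.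
  move=> hz i j; have := Jmul z i j; rewrite mxE => <-; apply: eq_bigr => k _.
  by rewrite (We _ _ z hz) (Ve _ _ z hz).
pose e i (j : 'I_2) := delta (0 : int) ((i == j)%:R : C).
have he i : rows_l1 (e i) by move=> j; exact: (delta_l1 _ _).1.
have eneg i j n : e i j (Negz n) = 0 by [].
have [p hp] := choice (fun i => symbol_solve hV hW uV uW WV (he i) (eneg i)).
have pl i : rows_l1 (p i) by have [] := hp i.
exists p, (fun i j n => rmul (p i) V j n - e i j n); split.
- by move=> i j; have [] := hp i.
- by move=> i j; exact: (l1B ((rmul_l1 (pl i) hV).1 j) (he i j)).1.
- by move=> i j n; have [_ + _] := hp i; exact.
- by move=> i j n; have [_ _ h] := hp i; rewrite h subrr.
- move=> z hz; apply/matrixP => i j.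
  rewrite [LHS]mxE [1%:M i j]mxE [symM _ _ i j]mxE.
  rewrite (symD ((rmul_l1 (pl i) hV).1 j) (l1N (he i j)) hz) (symN (he i j) hz).
  rewrite sym_delta addrCA subrr addr0 (sym_rmul j (pl i) hV hz) mxE.
  by apply: eq_bigr => k _; rewrite mxE (Ve _ _ z hz).
Qed.

(** The second conclusion makes the adjugate of [symM p] its inverse on the circle, as required for
    perturbing a solution at a base point. *)
Lemma rhp_of_coef (X T B : R) (G : 'M[C]_2) p q :
  coef_solution (jump X T G B) p q ->
  RHP_solution X T G B (fun z => \matrix_(i, j)
    if nrm z < 1 then cin (p i j) z else (i == j)%:R + cout (q i j) z) /\
  (det2 G = 1 -> forall z, nrm z = 1 -> det2 (symM p z) = 1).
Proof.
move=> [hp hq pneg qpos pq].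
have sp i j z : nrm z = 1 -> sym (p i j) z = cin (p i j) z.
  by move=> hz; rewrite (symE (hp i j) hz) cout0 ?addr0//; exact: pneg.
have sq i j z : nrm z = 1 -> sym (q i j) z = cout (q i j) z.
  by move=> hz; rewrite (symE (hq i j) hz) cin0 ?add0r//; exact: qpos.
have [|||||| h1 h2 h3 h4 h5] := @mk_solution R X T B G (fun i j => cin (p i j))
  (fun i j z => (i == j)%:R + cout (q i j) z).
- by move=> i j z; exact: cin_deriv.
- by move=> i j; exact: cin_bv.
- move=> i j z hz; exact: (deriv1D (@deriv1_cst R (i == j)%:R z) (cout_deriv (hq i j) hz)).
- move=> i j; exact: (bvD (bv_cst _ _) (cout_bv (hq i j))).
- move=> i j; apply/cinftyP => e e0; have [M hM] := cout_oo (hq i j) e0.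
  by exists M => z hz; rewrite addrC addKr; exact: hM.
- move=> i k z hz; have : (1%:M + symM q z) i k = (symM p z *m jump X T G B z) i k by rewrite (pq z hz).
  rewrite [LHS]mxE [1%:M i k]mxE [symM _ _ i k]mxE (sq i k z hz) => ->.
  by rewrite [LHS]mxE; apply: eq_bigr => j _; rewrite [symM _ _ _ _]mxE (sp i j z hz).
split.
  split=> //; eexists; eexists; split; [exact: h2|exact: h3|] => z /circleE hz.
  by rewrite (h4 z hz) /jump !mulmxA.
move=> dG z hz; have [_ d] := rhp_det dG h1 h2 h3 h4 h5.
rewrite -(d z hz); congr det2; apply/matrixP => i j.
by rewrite !mxE sp.
Qed.

End Assembly.

(** * Factorization near the identity *)

Section Perturbation.
Variable R : realType.
Local Notation C := R[i].
Variable n : nat.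
Local Notation A := (int * {ffun 'I_n -> nat})%type.
Implicit Types (F G : 'I_2 -> 'I_2 -> A -> C) (f g : A -> C) (x : 'rV[R]_n).

Definition evM F (z : C) x : 'M[C]_2 := \matrix_(i, j) ev (F i j) z x.
Definition mmul F G i := rmul (F i) G.

Lemma mmul_l1 F G : mat_l1 F -> mat_l1 G -> mat_l1 (mmul F G).
Proof. by move=> hF hG i; exact: (rmul_l1 (hF i) hG).1. Qed.

Lemma evM_mmul F G z x : mat_l1 F -> mat_l1 G -> nrm z = 1 -> unit_cube x ->
  evM (mmul F G) z x = evM F z x *m evM G z x.
Proof.
move=> hF hG hz hx; apply/matrixP => i j; rewrite [LHS]mxE [RHS]mxE.
rewrite (ev_rmul j (hF i) hG hz hx); apply: eq_bigr => k _.
by rewrite [evM F z x i k]mxE [evM G z x k j]mxE.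
Qed.

Lemma evN f z x : l1 f -> nrm z = 1 -> unit_cube x ->
  ev (fun a => - f a) z x = - ev f z x.
Proof.
move=> hf hz hx; rewrite -mulN1r -(evZ (-1) hf hz hx).
by congr (ev _ z x); apply/funext => a; rewrite mulN1r.
Qed.

Lemma evM_adjf F z x : mat_l1 F -> nrm z = 1 -> unit_cube x ->
  evM (adjf F) z x = adj2 (evM F z x).
Proof.
move=> hF hz hx; have [a1 a2 a3 a4] := adjfE F; have [b1 b2 b3 b4] := adj2E (evM F z x).
apply/matrixP => i j; rewrite [LHS]mxE.
case: (ord2 i) => ->; case: (ord2 j) => ->.
- by rewrite a1 b1 [RHS]mxE.
- by rewrite a2 b2 (evN (hF 0 1) hz hx) [evM _ _ _ _ _]mxE.
- by rewrite a3 b3 (evN (hF 1 0) hz hx) [evM _ _ _ _ _]mxE.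
- by rewrite a4 b4 [RHS]mxE.
Qed.

Definition unitf : 'I_2 -> 'I_2 -> A -> C := fun i j => delta 0 (i == j)%:R.

Lemma unitf_l1 : mat_l1 unitf.
Proof. by move=> i j; exact: (delta_l1 _ _).1. Qed.

Lemma evM_unitf z x : evM unitf z x = 1%:M.
Proof.
by apply/matrixP => i j; rewrite mxE [RHS]mxE (ev_delta _ _ z x) chi0 mulr1.
Qed.

Definition madd F G i j (a : A) : C := F i j a + G i j a.

Lemma madd_l1 F G : mat_l1 F -> mat_l1 G -> mat_l1 (madd F G).
Proof. by move=> hF hG i j; exact: (l1D (hF i j) (hG i j)).1. Qed.

Lemma evM_madd F G z x : mat_l1 F -> mat_l1 G -> nrm z = 1 -> unit_cube x ->
  evM (madd F G) z x = evM F z x + evM G z x.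
Proof.
move=> hF hG hz hx; apply/matrixP => i j; rewrite [LHS]mxE [RHS]mxE.
by rewrite (ev_add (hF i j) (hG i j) hz hx) [evM F z x i j]mxE [evM G z x i j]mxE.
Qed.

Definition mopp F i j (a : A) : C := - F i j a.

Lemma mopp_l1 F : mat_l1 F -> mat_l1 (mopp F).
Proof. by move=> hF i j; exact: (l1N (hF i j)). Qed.

Lemma evM_mopp F z x : mat_l1 F -> nrm z = 1 -> unit_cube x ->
  evM (mopp F) z x = - evM F z x.
Proof.
move=> hF hz hx; apply/matrixP => i j; rewrite [LHS]mxE [RHS]mxE.
by rewrite (evN (hF i j) hz hx) [evM F z x i j]mxE.
Qed.

Lemma conv_pos f g m al : (forall m al, f (Negz m, al) = 0) ->
  (forall m al, g (Negz m, al) = 0) -> conv f g (Negz m, al) = 0.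
Proof.
move=> hf hg; rewrite /conv /push -[RHS](csum0 R (A * A)%type).
apply: eq_csum => -[[[a|a] be] [[b|b] ga]] /=; rewrite ?hf ?hg ?mul0r ?mulr0 //; by case: ifP.
Qed.

Lemma conv_neg f g m al : (forall m al, f (Posz m, al) = 0) ->
  (forall m al, g (Posz m, al) = 0) -> conv f g (Posz m, al) = 0.
Proof.
move=> hf hg; rewrite /conv /push -[RHS](csum0 R (A * A)%type).
apply: eq_csum => -[[[a|a] be] [[b|b] ga]] /=; rewrite ?hf ?hg ?mul0r ?mulr0 //; by case: ifP.
Qed.

Lemma mmul_pos F G i j m al : (forall i j m al, F i j (Negz m, al) = 0) ->
  (forall i j m al, G i j (Negz m, al) = 0) -> mmul F G i j (Negz m, al) = 0.
Proof. by move=> hF hG; rewrite /mmul /rmul big1// => k _; exact: conv_pos. Qed.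

Lemma mmul_neg F G i j m al : (forall i j m al, F i j (Posz m, al) = 0) ->
  (forall i j m al, G i j (Posz m, al) = 0) -> mmul F G i j (Posz m, al) = 0.
Proof. by move=> hF hG; rewrite /mmul /rmul big1// => k _; exact: conv_neg. Qed.

Definition embM (p : 'I_2 -> 'I_2 -> int -> C) : 'I_2 -> 'I_2 -> A -> C :=
  fun i j => emb (p i j).

Lemma embM_l1 p : mat_l1 p -> mat_l1 (embM p).
Proof. by move=> hp i j; exact: emb_l1. Qed.

Lemma evM_embM p z x : mat_l1 p -> nrm z = 1 -> unit_cube x ->
  evM (embM p) z x = symM p z.
Proof.
by move=> hp hz hx; apply/matrixP => i j; rewrite mxE [RHS]mxE; exact: (ev_emb (hp i j) hz hx).
Qed.

Lemma symM_spec F z x : mat_l1 F -> nrm z = 1 -> unit_cube x ->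
  symM (fun i j => spec x (F i j)) z = evM F z x.
Proof.
by move=> hF hz hx; apply/matrixP => i j; rewrite mxE [RHS]mxE; exact: (sym_spec (hF i j) hz hx).
Qed.

(* If [1 + Delta] has constant part 1, then after rescaling the parameters it
   factors as [E (1 + Delta) = 1 + O] with [E] analytic inside and [O] analytic
   outside the circle. *)
Lemma factor_near_unit F : mat_l1 F -> (forall z, nrm z = 1 -> evM F z 0 = 1%:M) ->
  exists2 t : R, 0 < t <= 1 & exists E O, [/\ mat_l1 E, mat_l1 O,
    forall i j m al, E i j (Negz m, al) = 0, forall i j m al, O i j (Posz m, al) = 0 &
    forall z x, nrm z = 1 -> unit_cube x ->
      evM E z x *m evM F z (t *: x) = 1%:M + evM O z x].
Proof.
move=> hF F0; have u0 : unit_cube (0 : 'rV[R]_n) by move=> k; rewrite mxE normr0.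
have hU := unitf_l1; have hD := madd_l1 hF (mopp_l1 hU).
pose D := madd F (mopp unitf).
have D0 i j m : D i j (m, 0) = 0.
  apply: (sym_inj0 (slice0_l1 (hD i j))) => z hz.
  rewrite -(sym_spec0 (hD i j) hz).
  have : evM D z 0 i j = 0.
    by rewrite /D (evM_madd hF (mopp_l1 hU) hz u0) (evM_mopp hU hz u0) evM_unitf F0// subrr mxE.
  by rewrite mxE.
have M0 := mn_ge0 D.
(* With this [t] the rescaled [D] has norm at most [t * mn D], hence at most 1/2. *)
pose t := (2 * (mn D + 1))^-1.
have t0 : 0 < t by rewrite invr_gt0; lra.
have tE : t * (2 * (mn D + 1)) = 1 by rewrite mulVf// gt_eqF//; lra.
have t1 : t <= 1 by rewrite invf_le1//; lra.
have t01 : 0 <= t <= 1 by rewrite (ltW t0).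
pose Dt i j := rescale t (D i j).
have hDt : mat_l1 Dt by move=> i j; exact: (rescale_l1 t01 (hD i j) (D0 i j)).1.
have Dt2 : mn Dt <= 2^-1.
  apply: (@le_trans _ _ (t * mn D)); last by lra.
  rewrite /mn mulr_sumr; apply: ler_sum => i _; rewrite mulr_sumr; apply: ler_sum => j _.
  exact: (rescale_l1 t01 (hD i j) (D0 i j)).2.
have uneg i j m al : unitf i j (Negz m, al) = 0 by [].
have [E hE] := choice (fun i => small_norm hDt Dt2 (hU i) (uneg i)).
have El : mat_l1 E by move=> i j; have [] := hE i.
have EDl := mmul_l1 El hDt.
exists t; first by rewrite t0.
(* The second family is E (1 + Dt) - 1; its nonnegative coefficients vanish by the choice of [E]. *)
exists E, (madd (madd E (mmul E Dt)) (mopp unitf)); split=> //.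
- exact: (madd_l1 (madd_l1 El EDl) (mopp_l1 hU)).
- by move=> i j m al; have [_ + _] := hE i; exact.
- by move=> i j m al; have [_ _ h] := hE i; rewrite /madd /mopp [X in X + _](h j m al) subrr.
- move=> z x hz hx.
  have hx' : unit_cube (t *: x).
    by move=> k; rewrite mxE normrM (gtr0_norm t0) mulr_ile1// ltW.
  have eD : evM Dt z x = evM F z (t *: x) - 1%:M.
    transitivity (evM D z (t *: x)).
      by apply/matrixP => i j; rewrite mxE [RHS]mxE; exact: ev_rescale.
    by rewrite /D (evM_madd hF (mopp_l1 hU) hz hx') (evM_mopp hU hz hx') evM_unitf.
  rewrite (evM_madd (madd_l1 El EDl) (mopp_l1 hU) hz hx) (evM_madd El EDl hz hx).
  rewrite (evM_mopp hU hz hx) evM_unitf (evM_mmul El hDt hz hx) eD mulmxBr mulmx1.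
  by rewrite (addrC (evM E z x)) subrK addrC subrK.
Qed.

End Perturbation.

(** * Solutions near a base point *)

Section Local.
Variables (R : realType) (B : R).
Local Notation C := R[i].
Local Notation A := (int * {ffun 'I_6 -> nat})%type.

Definition jump_at (v : 'rV[R]_6) : C -> 'M[C]_2 :=
  jump (par_X v) (par_T v) (Gmx (par_a v) (par_b v)) B.

(** Only the base point is solved by the finite-rank argument; nearby solutions are multiplicative
    corrections of that one. [p] and [q] are fixed families, and the parameters enter through [spec]
    alone, which is what makes the dependence analytic. *)
Lemma local_family (v0 : 'rV[R]_6) : (par_a v0, par_b v0) != (0, 0) ->
  exists2 rho : R, 0 < rho & exists p q : 'I_2 -> 'I_2 -> A -> C,
  [/\ mat_l1 p, mat_l1 q & forall x, unit_cube x -> let v := v0 + rho *: x in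
    (par_a v, par_b v) != (0, 0) /\
    coef_solution (jump_at v) (fun i j => spec x (p i j)) (fun i j => spec x (q i j))].
Proof.
move=> ab0; have [rho r0 [V [hV VE]]] := jump_element B ab0.
have u0 : unit_cube (0 : 'rV[R]_6) by move=> k; rewrite mxE normr0.
have VJ z x : nrm z = 1 -> unit_cube x -> evM V z x = jump_at (v0 + rho *: x) z.
  by move=> hz hx; apply/matrixP => i j; rewrite mxE (VE z x hz hx).2.
pose V0 i j (m : int) := V i j (m, 0).
have hV0 : mat_l1 V0 by move=> i j; exact: (slice0_l1 (hV i j)).
have V0J z : nrm z = 1 -> symM V0 z = jump_at v0 z.
  move=> hz; rewrite -[v0]addr0 -(scaler0 _ rho) -(VJ z 0 hz u0).
  by apply/matrixP => i j; rewrite mxE [RHS]mxE (sym_spec0 (hV i j) hz).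
have [p0 [q0 cs]] := coef_solution_exists ab0 hV0 V0J.
have [_ det0] := rhp_of_coef cs; have {det0} dP := det0 (det2_Gmx ab0).
have [hp hq pneg qpos pq] := cs.
have dJ z : det2 (jump_at v0 z) = 1 by rewrite det2_jump (det2_Gmx ab0).
have hP : mat_l1 (embM p0 : 'I_2 -> 'I_2 -> A -> C) := embM_l1 6 hp.
have hQ : mat_l1 (embM q0 : 'I_2 -> 'I_2 -> A -> C) := embM_l1 6 hq.
have hW : mat_l1 (embM (adjf V0) : 'I_2 -> 'I_2 -> A -> C) := embM_l1 6 (adjf_l1 hV0).
have hPa := adjf_l1 hP.
have h1 := mmul_l1 hP hV; have h2 := mmul_l1 h1 hW; have hF := mmul_l1 h2 hPa.
have FE z x : nrm z = 1 -> unit_cube x ->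
    evM (mmul (mmul (mmul (embM p0) V) (embM (adjf V0))) (adjf (embM p0))) z x =
    symM p0 z *m jump_at (v0 + rho *: x) z *m adj2 (jump_at v0 z) *m adj2 (symM p0 z).
  move=> hz hx; rewrite (evM_mmul h2 hPa hz hx) (evM_mmul h1 hW hz hx) (evM_mmul hP hV hz hx).
  rewrite (evM_adjf hP hz hx) (evM_embM hp hz hx) (evM_embM (adjf_l1 hV0) hz hx).
  by rewrite (symM_adjf hV0 hz) (V0J z hz) (VJ z x hz hx).
have F0 z : nrm z = 1 ->
    evM (mmul (mmul (mmul (embM p0) V) (embM (adjf V0))) (adjf (embM p0))) z 0 = 1%:M.
  move=> hz; rewrite (FE z 0 hz u0) scaler0 addr0 -(mulmxA (symM p0 z)).
  by rewrite (mul_adj2 (dJ z)) mulmx1 (mul_adj2 (dP z hz)).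
have [t /andP[t0 t1] [E [] O [hE hO Eneg Opos EO]]] := factor_near_unit hF F0.
exists (rho * t); first exact: mulr_gt0.
have hOQ := mmul_l1 hO hQ.
(* The second family encodes (1 + O) (1 + q0) - 1, since [coef_solution] stores the exterior part
   without its leading 1. *)
exists (mmul E (embM p0)), (madd (madd O (embM q0)) (mmul O (embM q0))).
have Hp := mmul_l1 hE hP; have hOq := madd_l1 hO hQ; have Hq := madd_l1 hOq hOQ.
split; [exact: Hp|exact: Hq|move=> x hx v].
have hx' : unit_cube (t *: x).
  by move=> k; rewrite mxE normrM (gtr0_norm t0) mulr_ile1// ltW.
have vE : v0 + rho *: (t *: x) = v by rewrite scalerA.
have n1 : nrm (1 : C) = 1 by exact: nrm1.
(* [VE] delivers the nonvanishing of (a, b) at a point of the circle; the point 1 serves. *)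
split; first by have [+ _] := VE 1 _ n1 hx'; rewrite vE.
have specn (f : A -> C) m : (forall al, f (m, al) = 0) -> spec x f m = 0.
  move=> h; rewrite /spec -[RHS](csum0 R {ffun 'I_6 -> nat}).
  by apply: eq_csum => al; rewrite h mul0r.
split.
- by move=> i j; exact: (spec_l1 (Hp i j) hx).
- by move=> i j; exact: (spec_l1 (Hq i j) hx).
- move=> i j m; apply: specn => al; apply: mmul_pos => // k l m' al'.
  by rewrite /embM /emb /=; case: ifP => // _; exact: pneg.
- have Qpos k l m' al' : embM q0 k l (Posz m', al' : {ffun 'I_6 -> nat}) = 0.
    by rewrite /embM /emb /=; case: ifP => // _; exact: qpos.
  move=> i j m; apply: specn => al; rewrite /madd Opos Qpos mmul_neg//.
  by rewrite !addr0.
- move=> z hz; rewrite (symM_spec Hq hz hx) (symM_spec Hp hz hx).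
  rewrite (evM_madd hOq hOQ hz hx) (evM_madd hO hQ hz hx) (evM_mmul hO hQ hz hx).
  rewrite (evM_mmul hE hP hz hx) (evM_embM hp hz hx) (evM_embM hq hz hx).
  have := EO z x hz hx; rewrite (FE z _ hz hx') vE.
  have := pq z hz; have := adj2_mul (dJ z); have := adj2_mul (dP z hz).
  rewrite -/(jump_at v0 z).
  move: (jump_at v z) (jump_at v0 z) (symM p0 z) (symM q0 z) (evM E z x) (evM O z x).
  move=> Jv J0 P Q Ex Ox PP JJ PQ EE.
  (* Multiplying E P Jv J0^-1 P^-1 = 1 + O on the right by 1 + Q = P J0 cancels the inverses. *)
  transitivity ((1%:M + Ox) *m (1%:M + Q)).
    by rewrite mulmxDl !mulmxDr !mul1mx !mulmx1 -!addrA; congr (_ + _); rewrite addrCA.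
  by rewrite -EE PQ -!mulmxA (mulmxA (adj2 P)) PP mul1mx JJ mulmx1.
Qed.

End Local.

Section Main.
Variables (R : realType) (B : R).
Local Notation C := R[i].

Lemma rhp_exists (X T : R) (a b : C) : (a, b) != (0, 0) ->
  exists P, RHP_solution X T (Gmx a b) B P.
Proof.
case: a b => [a1 a2] [b1 b2] ab0.
pose v0 : 'rV[R]_6 := \row_k [:: X; T; a1; a2; b1; b2]`_k.
have eX : par_X v0 = X by rewrite /par_X mxE.
have eT : par_T v0 = T by rewrite /par_T mxE.
have ea : par_a v0 = a1 +i* a2 by rewrite /par_a !mxE.
have eb : par_b v0 = b1 +i* b2 by rewrite /par_b !mxE.
have u0 : unit_cube (0 : 'rV[R]_6) by move=> k; rewrite mxE normr0.
have [|rho r0 [p [q [hp hq /(_ 0 u0)[_]]]]] := @local_family R B v0.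
  by rewrite ea eb.
rewrite scaler0 addr0 /jump_at eX eT ea eb => /rhp_of_coef[h _].
by eexists; exact: h.
Qed.

(** [F] is an arbitrary choice of solutions, with no regularity in [v] assumed; near [v0],
    uniqueness identifies it with the local family. *)
Lemma analytic_entry (v0 : 'rV[R]_6) (F : 'rV[R]_6 -> C -> 'M[C]_2) (z : C) i j :
  (par_a v0, par_b v0) != (0, 0) ->
  (forall v, (par_a v, par_b v) != (0, 0) ->
     RHP_solution (par_X v) (par_T v) (Gmx (par_a v) (par_b v)) B (F v)) ->
  nrm z != 1 -> real_analytic_at (fun v => F v z i j) v0.
Proof.
move=> ab0 hF hz; have [rho r0 [p [q [hp hq pq]]]] := local_family B ab0.
have FE x : unit_cube x -> F (v0 + rho *: x) z i j =
    if nrm z < 1 then cin (spec x (p i j)) z else (i == j)%:R + cout (spec x (q i j)) z.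
  move=> hx; have [ab /rhp_of_coef[h _]] := pq x hx.
  by rewrite (rhp_unique (det2_Gmx ab) h (hF _ ab) hz) mxE.
have [h|h|h] := ltgtP (nrm z) 1; last by rewrite h eqxx in hz.
  have [c hc cE] := cin_series (hp i j) (ltW h).
  by apply: (analytic_of_series r0 hc) => x hx; rewrite (FE x hx) h cE.
have [c hc cE] := cout_series (hq i j) (ltW h).
(* The leading constant of the exterior solution is one more coefficient, at the multi-index 0. *)
have hd := (delta_l1 (0 : {ffun 'I_6 -> nat}) ((i == j)%:R : C)).1.
apply: (analytic_of_series r0 (l1D hd hc).1) => x hx.
have h1 (f : {ffun 'I_6 -> nat} -> C) : l1 f -> l1 (fun al => f al * (monomial al x)%:C).
  move=> hf; have [] := @l1_mulb _ _ f (fun al => (monomial al x)%:C) 1 hf _ ler01 => //.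
  by move=> al; rewrite nrmC monomial_le1.
rewrite (FE x hx) ltNge (ltW h) /= (cE x hx).
transitivity (csum (fun al => delta 0 (i == j)%:R al * (monomial al x)%:C +
                             c al * (monomial al x)%:C)).
  rewrite (csumD (h1 _ hd) (h1 _ hc)); congr (_ + _).
  rewrite (@csum1 _ _ _ (0 : {ffun 'I_6 -> nat})) /delta ?eqxx.
    by rewrite /monomial big1 ?mulr1// => k _; rewrite ffunE expr0.
  by move=> al /negbTE ->; rewrite mul0r.
by apply: eq_csum => al; rewrite mulrDl.
Qed.

End Main.

Theorem proposition1p1 (R : realType) (B : R) (B_gt0 : 0 < B) :
  exists P : R -> R -> R[i] -> R[i] -> R[i] -> 'M[R[i]]_2,
    (forall (X T : R) (a b : R[i]), (a, b) != (0, 0) ->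
       RHP_solution X T (Gmx a b) B (P X T a b) /\
       forall Q : R[i] -> 'M[R[i]]_2, RHP_solution X T (Gmx a b) B Q ->
         forall z : R[i], `|z| != 1 -> Q z = P X T a b z) /\
    (forall (z : R[i]) (i j : 'I_2), `|z| != 1 ->
       real_analytic_on [set v : 'rV[R]_6 | (par_a v, par_b v) != (0, 0)]
         (fun v => P (par_X v) (par_T v) (par_a v) (par_b v) z i j)).
Proof.
have ex (w : R * R * (R[i] * R[i])) : exists P : R[i] -> 'M[R[i]]_2,
    w.2 != (0, 0) -> RHP_solution w.1.1 w.1.2 (Gmx w.2.1 w.2.2) B P.
  case: w => [[X T] [a b]] /=; have [_|ab0] := eqVneq (a, b) (0, 0).
    (* A default value at (a, b) = (0, 0), so that [choice] yields a function of all parameters. *)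
    by exists (fun=> 0).
  by have [P hP] := rhp_exists B X T ab0; exists P.
have [F hF] := choice ex.
exists (fun X T a b => F (X, T, (a, b))); split.
  move=> X T a b ab0; have hP := hF (X, T, (a, b)) ab0; split=> // Q hQ z.
  by rewrite circ_neq; exact: (rhp_unique (det2_Gmx ab0) hP hQ).
move=> z i j; rewrite circ_neq => hz v0 ab0.
apply: (@analytic_entry R B v0
  (fun v => F (par_X v, par_T v, (par_a v, par_b v))) z i j ab0) => // v ab.
exact: (hF (par_X v, par_T v, (par_a v, par_b v)) ab).
Qed.
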